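(* Let $p$ be a prime and let $G = F_1 \times \ldots \times F_r$ be a non-trivial finite direct product of finitely generated free pro-$p$ groups $F_j$. Put $$d = \max \{ d(F_j) \mid 1 \le j \le r \} \qquad\text{and}\qquad t = \big| \{ j \mid 1 \le j \le r, \; d(F_j) = d \} \big|.$$ Let $\mathcal{S}$ be an iterated verbal filtration of $G$ and let $\mathcal{Z}$ be the Zassenhaus series of $G$. Then $G$ has the normal Hausdorff spectra $$\mathrm{hspec}_\trianglelefteq^{\mathcal{S}}(G) = \mathrm{hspec}_\trianglelefteq^{\mathcal{Z}}(G) = \{0, 1/t, \ldots, (t-1)/t, 1 \}.$$
   Context: Subgroups of pro-$p$ groups are understood to be closed and generation is topological; $d(H)$ denotes the minimal number of topological generators of a pro-$p$ group $H$. A filtration of a finitely generated infinite pro-$p$ group $G$ is a descending chain $\mathcal{S}\colon G_i$ (indexed by $i\in\mathbb{N}_0$ or $i\in\mathbb{N}$) of open normal subgroups with trivial intersection. A filtration $G_i$, $i\in\mathbb{N}_0$, is an iterated verbal filtration if $G_0=G$ and $G_i$ is a verbal subgroup of $G_{i-1}$ for each $i\in\mathbb{N}$. Here a verbal subgroup of a pro-$p$ group $H$ is a closed subgroup (topologically) generated by all values $w(h_1,\ldots,h_k)$, $h_1,\ldots,h_k\in H$, of group words $w$ in a given set of words $\mathcal{W}$ (which may depend on $i$). The Zassenhaus series $\mathcal{Z}\colon Z_i(G)$, $i\in\mathbb{N}$, is defined by $Z_1(G)=G$ and $Z_i(G) = Z_{\lceil i/p\rceil}(G)^p \prod_{1\le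 j<i}[Z_j(G),Z_{i-j}(G)]$ for $i\ge2$. The Hausdorff dimension of a closed subgroup $H\le G$ with respect to a filtration $\mathcal{S}$ is $$\mathrm{hdim}_G^{\mathcal{S}}(H) = \liminf_{i\to\infty} \frac{\log_p |HG_i:G_i|}{\log_p |G:G_i|}.$$ The normal Hausdorff spectrum is $\mathrm{hspec}_\trianglelefteq^{\mathcal{S}}(G) = \{\mathrm{hdim}_G^{\mathcal{S}}(N) \mid N \text{ a closed normal subgroup of } G\}$. *)

(* Defs.v *)
From HB Require Import structures.
From mathcomp Require Import all_boot all_order all_algebra finmap.
From mathcomp Require Import all_classical all_reals all_analysis.

Set Implicit Arguments.
Unset Strict Implicit.
Unset Printing Implicit Defensive.

Local Open Scope classical_set_scope.
Local Open Scope group_scope.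

(* Multiplicative, not necessarily commutative counterpart of
   topologicalZmodType. *)
HB.mixin Record Group_isTopGroup G of Group G & Topological G := {
  mulg_continuous : continuous (fun xy : G * G => xy.1 * xy.2) ;
  invg_continuous : continuous (fun x : G => x^-1)
}.

#[short(type="topGroupType")]
HB.structure Definition TopGroup :=
  {G of Group_isTopGroup G & Group G & Topological G}.

Lemma prod_topology_continuous (I : eqType) (T : I -> topologicalType)
    (Z : topologicalType) (f : Z -> prod_topology T) :
  (forall i, continuous (fun z => f z i)) -> continuous f.
Proof.
move=> cf z; apply/cvg_sup => i; move: z.
apply/(@continuousP _ (initial_topology (@^~ i))) => _ [B oB <-].
rewrite (_ : f @^-1` _ = (fun z => f z i) @^-1` B) //.
by apply: open_comp => // + _; exact: cf.
Qed.

Section DirectProduct.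
Context {I : eqType} (F : I -> topGroupType).
Local Notation G := (prod_topology F).
Implicit Types x y : G.

Definition dprod_one : G := fun i => 1.
Definition dprod_mul x y : G := fun i => x i * y i.
Definition dprod_inv x : G := fun i => (x i)^-1.

Fact dprod_mulA : associative dprod_mul.
Proof.
by move=> x y z; apply: functional_extensionality_dep => i; exact: mulgA.
Qed.

Fact dprod_mul1g : left_id dprod_one dprod_mul.
Proof.
by move=> x; apply: functional_extensionality_dep => i; exact: mul1g.
Qed.

Fact dprod_mulg1 : right_id dprod_one dprod_mul.
Proof.
by move=> x; apply: functional_extensionality_dep => i; exact: mulg1.
Qed.

Fact dprod_mulVg : left_inverse dprod_one dprod_inv dprod_mul.
Proof.
by move=> x; apply: functional_extensionality_dep => i; exact: mulVg.
Qed.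

Fact dprod_mulgV : right_inverse dprod_one dprod_inv dprod_mul.
Proof.
by move=> x; apply: functional_extensionality_dep => i; exact: mulgV.
Qed.

HB.instance Definition _ := isGroup.Build G
  dprod_mulA dprod_mul1g dprod_mulg1 dprod_mulVg dprod_mulgV.

Fact dprod_mul_continuous : continuous (fun xy : G * G => xy.1 * xy.2).
Proof.
apply: prod_topology_continuous => i xy.
apply: (@continuous_comp _ _ _ (fun uv : G * G => (uv.1 i, uv.2 i))
  (fun xy : F i * F i => xy.1 * xy.2)); last exact: mulg_continuous.
apply: cvg_pair.
  apply: (@cvg_comp _ _ _ fst (@proj I F i) (nbhs xy) (nbhs xy.1)).
    exact: cvg_fst.
  exact: proj_continuous.
apply: (@cvg_comp _ _ _ snd (@proj I F i) (nbhs xy) (nbhs xy.2)).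
  exact: cvg_snd.
exact: proj_continuous.
Qed.

Fact dprod_inv_continuous : continuous (fun x : G => x^-1).
Proof.
apply: prod_topology_continuous => i x.
apply: (@cvg_comp _ _ _ (@proj I F i) (fun y : F i => y^-1)
  (nbhs x) (nbhs (x i))).
  exact: proj_continuous.
exact: invg_continuous.
Qed.

HB.instance Definition _ := Group_isTopGroup.Build G
  dprod_mul_continuous dprod_inv_continuous.

End DirectProduct.

Section Subgroups.
Context {G : topGroupType}.
Implicit Types (A B H N : set G) (x y : G).

Definition subgroup H :=
  [/\ H 1, forall x y, H x -> H y -> H (x * y) & forall x, H x -> H x^-1].

Definition closed_subgroup H := subgroup H /\ closed H.

Definition normal_subgroup N :=
  subgroup N /\ forall x y, N x -> N (x ^ y).

(* the closed subgroup topologically generated by A *)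
Definition topgen A := smallest closed_subgroup A.

Definition mulset A B := [set x * y | x in A & y in B].

(* |A : H|, the number of left cosets xH with x in A; the value is 0 if there
   are infinitely many of them *)
Definition subg_index A H : nat :=
  #|` fset_set [set mulset [set x] H | x in A] |%fset.

Definition commutator_subgroup A B := topgen [set [~ x, y] | x in A & y in B].

Definition power_subgroup (n : nat) A := topgen [set x ^+ n | x in A].

(* A group word is the sequence of its letters, (k, false) standing for the
   k-th variable and (k, true) for its inverse. *)
Definition word_value (w : seq (nat * bool)) (h : nat -> G) : G :=
  \big[*%g/1]_(l <- w) (if l.2 then (h l.1)^-1 else h l.1).

Definition verbal_subgroup (W : set (seq (nat * bool))) H :=
  topgen [set x | exists w h,
    [/\ W w, forall k, H (h k) & x = word_value w h]].

Definition filtration (S : nat -> set G) :=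
  [/\ forall i, S i.+1 `<=` S i,
      forall i, open (S i) /\ normal_subgroup (S i) &
      \bigcap_i S i = [set 1]].

Definition iterated_verbal_filtration (S : nat -> set G) :=
  [/\ filtration S, S 0 = setT &
      forall i, exists W, S i.+1 = verbal_subgroup W (S i)].

End Subgroups.

Definition topgen_by (G : topGroupType) (n : nat) :=
  exists x : 'I_n -> G, topgen (range x) = setT.

(* d(G), the minimal number of topological generators; only meaningful if G is
   topologically finitely generated *)
Definition mingen (G : topGroupType) : nat :=
  xget 0 [set n | topgen_by G n /\ forall m, topgen_by G m -> n <= m].

(* A pro-p group is a profinite group (compact, Hausdorff, with the open
   subgroups forming a base of neighbourhoods of 1) all of whose open normal
   subgroups have p-power index. *)
Definition pro_p (p : nat) (G : topGroupType) :=
  [/\ compact [set: G], hausdorff_space G,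
      forall U, nbhs (1 : G) U -> exists2 H, open H /\ subgroup H & H `<=` U &
      forall N : set G, open N -> normal_subgroup N ->
        exists k, subg_index setT N = (p ^ k)%N].

Definition free_pro_p_on (p n : nat) (F : topGroupType) (x : 'I_n -> F) :=
  pro_p p F /\
  forall (H : topGroupType) (h : 'I_n -> H), pro_p p H ->
    exists! f : F -> H,
      [/\ continuous f, {morph f : a b / a * b} & forall i, f (x i) = h i].

Definition fg_free_pro_p (p : nat) (F : topGroupType) :=
  exists n (x : 'I_n -> F), free_pro_p_on p x.

Section Zassenhaus.
Context {G : topGroupType} (p : nat).

(* (i + p.-1) %/ p is the ceiling of i / p. *)
Definition zassenhaus_step (Z : nat -> set G) (i : nat) : set G :=
  mulset (power_subgroup p (Z ((i + p.-1) %/ p)))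
    (\big[mulset/[set 1]]_(1 <= j < i) commutator_subgroup (Z j) (Z (i - j))).

Fixpoint zassenhaus_rec (n i : nat) : set G :=
  if n is n'.+1 then
    if i <= 1 then setT else zassenhaus_step (zassenhaus_rec n') i
  else setT.

(* The series starts at the index 1; the value at 0 is a dummy. The bound i on
   the recursion depth is sufficient by zassenhausE. *)
Definition zassenhaus (i : nat) : set G := zassenhaus_rec i i.

Lemma zassenhaus1 : zassenhaus 1 = setT. Proof. by []. Qed.

Lemma zassenhausE i : prime p -> 2 <= i ->
  zassenhaus i = zassenhaus_step zassenhaus i.
Proof.
move=> p_pr i2; have p1 := prime_gt1 p_pr.
have ceil_lt k : 1 < k -> (k + p.-1) %/ p < k.
  case: k => [|[|k]] // _; rewrite ltn_divLR ?prime_gt0 //.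
  case: p p1 => [|[|q]] //= _.
  rewrite (_ : (k.+2 + q.+1 = q.+2 + k.+1)%N); last by rewrite addnC !addSnnS.
  by rewrite mulSn ltn_add2l ltn_Pmulr.
have stepE (Z1 Z2 : nat -> set G) k : 1 < k ->
    (forall j, j < k -> Z1 j = Z2 j) ->
    zassenhaus_step Z1 k = zassenhaus_step Z2 k.
  move=> k1 eqZ; rewrite /zassenhaus_step eqZ ?ceil_lt //; congr mulset.
  apply: eq_big_nat => j /andP[j0 jk]; rewrite !eqZ //.
  by rewrite ltn_subrL j0 (leq_trans _ k1).
have recE n m k : k <= n -> k <= m -> zassenhaus_rec n k = zassenhaus_rec m k.
  elim: n m k => [|n IHn] [|m] [|k] //= kn km.
  case: ltnP => // k1; apply: stepE => // j jk; apply: IHn.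
    by rewrite -ltnS (leq_trans jk).
  by rewrite -ltnS (leq_trans jk).
case: i i2 => // i i2; rewrite {1}/zassenhaus /= leqNgt i2 /=.
by apply: stepE => // j ji; apply: recE.
Qed.

End Zassenhaus.

Section HausdorffDimension.
Context (R : realType) (p : nat) {G : topGroupType} (S : nat -> set G).
Local Open Scope ring_scope.

Definition logp (n : nat) : R := ln n%:R / ln p%:R.

Definition hdim (H : set G) : R :=
  limn_inf (fun i => logp (subg_index (mulset H (S i)) (S i))
                     / logp (subg_index setT (S i))).

Definition normal_hspec : set R :=
  [set hdim N | N in [set N | closed N /\ normal_subgroup N]].

End HausdorffDimension.

Arguments hdim R p {G} S H.
Arguments normal_hspec R p {G} S _.

(* Main.v *)
(* For an open normal subgroup S_i of G and a normal subgroup N one has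
   log |N S_i : S_i| = log |G : S_i| - log |G : N S_i|, so everything rests on the
   following fact about a free pro-p group F of rank D >= 2: if N is a nontrivial
   normal subgroup, then log |F : N F_i| = o(log |F : F_i|), where F_i is the
   Zassenhaus series or an iterated verbal filtration.

   Zassenhaus series.  The Magnus embedding of F into power series in D
   noncommuting variables gives f in N a leading term of some degree n, hence a
   relation that, in any finite quotient killing f, expresses one of the D^n
   left-normed commutators of length n in terms of the others and of terms deeper
   in the series.  So the ranks of the factors of F / N Z_i grow at most like
   (D^n - 1)^(m/n), while elements with prescribed top words show that those of
   F / Z_i grow faster.

   Verbal filtration.  Put U = F_k, Q = F / U, and let K be the image of U in
   F / N F_i.  By Schreier's formula U has (D - 1)|Q| + 1 free generators, whereas
   K needs at most D |F : N U| generators, so about |N U : U| / 2 independent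
   homomorphisms from U map onto K; all of them kill F_i because F_i is an
   iterated verbal subgroup of U.  Hence log |U : F_i| >= (|N U : U| / 2) log |K|,
   and |N U : U| is unbounded since F is torsion-free.

   The chains of G are products of the chains of the factors, and factors of equal
   rank have chains of equal indices.  If d >= 2, then N contains [N, F_j], which
   is nontrivial whenever the projection of N to F_j is, as F_j is centreless; so
   only the number of factors of maximal rank to which N projects nontrivially
   matters.  If d = 1, then G is Z_p^t, the open subgroups in question are the
   G^(p^k), and the indices |N G^(p^k) : N G^(p^(k+1))| are nonincreasing in k. *)

From HB Require Import structures.
Require Import Defs.
From mathcomp Require Import all_boot all_order all_algebra all_fingroup all_solvable.
From mathcomp Require Import all_character finmap ring zify.
From mathcomp Require Import boolp functions.

Set Implicit Arguments.
Unset Strict Implicit.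
Unset Printing Implicit Defensive.

(** * Polynomial sequences in filtered groups *)

(** The upper bounds rest on one structural fact: modulo deeper terms, degree [m] of the Zassenhaus
    series is spanned by commutators of elements of degree [m - 1] with the free generators and by
    [p]-th powers from degree [m / p]. The recursive definition hides it; it amounts to reducing
    [[u, x ^ p]] to commutators with the whole group and to additivity of the power map. Both come
    from Lazard's calculus of polynomial sequences, because [p] divides ['C(p, i)] for [0 < i < p].
    Group computations take place in finite quotients. Closed subgroups are recovered by separation,
    and openness of the series by a bound on indices that is uniform in the quotient. The relator
    must have leading degree [n > 1]: the contribution of [p]-th powers grows like [D ^ (m %/ 2)]
    and has to stay below [(D ^ n).-1 ^ (m %/ n)]. A commutator inside [N] provides such a relator.
    Coefficients are taken in ['F_p] because [(1 + b) ^ p = 1 + b ^ p] there matches the [p]-power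
    part of the recursion. *)

Section Polynomial_sequences.
Local Open Scope group_scope.
Variables (gT : finGroupType) (E : nat -> {group gT}) (c : nat).
Hypothesis E_comm : forall a b, [~: E a, E b] \subset E (a + b).
Hypothesis E_desc : forall a, E a.+1 \subset E a.
Implicit Types f g : nat -> gT.

Definition fwd f n := (f n)^-1 * f n.+1.

(* [polyseq k s f]: the first [k] iterated differences of [f], hence all of
   them when the filtration is trivial from [s + k] on, lie in the terms of the
   filtration starting at [s]. *)
Fixpoint polyseq (k s : nat) f : Prop :=
  (forall n, f n \in E s) /\ (if k is k'.+1 then polyseq k' s.+1 (fwd f) else True).

Lemma E_le a b : a <= b -> E b \subset E a.
Proof.
move/subnKC<-; elim: (b - a) => [|n IH]; first by rewrite addn0.
by rewrite addnS (subset_trans (E_desc _)).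
Qed.

Lemma polyseqP k s f n : polyseq k s f -> f n \in E s.
Proof. by case: k => [|k] []. Qed.

Lemma polyseq_ext k s f g : f =1 g -> polyseq k s f -> polyseq k s g.
Proof.
elim: k s f g => [|k IH] s f g fg [Hf Df]; (split; first by move=> n; rewrite -fg) => //.
by apply: IH Df => n; rewrite /fwd !fg.
Qed.

Lemma polyseqW k s f : polyseq k.+1 s f -> polyseq k s f.
Proof.
elim: k s f => [|k IH] s f [Hf Df]; first by split.
by split=> //; apply: IH.
Qed.

Lemma polyseqS k s f : polyseq k s.+1 f -> polyseq k s f.
Proof.
elim: k s f => [|k IH] s f [Hf Df];
  (split; first by move=> n; apply: subsetP (E_desc s) _ (Hf n)) => //.
exact: IH.
Qed.

Lemma polyseq_shift k s t f : s <= t -> polyseq k t f -> polyseq k s f.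
Proof.
move=> /subnKC<-; elim: (t - s) => [|n IH]; first by rewrite addn0.
by rewrite addnS => /polyseqS/IH.
Qed.

Lemma comm_mem a b x y : x \in E a -> y \in E b -> [~ x, y] \in E (a + b).
Proof. by move=> xa yb; apply: (subsetP (E_comm a b)); apply: mem_commg. Qed.

Lemma fwdM f g n : fwd (fun i => f i * g i) n = fwd f n * [~ fwd f n, g n] * fwd g n.
Proof. by rewrite /fwd /commg /conjg !invMg !invgK !gnorm. Qed.

(* Lazard's theorem. *)
Lemma polyseqMR k :
  (forall s f g, polyseq k s f -> polyseq k s g -> polyseq k s (fun n => f n * g n)) /\
  (forall s t f g, polyseq k s f -> polyseq k t g ->
     polyseq k (s + t) (fun n => [~ f n, g n])).
Proof.
elim: k => [|k [IHM IHR]].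
  split=> [s f g [Hf _] [Hg _]|s t f g [Hf _] [Hg _]]; split=> // n.
    exact: groupM.
  exact: comm_mem.
split=> [s f g|s t f g] Pf Pg.
  case: (Pf) (Pg) => Hf Df [Hg Dg]; split=> [n|]; first exact: groupM.
  apply: polyseq_ext (fun n => esym (fwdM f g n)) _.
  apply: (IHM _ _ _ _ Dg); apply: IHM (Df) _.
  apply: (@polyseq_shift _ _ (s.+1 + s)); first by rewrite leq_addr.
  by apply: IHR => //; apply: polyseqW.
case: (Pf) (Pg) => Hf Df [Hg Dg]; split=> [n|]; first exact: comm_mem.
have {}Pf := polyseqW Pf; have {}Pg := polyseqW Pg.
(* With [f' = fwd f], [g' = fwd g] and [G = g * g'], the difference of [[f, g]] is [[f, g'] *
   [[f, g'], [f, g]] * [[f, g], g'] * [[f, G], f'] * [f', G]]. Each factor involves a difference, so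
   it lies one step deeper. *)
have Ph := IHR _ _ _ _ Pf Pg; have Q1 := IHR _ _ _ _ Pf Dg.
have Sg := IHM _ _ _ Pg (polyseqS Dg).
have Q2 := IHR _ _ _ _ Pf Sg; have Q3 := IHR _ _ _ _ Df Sg.
have R1 := IHR _ _ _ _ Q1 Ph; have R2 := IHR _ _ _ _ Ph Dg.
have R3 := IHR _ _ _ _ Q2 Df.
have up a (F : nat -> gT) : polyseq k a F -> (s + t).+1 <= a -> polyseq k (s + t).+1 F.
  by move=> PF sta; apply: polyseq_shift PF.
have {}Q1 := up _ _ Q1 (eq_leq (esym (addnS _ _))).
have {}R1 := up _ _ R1 ltac:(by rewrite addnS addSn ltnS leq_addr).
have {}R2 := up _ _ R2 ltac:(by rewrite addnS ltnS leq_addr).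
have {}R3 := up _ _ R3 ltac:(by rewrite addnS ltnS leq_addr).
have {}Q3 := up _ _ Q3 (eq_leq (esym (addSn _ _))).
apply: polyseq_ext (IHM _ _ _ (IHM _ _ _ (IHM _ _ _ (IHM _ _ _ Q1 R1) R2) R3) Q3) => n.
by rewrite /fwd /commg /conjg !invMg !invgK !gnorm.
Qed.

Lemma polyseqM k s f g :
  polyseq k s f -> polyseq k s g -> polyseq k s (fun n => f n * g n).
Proof. by have [+ _] := polyseqMR k; apply. Qed.

Lemma polyseq1 k s : polyseq k s (fun=> 1).
Proof.
elim: k s => [|k IH] s; split=> //.
by apply: polyseq_ext (IH _) => n; rewrite /fwd mulVg.
Qed.

Lemma polyseq_cst k s x : x \in E s -> polyseq k s (fun=> x).
Proof.
case: k => [|k] xs; split=> //.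
by apply: polyseq_ext (polyseq1 _ _) => n; rewrite /fwd mulVg.
Qed.

(** By Pascal's rule a difference lowers [i] by one while raising the filtration index by one, so
    the weight [i + j] of [x] stays exactly sufficient. *)
Lemma polyseq_bin k i j x :
  x \in E (i + j) -> polyseq k j (fun n => x ^+ 'C(n, i)).
Proof.
elim: k i j => [|k IH] i j xE.
  by split=> // n; apply: groupX; apply: subsetP xE; apply: E_le; rewrite leq_addl.
split=> [n|]; first by apply: groupX; apply: subsetP xE; apply: E_le; rewrite leq_addl.
case: i xE => [|i] xE.
  by apply: polyseq_ext (polyseq1 _ _) => n; rewrite /fwd !bin0 mulVg.
apply: polyseq_ext (IH i j.+1 _) => [n|]; last by rewrite addnS -addSn.
by rewrite /fwd binS expgnDr mulKg.
Qed.

Lemma polyseq_exp k x : x \in E 1 -> polyseq k 0 (fun n => x ^+ n).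
Proof.
by move=> x1; apply: polyseq_ext (@polyseq_bin k 1 0 x x1) => n; rewrite bin1.
Qed.

(** When [f] vanishes below [m], [f m] is the [m]-th difference of [f] at 0. *)
Lemma polyseq_vanish k s m f :
  polyseq k s f -> m <= k -> (forall j, j < m -> f j = 1) -> f m \in E (s + m).
Proof.
elim: k s m f => [|k IH] s m f Pf mk f1.
  by case: m mk {f1} => // _; rewrite addn0; apply: polyseqP Pf.
case: m mk f1 => [|m] mk f1; first by rewrite addn0; apply: polyseqP Pf.
have -> : f m.+1 = fwd f m by rewrite /fwd (f1 m) // invg1 mul1g.
rewrite addnS -addSn; apply: IH => //; first by case: Pf.
by move=> j jm; rewrite /fwd !f1 ?invg1 ?mulg1 // ltnS (leq_trans _ jm).
Qed.

(* A polynomial sequence is a product of sequences [c_i ^+ 'C(n, i)] with [c_i]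
   in [E i], and [p] divides ['C(p, i)] for [0 < i < p]. *)
Lemma polyseq_prime p m f :
  prime p -> 0 < m <= p -> polyseq p 0 f -> (forall j, j < m -> f j = 1) ->
  (forall i x, m <= i < p -> x \in E i -> x ^+ p \in E p) ->
  f p \in E p.
Proof.
move=> p_pr; have [n] := ubnP (p - m).
elim: n m f => // n IH m f pmn /andP[m0 mp] Pf f1 HE.
have cm := polyseq_vanish Pf mp f1; rewrite add0n in cm.
move: mp; rewrite leq_eqVlt => /orP[/eqP <- //|mp].
(* Removing the binomial term at [m] makes the sequence vanish at [m] too; at [p] the removed factor
   is a power of [f m ^+ p]. *)
pose g j := f j * (f m)^-1 ^+ 'C(j, m).
have gp : g p \in E p.
  apply: (IH m.+1) => //.
  - by rewrite ltnS in pmn; apply: leq_trans pmn; rewrite subnS prednK ?subn_gt0.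
  - by apply: polyseqM => //; apply: polyseq_bin; rewrite addn0 groupV.
  - move=> j; rewrite ltnS leq_eqVlt /g => /orP[/eqP ->|jm].
      by rewrite binn expg1 mulgV.
    by rewrite f1 // bin_small // mulg1.
  - by move=> i x /andP[mi ip]; apply: HE; rewrite (ltnW mi).
have := HE m (f m); rewrite leqnn mp => /(_ isT cm) cp.
have /dvdnP[q Dq] : p %| 'C(p, m) by apply: prime_dvd_bin => //; rewrite m0.
move: gp; rewrite /g expVgn Dq mulnC expgM => gp.
by rewrite -(groupMr _ (groupVr (groupX q cp))).
Qed.
End Polynomial_sequences.

(** * Ranks of the factors of a finite Zassenhaus series *)

Lemma leq_card_imset2 (aT bT rT : finType) (f : aT -> bT -> rT)
    (A : {set aT}) (B : {set bT}) :
  #|[set f a b | a in A, b in B]| <= #|A| * #|B|.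
Proof. by rewrite -cardsX curry_imset2X leq_imset_card. Qed.

Section Zassenhaus_chain.
Local Open Scope group_scope.
Variables (gT : finGroupType) (p : nat) (Z : nat -> {group gT}).
Hypothesis p_pr : prime p.
Hypothesis Z1 : Z 1 :=: [set: gT].
Hypothesis Zdesc : forall a, 0 < a -> Z a.+1 \subset Z a.
Hypothesis Zcomm : forall a b, 0 < a -> 0 < b -> [~: Z a, Z b] \subset Z (a + b).
Hypothesis Zpow : forall a x, 0 < a -> x \in Z a -> x ^+ p \in Z (p * a).
(** Minimality of the recursively defined term. In this form, with a test subgroup [H], the
    recursion passes to images in finite quotients. *)
Hypothesis Zmin : forall m (H : {group gT}), 1 < m ->
  (forall x, x \in Z ((m + p.-1) %/ p) -> x ^+ p \in H) ->
  (forall a b, 0 < a -> 0 < b -> (a + b = m)%N -> [~: Z a, Z b] \subset H) ->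
  Z m \subset H.

Lemma Z_le a b : 0 < a <= b -> Z b \subset Z a.
Proof.
case/andP=> a0 /subnKC<-; elim: (b - a) => [|n IH]; first by rewrite addn0.
by rewrite addnS (subset_trans (Zdesc _)) // addn_gt0 a0.
Qed.

Lemma Z_norm a (A : {set gT}) : 0 < a -> A \subset 'N(Z a).
Proof.
move=> a0; apply: subset_trans (subsetT A) _; rewrite -Z1 -commg_subl.
by apply: subset_trans (Zcomm a0 _) _ => //; rewrite addn1 Zdesc.
Qed.

(* Later shown to be all of [Z m] up to p-th powers. *)
Definition Zstep m : {group gT} := ([~: Z m.-1, [set: gT]] <*> Z m.+1)%G.

Lemma Zstep_norm m (A : {set gT}) : 1 < m -> A \subset 'N(Zstep m).
Proof.
move=> m1; apply: subset_trans (subsetT A) _; apply: normsY; last exact: Z_norm.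
by apply: normsR; [apply: Z_norm; case: m m1 => [|[]] | apply: normG].
Qed.

Lemma sub_Zstep m b : m < b -> Z b \subset Zstep m.
Proof. by move=> mb; apply: subset_trans (Z_le _) (joing_subr _ _). Qed.

Lemma mem_joing_norm (K : {group gT}) (A : {group gT}) x :
  A \subset 'N(K) -> x \in A <*> K -> exists2 a, a \in A & a^-1 * x \in K.
Proof.
move=> nKA; rewrite norm_joinEl // => /mulsgP[a k aA kK ->].
by exists a; rewrite // mulKg.
Qed.

Lemma expg_coset (K : {group gT}) x y n : [set: gT] \subset 'N(K) ->
  x^-1 * y \in K -> x ^+ n \in K -> y ^+ n \in K.
Proof.
move=> nK xyK; have N z : z \in 'N(K) by apply: (subsetP nK); rewrite inE.
have Dy : coset K y = coset K x.
  by rewrite -{1}[y](mulKVg x) morphM //= (coset_id xyK) mulg1.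
have X z : coset K (z ^+ n) = coset K z ^+ n by apply: (morphX (coset_morphism K)).
by move=> xn; apply: coset_idr => //; rewrite X Dy -X coset_id.
Qed.

Section Filtration.
Variables (m : nat) (w : nat -> nat).
Hypothesis m1 : 1 < m.
Hypothesis w0 : forall i, 0 < w i.
Hypothesis w_le : forall i, w i <= w i.+1.
Hypothesis w_add : forall a b, a + b < p -> w (a + b) <= w a + w b.
Hypothesis w_top : forall a b, a < p -> b < p -> p <= a + b ->
  [~: Z (w a), Z (w b)] \subset Zstep m.

(** Constant from [p] on, so that membership in the [p]-th term, the conclusion of [polyseq_prime],
    means membership in [Zstep m]. *)
Definition Zfil i : {group gT} :=
  (if i < p then Z (w i) <*> Zstep m else Zstep m)%G.

Lemma Zstep_sub_fil i : Zstep m \subset Zfil i.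
Proof. by rewrite /Zfil; case: ifP => _ //; apply: joing_subr. Qed.

Lemma Zfil_norm i (A : {set gT}) : A \subset 'N(Zfil i).
Proof.
rewrite /Zfil; case: ifP => _; last exact: Zstep_norm.
by apply: normsY; [apply: Z_norm | apply: Zstep_norm].
Qed.

Lemma Zfil_commY i a (A : {group gT}) :
  [~: Z (w a), A] \subset Zfil i ->
  [~: Z (w a) <*> Zstep m, A <*> Zstep m] \subset Zfil i.
Proof.
move=> H; have N (B : {set gT}) : B \subset 'N(Zfil i) := Zfil_norm i B.
have K1 : Zstep m / Zfil i = 1 := quotientS1 (Zstep_sub_fil i).
rewrite -quotient_cents2 // (quotientY (N (Z (w a))) (N (Zstep m))).
rewrite (quotientY (N A) (N (Zstep m))) K1.
by rewrite !joingG1 quotient_cents2.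
Qed.

Lemma Zfil_comm a b : [~: Zfil a, Zfil b] \subset Zfil (a + b).
Proof.
have N (B : {set gT}) : B \subset 'N(Zstep m) := Zstep_norm B m1.
rewrite {1 2}/Zfil; case: ltnP => ap; last first.
  by apply: subset_trans (Zstep_sub_fil _); rewrite commg_subl.
case: ltnP => bp; last first.
  by apply: subset_trans (Zstep_sub_fil _); rewrite commg_subr.
apply: Zfil_commY; case: (ltnP (a + b) p) => abp; last first.
  by apply: subset_trans (Zstep_sub_fil _); apply: w_top.
apply: subset_trans (Zcomm (w0 _) (w0 _)) _; rewrite /Zfil abp.
by apply: subset_trans (joing_subl _ _); apply: Z_le; rewrite w0 w_add.
Qed.

Lemma Zfil_desc i : Zfil i.+1 \subset Zfil i.
Proof.
rewrite {1}/Zfil; case: ltnP => ip; last exact: Zstep_sub_fil.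
rewrite /Zfil (ltnW ip); apply: genS; apply: setSU.
by apply: Z_le; rewrite w0 w_le.
Qed.

Lemma Zfil_pow i x : i < p -> m < p * w i -> x \in Zfil i -> x ^+ p \in Zfil p.
Proof.
rewrite /Zfil ltnn => -> mpw /mem_joing_norm[|z zZ]; first exact: Zstep_norm.
move/expg_coset; apply; first exact: Zstep_norm.
exact: subsetP (sub_Zstep mpw) _ (Zpow (w0 i) zZ).
Qed.

End Filtration.

Lemma ceil_mul k : k <= p * ((k + p.-1) %/ p).
Proof.
have p0 := prime_gt0 p_pr; have := ltn_ceil (k + p.-1) p0.
by set q := (_ %/ _); rewrite mulSn mulnC; lia.
Qed.

Lemma ceil_lt k : 1 < k -> (k + p.-1) %/ p < k.
Proof.
move=> k1; have p0 := prime_gt0 p_pr; have p1 := prime_gt1 p_pr.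
rewrite ltn_divLR //; case: p p1 {p0} => [|[|q]] //= _.
case: k k1 => [|[|k]] // _.
by rewrite mulSn mulnS; lia.
Qed.

Lemma ceil_gt0 k : 0 < k -> 0 < (k + p.-1) %/ p.
Proof.
move=> k0; have p0 := prime_gt0 p_pr; rewrite divn_gt0 //.
by lia.
Qed.

Section Conjugation.
Variables (j k : nat).
Hypothesis j0 : 0 < j.
Hypothesis k1 : 1 < k.
Hypothesis IH : forall k' j', k' < k -> 0 < j' -> 0 < k' ->
  [~: Z j', Z k'] \subset Zstep (j' + k').
Let s := (k + p.-1) %/ p.
Let w i := (j + i * s)%N.

Let jk1 : 1 < j + k. Proof. by rewrite (leq_trans k1) ?leq_addl. Qed.
Let s0 : 0 < s. Proof. by apply: ceil_gt0; apply: ltnW. Qed.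
Let w0 i : 0 < w i. Proof. by rewrite addn_gt0 j0. Qed.
Let w_le i : w i <= w i.+1. Proof. by rewrite /w mulSn addnCA leq_addl. Qed.
Let w_add a b : a + b < p -> w (a + b) <= w a + w b.
Proof. by rewrite /w mulnDl => _; lia. Qed.
Let w_top a b : a < p -> b < p -> p <= a + b ->
  [~: Z (w a), Z (w b)] \subset Zstep (j + k).
Proof.
move=> _ _ pab; apply: subset_trans (Zcomm (w0 _) (w0 _)) (sub_Zstep _).
rewrite /w addnACA -mulnDl.
have := leq_mul pab (leqnn s); have := ceil_mul k; rewrite -/s; lia.
Qed.
Let E := Zfil (j + k) w.

(** The difference of [n |-> y ^ (x ^+ n)] is the same kind of sequence for [[~ y, x]], and each
    commutation with [x] adds [s] to the weight. *)
Lemma conj_polyseq x d i y : x \in Z s -> y \in E i ->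
  polyseq E d i (fun n => y ^ (x ^+ n)).
Proof.
move=> xs; have J i' z z' : z \in E i' -> z ^ z' \in E i'.
  by move=> zE; rewrite memJ_norm // (subsetP (Zfil_norm jk1 w0 i' [set: gT])) ?inE.
elim: d i y => [|d IHd] i y yi; (split; first by move=> n; apply: J) => //.
apply: polyseq_ext (IHd i.+1 [~ y, x] _) => [n|].
  by rewrite /fwd expgS conjgM -conjVg -conjMg.
have nT (A : {set gT}) : A \subset 'N(Zstep (j + k)) by apply: Zstep_norm.
have Tm z z' : z \in Zstep (j + k) -> [~ z, z'] \in Zstep (j + k).
  by move=> zT; rewrite commgEl groupM ?groupV // memJ_norm // (subsetP (nT setT)) ?inE.
move: yi; rewrite /E {1}/Zfil; case: ltnP => ip yi; last first.
  by apply: subsetP (Zstep_sub_fil _ _ _) _ (Tm _ _ yi).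
have [z zZ zy] := mem_joing_norm (nT _) yi.
have -> : [~ y, x] = [~ z * (z^-1 * y), x] by rewrite mulKVg.
rewrite commMgJ groupM //; last by apply: subsetP (Zstep_sub_fil _ _ _) _ (Tm _ _ zy).
apply: (J i.+1).
have zx : [~ z, x] \in [~: Z (w i), Z s] by apply: mem_commg.
rewrite /E /Zfil; case: (ltnP i.+1 p) => ip'.
  apply: (subsetP (joing_subl _ _)); rewrite /w mulSn addnCA addnC.
  by apply: subsetP (Zcomm (w0 _) s0) _ zx.
(* At [i.+1 = p] the weight reached is [j + p * s], at least [j + k]. Depth alone settles the strict
   case; for equality [s < k] lets the induction hypothesis act. *)
have ps : (k <= p * s)%N by apply: ceil_mul.
have wis : w i + s = j + p * s.
  have -> : p = i.+1 by apply/eqP; rewrite eqn_leq ip ip'.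
  by rewrite /w mulSn; lia.
case: (leqP (p * s) k) => psk; last first.
  apply: subsetP zx; apply: subset_trans (Zcomm (w0 _) s0) (sub_Zstep _); lia.
have -> : (j + k = w i + s)%N by lia.
by apply: subsetP zx; apply: IH => //; apply: ceil_lt.
Qed.

(** [n |-> [~ u, x ^+ n]] is a polynomial sequence vanishing at 0, so its value at [p] lies in the
    [p]-th term of the filtration. *)
Lemma comm_pow u x : u \in Z j -> x \in Z s -> [~ u, x ^+ p] \in Zstep (j + k).
Proof.
move=> uj xs; have p1 := prime_gt1 p_pr.
have Ep : Zstep (j + k) = E p by rewrite /E /Zfil ltnn.
have uE : u \in E 0.
  rewrite /E /Zfil prime_gt0 //; apply: (subsetP (joing_subl _ _)).
  by rewrite /w addn0.
rewrite Ep commgEl.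
have Edesc a : E a.+1 \subset E a by apply: Zfil_desc.
have Ecomm a b : [~: E a, E b] \subset E (a + b)%N by apply: Zfil_comm.
apply: (@polyseq_prime _ E Ecomm Edesc _ 1 (fun n => u^-1 * u ^ (x ^+ n))) => //.
- exact: prime_gt0.
- apply: polyseqM => //; last exact: conj_polyseq.
  by apply: polyseq_cst; rewrite groupV.
- by case=> // _; rewrite expg0 conjg1 mulVg.
- move=> i y /andP[i0 ip] yE; apply: Zfil_pow yE => //.
  rewrite /w mulnDr; have := ceil_mul k; rewrite -/s => ks.
  have : p * s <= p * (i * s) by rewrite leq_mul2l leq_pmull ?orbT.
  have : 2 * j <= p * j by rewrite leq_mul2r p1 orbT.
  lia.
Qed.
End Conjugation.

(** By [Zmin], applied to the centraliser of [Z j] modulo the target, [Z k] may be replaced by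
    [p]-th powers, treated by [comm_pow], and by commutators of earlier terms, treated by induction
    and the three subgroup lemma. *)
Lemma Zcomm_step k j : 0 < j -> 0 < k -> [~: Z j, Z k] \subset Zstep (j + k).
Proof.
elim/ltn_ind: k j => k IH j j0 k0.
case: (leqP k 1) => k1.
  have -> : k = 1%N by apply/eqP; rewrite eqn_leq k1.
  by rewrite addn1 Z1; apply: joing_subl.
have jk1 : 1 < j + k by rewrite (leq_trans k1) ?leq_addl.
set T := Zstep (j + k).
have nT (A : {set gT}) : A \subset 'N(T) by apply: Zstep_norm.
have IH' k' j' : k' < k -> 0 < j' -> 0 < k' ->
  [~: Z j', Z k'] \subset Zstep (j' + k') by move=> ? ? ?; apply: IH.
suff: Z k \subset coset T @*^-1 'C(Z j / T).
  rewrite -sub_morphim_pre ?nT // => H.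
  by rewrite commGC -quotient_cents2.
apply: Zmin => // [x xs|a b a0 b0 abk].
  rewrite inE (subsetP (nT setT)) ?inE //=.
  apply/centP => _ /morphimP[u _ uj ->]; apply/esym/commgP.
  have N (z : gT) : z \in 'N(T) by apply: subsetP (nT setT) _ _; rewrite inE.
  by rewrite -morphR //= coset_id //; apply: comm_pow.
rewrite -sub_morphim_pre ?nT //; change ([~: Z a, Z b] / T \subset 'C(Z j / T)).
rewrite (quotientR (nT (Z a)) (nT (Z b))).
have Q3 (A B C : {group gT}) : [~: A, B, C] \subset T -> [~: A / T, B / T, C / T] = 1.
  by move=> ABC; rewrite -!quotientR ?nT // quotientS1.
apply/commG1P; apply: three_subgroup; apply: Q3.
  apply: subset_trans (commSg _ (Zcomm b0 j0)) _.
  rewrite /T (_ : j + k = b + j + a)%N; last lia.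
  by apply: IH' => //; lia.
apply: subset_trans (commSg _ (Zcomm j0 a0)) _.
rewrite /T (_ : j + k = j + a + b)%N; last lia.
by apply: IH' => //; lia.
Qed.

Section Power_additivity.
Variables (s : nat).
Hypothesis s0 : 0 < s.
Let m := (p * s)%N.
(** The weight at 0 equals the one at 1 because the sequences [u ^+ n] with [u] in [Z s] never leave
    [Z s]. *)
Let w i := (maxn i 1 * s)%N.
Let p1 : 1 < p. Proof. exact: prime_gt1. Qed.
Let m1 : 1 < m. Proof. by rewrite (leq_trans p1) // leq_pmulr. Qed.
Let w0 i : 0 < w i. Proof. by rewrite muln_gt0 s0 andbT; lia. Qed.
Let w_le i : w i <= w i.+1. Proof. by rewrite leq_mul2r; lia. Qed.
Let w_add a b : a + b < p -> w (a + b) <= w a + w b.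
Proof. by rewrite /w -mulnDl leq_mul2r => _; lia. Qed.
Let w_top a b : a < p -> b < p -> p <= a + b ->
  [~: Z (w a), Z (w b)] \subset Zstep m.
Proof.
move=> ap bp pab; case: (ltnP p (maxn a 1 + maxn b 1)) => H.
  apply: subset_trans (Zcomm (w0 _) (w0 _)) (sub_Zstep _).
  by rewrite /w /m -mulnDl ltn_pmul2r.
have -> : m = (w a + w b)%N.
  by rewrite /m /w -mulnDl; congr (_ * _)%N; lia.
exact: Zcomm_step.
Qed.
Let E := Zfil m w.

(** [n |-> v^-1 ^+ n * u^-1 ^+ n * (u * v) ^+ n] is polynomial and vanishes at 0 and 1. So only
    terms of index at least 2 enter, and their [p]-th powers have degree at least [2 * p * s],
    beyond [m]. *)
Lemma Zpow_add u v : u \in Z s -> v \in Z s ->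
  (u ^+ p * v ^+ p)^-1 * (u * v) ^+ p \in Zstep m.
Proof.
move=> us vs; have Ep : Zstep m = E p by rewrite /E /Zfil ltnn.
have sE x : x \in Z s -> x \in E 1.
  move=> xs; rewrite /E /Zfil p1; apply: (subsetP (joing_subl _ _)).
  by rewrite /w mul1n.
have Edesc a : E a.+1 \subset E a by apply: Zfil_desc.
have Ecomm a b : [~: E a, E b] \subset E (a + b)%N by apply: Zfil_comm.
rewrite Ep invMg -!expVgn.
apply: (@polyseq_prime _ E Ecomm Edesc _ 2
  (fun n => v^-1 ^+ n * u^-1 ^+ n * (u * v) ^+ n)) => //.
- by apply: polyseqM => //; first (apply: polyseqM => //); apply: polyseq_exp;
    rewrite ?groupV // sE // groupM.
- case=> [|[|]] // _; first by rewrite !expg0 !mulg1.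
  by rewrite !expg1 -invMg mulVg.
- move=> i y /andP[i2 ip] yE; apply: Zfil_pow yE => //.
  rewrite /w /m ltn_pmul2l ?prime_gt0 //.
  have -> : maxn i 1 = i by lia.
  by rewrite -{1}(mul1n s) ltn_pmul2r.
Qed.
End Power_additivity.

Definition crank m := logn p #|Z m : Z m.+1|.

Definition Zgens m (X : {set gT}) := (X \subset Z m) && (Z m \subset <<X>> <*> Z m.+1).

Lemma Zabelem m : 0 < m -> p.-abelem (Z m / Z m.+1).
Proof.
move=> m0; have nZ (A : {set gT}) : A \subset 'N(Z m.+1) by apply: Z_norm.
rewrite abelemE //; apply/andP; split.
  rewrite /abelian quotient_cents2 //; apply: subset_trans (Zcomm m0 m0) _.
  by apply: Z_le; lia.
apply/exponentP => _ /morphimP[x _ xZ ->]; rewrite -morphX //=; last first.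
  by rewrite (subsetP (nZ setT)) ?inE.
apply: coset_id; apply: subsetP (Z_le _) _ (Zpow m0 xZ).
have := prime_gt1 p_pr; case: p => [|[|q]] // _; lia.
Qed.

Lemma crankE m : 0 < m -> crank m = logn p #|Z m / Z m.+1|.
Proof. by move=> m0; rewrite /crank card_quotient // Z_norm. Qed.

Lemma Zgens_quotient m X : 0 < m -> Zgens m X -> Z m / Z m.+1 = <<X / Z m.+1>>.
Proof.
move=> m0 /andP[XZ ZX]; have nZ (A : {set gT}) : A \subset 'N(Z m.+1) by apply: Z_norm.
apply/eqP; rewrite eqEsubset gen_subG quotientS // andbT.
apply: subset_trans (quotientS _ ZX) _.
by rewrite quotientYidr ?nZ // quotient_gen ?nZ.
Qed.

Lemma crank_le m X : 0 < m -> Zgens m X -> crank m <= #|X|.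
Proof.
move=> m0 gX; rewrite crankE // -(rank_abelem (Zabelem m0)).
rewrite -(grank_abelian (abelem_abelian (Zabelem m0))).
rewrite /= (Zgens_quotient m0 gX); apply: leq_trans (grank_min _) _.
exact: leq_trans (leq_imset_card _ _) (subset_leq_card (subsetIr _ _)).
Qed.

Lemma Zgens_ex m : 0 < m -> exists2 X, Zgens m X & #|X| = crank m.
Proof.
move=> m0; have nZ (A : {set gT}) : A \subset 'N(Z m.+1) by apply: Z_norm.
have [B gB cB] := grank_witness (Z m / Z m.+1).
have BZ : B \subset Z m / Z m.+1 by rewrite -gB subset_gen.
pose X := [set repr (b : {set gT}) | b : coset_of (Z m.+1) in B].
have XB : X / Z m.+1 = B.
  apply/setP=> b; apply/idP/idP => [/morphimP[x _ /imsetP[b' b'B ->] ->]|bB].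
    by rewrite /= coset_reprK.
  rewrite -[b]coset_reprK; apply: (mem_morphim (coset_morphism (Z m.+1))).
    by rewrite (subsetP (nZ setT)) ?inE.
  by apply/imsetP; exists b.
have XZ : X \subset Z m.
  by rewrite -(quotientSGK (nZ X)) ?Zdesc // XB.
exists X; first rewrite /Zgens XZ /=.
  by rewrite joingC norm_joinEr ?nZ // -quotientSK ?nZ // quotient_gen ?nZ // XB gB subxx.
rewrite card_imset; last exact: can_inj (@coset_reprK _ _).
by rewrite cB (grank_abelian (abelem_abelian (Zabelem m0))) (rank_abelem (Zabelem m0)) crankE.
Qed.

Section Generation.
Variables (D : nat) (x : 'I_D -> gT).
Hypothesis x_gen : <<[set x l | l : 'I_D]>> = [set: gT].

Lemma Zgens1 : Zgens 1 [set x l | l : 'I_D].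
Proof. by rewrite /Zgens Z1 subsetT x_gen joing_subl. Qed.

Lemma Zgens_sub m (X Y : {set gT}) : Zgens m X -> X \subset Y -> Y \subset Z m -> Zgens m Y.
Proof.
move=> /andP[_ ZX] XY YZ; rewrite /Zgens YZ (subset_trans ZX) //.
by apply: genS; apply: setSU; apply: genS.
Qed.

(** [Zcomm_step] reduces commutators to those with a generator, and [Zpow_add] reduces [p]-th powers
    to those of [Y]. When [p] does not divide [m.+1], the powers in the recursion fall into a deeper
    term and [Y] is a dummy. *)
Lemma Zgens_step m (X Y : {set gT}) : 0 < m -> Zgens m X ->
  (if p %| m.+1 then Zgens (m.+1 %/ p) Y else Y \subset [set 1]) ->
  Zgens m.+1 ([set [~ u, x l] | u in X, l in [set: 'I_D]] :|: [set y ^+ p | y in Y]).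
Proof.
move=> m0 gX gY; have [XZ ZX] := andP gX.
set C := [set _ | u in X, l in [set: 'I_D]]; set B := [set _ | y in Y].
have p0 := prime_gt0 p_pr; have p1 := prime_gt1 p_pr.
have CZ : C \subset Z m.+1.
  apply/subsetP=> _ /imset2P[u l uX _ ->].
  have := Zcomm m0 (ltn0Sn 0); rewrite addn1 => /subsetP; apply.
  by rewrite mem_commg // ?(subsetP XZ) // Z1 inE.
have BZ : B \subset Z m.+1.
  apply/subsetP=> _ /imsetP[y yY ->]; case: ifP gY => [pm /andP[YZ _]|_ Y1].
    rewrite -(divnK pm) mulnC; apply: Zpow; last exact: (subsetP YZ).
    by rewrite divn_gt0 // dvdn_leq.
  by move/subsetP/(_ _ yY): Y1 => /set1P ->; rewrite expg1n group1.
pose R := (<<C :|: B>> <*> Z m.+2)%G.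
rewrite /Zgens subUset CZ BZ /=; change (Z m.+1 \subset R).
have sR : Z m.+2 \subset R by apply: joing_subr.
have CR : C \subset R by rewrite (subset_trans _ (joing_subl _ _)) // sub_gen // subsetUl.
have BR : B \subset R by rewrite (subset_trans _ (joing_subl _ _)) // sub_gen // subsetUr.
have RZ : R \subset Z m.+1.
  by rewrite join_subG gen_subG subUset CZ BZ Zdesc.
have nR (A : {set gT}) : A \subset 'N(R).
  apply: subset_trans (subsetT A) _; rewrite -Z1 -commg_subl.
  apply: subset_trans sR; apply: subset_trans (commSg _ RZ) _.
  by rewrite -(addn1 m.+1) Zcomm.
have ZpR : [~: Z m, [set: gT]] \subset R.
  rewrite -quotient_cents2 ?nR // -x_gen (quotient_gen (nR _)) cent_gen.
  apply: subset_trans (quotientS _ ZX) _.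
  rewrite quotientY ?nR // quotient_gen ?nR // gen_subG subUset gen_subG /=.
  rewrite !quotient_cents2 ?nR //; apply/andP; split.
    rewrite gen_subG; apply/subsetP=> _ /imset2P[u _ uX /imsetP[l _ ->] ->].
    by apply: (subsetP CR); apply/imset2P; exists u l.
  apply: subset_trans sR; apply: subset_trans (commgS _ (subsetT _)) _.
  by rewrite -Z1 -(addn1 m.+1) Zcomm.
have TR : Zstep m.+1 \subset R by rewrite join_subG ZpR.
apply: Zmin => //= [v vs|a b a0 b0 abm]; last first.
  by apply: subset_trans TR; rewrite -abm; apply: Zcomm_step.
case: ifP gY => [pm gY|pm _]; last first.
  apply: (subsetP sR); apply: subsetP (Z_le _) _ (Zpow _ vs); last exact: ceil_gt0.
  have := ceil_mul m.+1; rewrite leq_eqVlt => /orP[/eqP E|//].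
  by move: pm; rewrite E dvdn_mulr.
have cE : (m.+1 + p.-1) %/ p = m.+1 %/ p.
  have cl: p.-1 < p by rewrite ltn_predL.
  by rewrite -{1}(divnK pm) divnMDl // (divn_small cl) addn0.
rewrite cE in vs; set s := m.+1 %/ p in gY vs.
have s0 : 0 < s by rewrite divn_gt0 // dvdn_leq.
have ps : m.+1 = (p * s)%N by rewrite mulnC divnK.
(* A subgroup because the power map is additive modulo [Zstep m.+1], which lies in [R]. *)
have Rg : group_set [set z in Z s | z ^+ p \in R].
  apply/group_setP; split=> [|z1 z2]; rewrite !inE ?group1 ?expg1n ?group1 //.
  case/andP=> z1s z1p /andP[z2s z2p]; rewrite groupM //=.
  have := Zpow_add s0 z1s z2s; rewrite -ps => /(subsetP TR) H.
  by have := groupM (groupM z1p z2p) H; rewrite mulKVg.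
have [YZ ZY] := andP gY.
suff: Z s \subset Group Rg by move/subsetP/(_ _ vs); rewrite inE => /andP[].
apply: subset_trans ZY _; rewrite join_subG gen_subG; apply/andP; split.
  apply/subsetP=> y yY; rewrite inE (subsetP YZ) //=.
  by apply: (subsetP BR); apply: imset_f.
apply/subsetP=> y ys; rewrite inE (subsetP (Zdesc s0)) //=.
apply: (subsetP sR); apply: subsetP (Z_le _) _ (Zpow _ ys) => //.
by rewrite mulnS -ps -(add1n m.+1) leq_add2r.
Qed.

Definition cw (u : gT) (w : seq 'I_D) := foldl (fun v l => [~ v, x l]) u w.

Lemma cw_in m u w : 0 < m -> u \in Z m -> cw u w \in Z (m + size w).
Proof.
move=> m0; elim/last_ind: w => [|w l IH] uZ; first by rewrite addn0.
rewrite /cw foldl_rcons size_rcons -addn1 addnA.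
apply: (subsetP (Zcomm (a := m + size w) (b := 1) _ _)) => //.
  by rewrite addn_gt0 m0.
by rewrite mem_commg ?IH // Z1 inE.
Qed.

(* Number of generators of [Z (m + k)] modulo [Z (m + k + 1)] that come from
   p-th powers, when [Z m] is used as a starting point. *)
Fixpoint pgens m k :=
  if k is k'.+1 then
    (D * pgens m k' + (if p %| m + k then crank ((m + k) %/ p) else 0))%N
  else 0.

Definition cwset (X : {set gT}) n := [set cw u (tval w) | u in X, w in [set: n.-tuple 'I_D]].

Lemma Zgens_block m X n : 0 < m -> Zgens m X ->
  exists2 B : {set gT}, #|B| <= pgens m n & Zgens (m + n) (cwset X n :|: B).
Proof.
move=> m0 gX; have [XZ _] := andP gX.
have cwZ k : cwset X k \subset Z (m + k).
  apply/subsetP=> _ /imset2P[u w uX _ ->].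
  by rewrite -{2}(size_tuple w); apply: cw_in; rewrite ?(subsetP XZ).
elim: n => [|n [B cB gB]].
  exists set0; first by rewrite cards0.
  rewrite addn0; apply: Zgens_sub gX _ _; last by rewrite setU0; have := cwZ 0; rewrite addn0.
  rewrite setU0; apply/subsetP=> u uX; apply/imset2P.
  by exists u [tuple].
have [Y cY gY] : exists2 Y : {set gT},
    #|Y| <= (if p %| m + n.+1 then crank ((m + n.+1) %/ p) else 0) &
    (if p %| m + n.+1 then Zgens ((m + n.+1) %/ p) Y else Y \subset [set 1]).
  case: ifP => pm; last by exists set0; rewrite ?cards0 ?sub0set.
  have [|Y gY cY] := @Zgens_ex ((m + n.+1) %/ p).
    by rewrite divn_gt0 ?prime_gt0 // dvdn_leq // addn_gt0 m0.
  by exists Y; rewrite ?cY.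
have mn0 : 0 < m + n by rewrite addn_gt0 m0.
rewrite addnS in gY cY *; have := Zgens_step mn0 gB gY => gS.
exists ([set [~ u, x l] | u in B, l in [set: 'I_D]] :|: [set y ^+ p | y in Y]).
  apply: leq_trans (leq_card_setU _ _) _; rewrite /= addnS; apply: leq_add.
    rewrite mulnC; apply: leq_trans (leq_mul cB (leqnn D)).
    by apply: leq_trans (leq_card_imset2 _ _ _) _; rewrite cardsT card_ord.
  exact: leq_trans (leq_imset_card _ _) cY.
have [gS1 _] := andP gS; apply: Zgens_sub gS _ _.
  apply/subsetP=> z; rewrite !inE => /orP[/imset2P[u l + _ ->]|->]; last by rewrite !orbT.
  rewrite inE => /orP[/imset2P[v w vX _ ->]|uB]; last first.
    by apply/orP; right; apply/orP; left; apply/imset2P; exists u l.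
  have E : [~ cw v w, x l] = cw v (rcons w l) by rewrite /cw foldl_rcons.
  by apply/orP; left; rewrite E; apply/imset2P; exists v [tuple of rcons w l]; rewrite ?inE.
rewrite subUset -addnS cwZ /= addnS; apply: subset_trans gS1.
by apply: setSU; apply/subsetP=> _ /imset2P[u l uB _ ->]; apply/imset2P; exists u l; rewrite // inE uB orbT.
Qed.

Lemma card_cwset (X : {set gT}) n : #|cwset X n| <= D ^ n * #|X|.
Proof.
rewrite mulnC; apply: leq_trans (leq_card_imset2 _ _ _) _.
by rewrite cardsT card_tuple card_ord.
Qed.

Lemma crank_block m n : 0 < m -> crank (m + n) <= D ^ n * crank m + pgens m n.
Proof.
move=> m0; have [X gX <-] := Zgens_ex m0.
have [B cB gB] := Zgens_block n m0 gX.
apply: leq_trans (crank_le _ gB) _; first by rewrite addn_gt0 m0.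
by apply: leq_trans (leq_card_setU _ _) (leq_add (card_cwset _ _) cB).
Qed.

(** The relation makes the commutator at [w0] redundant modulo those at the other words, so one
    generator is saved for each element of [X]. *)
Lemma crank_block_rel m n (w0 : n.-tuple 'I_D) : 0 < m ->
  (forall (R : {group gT}) u, Z (m + n).+1 \subset R -> R \subset Z (m + n) ->
     u \in Z m -> (forall w : n.-tuple 'I_D, w != w0 -> cw u w \in R) ->
     cw u w0 \in R) ->
  crank (m + n) <= (D ^ n).-1 * crank m + pgens m n.
Proof.
move=> m0 rel; have [X gX <-] := Zgens_ex m0; have [XZ _] := andP gX.
have [B cB gB] := Zgens_block n m0 gX; have [gB1 gB2] := andP gB.
have mn0 : 0 < m + n by rewrite addn_gt0 m0.
pose A := [set cw u (tval w) | u in X, w in [set~ w0]].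
have AC : A \subset cwset X n.
  by apply/subsetP=> _ /imset2P[u w uX _ ->]; apply/imset2P; exists u w.
have ABZ : A :|: B \subset Z (m + n).
  by apply: subset_trans gB1; apply: setSU.
have gA : Zgens (m + n) (A :|: B).
  rewrite /Zgens ABZ /=; apply: subset_trans gB2 _.
  have RZ : <<A :|: B>> <*> Z (m + n).+1 \subset Z (m + n).
    by rewrite join_subG gen_subG ABZ Zdesc.
  rewrite join_subG joing_subr andbT gen_subG subUset; apply/andP; split; last first.
    apply: subset_trans (joing_subl _ _); apply: sub_gen; exact: subsetUr.
  apply/subsetP=> _ /imset2P[u w uX _ ->].
  have Aw (w' : n.-tuple 'I_D) : w' != w0 -> cw u w' \in <<A :|: B>> <*> Z (m + n).+1.
    move=> ww0; apply: (subsetP (joing_subl _ _)); apply: mem_gen; rewrite inE.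
    by apply/orP; left; apply/imset2P; exists u w'; rewrite // !inE.
  case: (eqVneq w w0) => [->|]; last exact: Aw.
  by apply: (rel (<<A :|: B>> <*> Z (m + n).+1)%G); rewrite /= ?joing_subr ?(subsetP XZ).
apply: leq_trans (crank_le mn0 gA) _.
apply: leq_trans (leq_card_setU _ _) (leq_add _ cB).
rewrite mulnC /A; have <- : #|[set~ w0]| = (D ^ n).-1.
  by rewrite cardsC1 card_tuple card_ord.
exact: leq_card_imset2.
Qed.

End Generation.

End Zassenhaus_chain.

(** * Noncommutative power series *)

Section Noncommutative_power_series.
Import GRing.Theory.
Local Open Scope ring_scope.
Variables (D : nat) (R : comNzRingType).

(* Formal power series in the noncommuting variables ['X_l], as functions
   giving the coefficient of each word. *)
Definition fps := seq 'I_D -> R.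

HB.instance Definition _ := GRing.Zmodule.on fps.

Implicit Types (a b c : fps) (l : 'I_D) (v w : seq 'I_D).

Definition fshift l a : fps := fun w => a (l :: w).

(** The sum over all splittings of [w] into a prefix read by [a] and a suffix read by [b];
    [fshift l] moves the first letter into the prefix. *)
Fixpoint fmul a b w : R :=
  if w is l :: w' then a [::] * b w + fmul (fshift l a) b w' else a [::] * b [::].

Definition fone : fps := fun w => (nilp w)%:R.

Definition fvar l : fps := fun w => (w == [:: l])%:R.

Lemma fpsD a b w : (a + b) w = a w + b w. Proof. by []. Qed.
Lemma fpsN a w : (- a) w = - a w. Proof. by []. Qed.
Lemma fps0 w : (0 : fps) w = 0. Proof. by []. Qed.

Lemma fmulDl : left_distributive (fmul : fps -> fps -> fps) +%R.
Proof.
move=> a b c; apply/funext => w; elim: w a b => [|l w IH] a b /=; first exact: mulrDl.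
rewrite (_ : fshift l (a + b) = fshift l a + fshift l b) // IH /=.
by rewrite !fpsD mulrDl addrACA.
Qed.

Lemma fmulDr : right_distributive (fmul : fps -> fps -> fps) +%R.
Proof.
move=> a b c; apply/funext => w; elim: w a => [|l w IH] a /=; first exact: mulrDr.
by rewrite IH !fpsD mulrDr addrACA.
Qed.

Lemma fmulZl (r : R) a b w : fmul (fun v => r * a v) b w = r * fmul a b w.
Proof.
elim: w a => [|l w IH] a /=; first by rewrite mulrA.
by rewrite mulrDr mulrA -IH.
Qed.

Lemma fmulA : associative (fmul : fps -> fps -> fps).
Proof.
move=> a b c; apply/funext => w; elim: w a b => [|l w IH] a b /=.
  by rewrite mulrA.
have -> : fshift l (fmul a b) = (fun v => a [::] * fshift l b v) + fmul (fshift l a) b.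
  by apply/funext => v.
by rewrite fmulDl fpsD fmulZl mulrDr mulrA -IH !addrA.
Qed.

Lemma fmul0 b w : fmul 0 b w = 0.
Proof.
elim: w => [|l w IH] /=; first by rewrite mul0r.
by rewrite mul0r add0r -[RHS]IH.
Qed.

Lemma fmul1l : left_id fone (fmul : fps -> fps -> fps).
Proof.
move=> a; apply/funext => -[|l w] /=; first by rewrite mul1r.
rewrite mul1r (_ : fshift l fone = 0) ?fmul0 ?addr0 //.
Qed.

Lemma fmul1r : right_id fone (fmul : fps -> fps -> fps).
Proof.
move=> a; apply/funext => w; elim: w a => [|l w IH] a /=; first by rewrite mulr1.
by rewrite mulr0 add0r IH.
Qed.

Lemma fone_neq0 : fone != 0 :> fps.
Proof. by apply/eqP => /(congr1 (@^~ [::])) /eqP; rewrite oner_eq0. Qed.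

HB.instance Definition _ := GRing.Zmodule_isNzRing.Build fps
  fmulA fmul1l fmul1r fmulDl fmulDr fone_neq0.

Lemma fps1 w : (1 : fps) w = (nilp w)%:R. Proof. by []. Qed.

Lemma fpsM_nil a b : (a * b : fps) [::] = a [::] * b [::]. Proof. by []. Qed.

Lemma fpsM_cons a b l w :
  (a * b : fps) (l :: w) = a [::] * b (l :: w) + (fshift l a * b : fps) w.
Proof. by []. Qed.

Lemma fshift_var l l' : fshift l (fvar l') = if l == l' then 1 else 0.
Proof.
apply/funext => w; rewrite /fshift /fvar eqseq_cons.
by case: eqP => //= _; case: w.
Qed.

Lemma fpsM_var l a w :
  (fvar l * a : fps) w = if w is l' :: w' then (if l' == l then a w' else 0) else 0.
Proof.
case: w => [|l' w]; first by rewrite fpsM_nil mul0r.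
rewrite fpsM_cons mul0r add0r fshift_var; case: eqP => _; by rewrite ?mul1r ?mul0r.
Qed.

Definition order_ge n a := forall w, (size w < n)%N -> a w = 0.

Lemma order_geD n a b : order_ge n a -> order_ge n b -> order_ge n (a + b).
Proof. by move=> an bn w wn; rewrite fpsD an ?bn ?addr0. Qed.

Lemma order_geN n a : order_ge n a -> order_ge n (- a).
Proof. by move=> an w wn; rewrite fpsN an ?oppr0. Qed.

Lemma order_geB n a b : order_ge n a -> order_ge n b -> order_ge n (a - b).
Proof. by move=> an bn; apply: order_geD => //; apply: order_geN. Qed.

(** In the least possible degree a single splitting of [w] contributes. *)
Lemma order_geM_lead m n a b w : order_ge m a -> order_ge n b ->
  (size w <= m + n)%N ->
  (a * b : fps) w = if size w == (m + n)%N then a (take m w) * b (drop m w) else 0.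
Proof.
elim: w m a => [|l w IH] m a am bn.
  rewrite fpsM_nil; case: m am => [|m] am _; last by rewrite am ?mul0r.
  by case: n bn => [|n] bn //=; rewrite bn ?mulr0.
rewrite fpsM_cons; case: m am => [|m] am wmn.
  have -> : (fshift l a * b : fps) w = 0.
    by rewrite (IH 0%N) // 1?ltnW // ltn_eqF.
  rewrite addr0 take0 drop0 add0n; case: eqP => // /eqP wn.
  by rewrite bn ?mulr0 // ltn_neqAle wn.
rewrite (am [::]) // mul0r add0r (IH m) //.
by move=> v vm; apply: am.
Qed.

Lemma order_geM m n a b : order_ge m a -> order_ge n b -> order_ge (m + n) (a * b).
Proof.
by move=> am bn w wmn; rewrite (order_geM_lead am bn) 1?ltnW // ltn_eqF.
Qed.

Lemma order_ge_le m n a : (n <= m)%N -> order_ge m a -> order_ge n a.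
Proof. by move=> nm am w wn; apply: am; apply: leq_trans nm. Qed.

Lemma order_geX m n a : order_ge m a -> order_ge (n * m) (a ^+ n).
Proof.
by move=> am; elim: n => [|n IH] //; rewrite exprS mulSn; apply: order_geM.
Qed.

Definition fps_eq n a b := forall w, (size w <= n)%N -> a w = b w.

Lemma fps_eqM n a a' b b' : fps_eq n a a' -> fps_eq n b b' -> fps_eq n (a * b) (a' * b').
Proof.
move=> + + w; elim: w n a a' => [|l w IH] n a a' ea eb wn.
  by rewrite !fpsM_nil ea ?eb.
rewrite !fpsM_cons ea // eb // (IH n.-1 _ (fshift l a')) //.
- by move=> v vn; apply: ea; rewrite /= -(ltn_predK wn).
- by move=> v vn; apply: eb; rewrite (leq_trans vn) // leq_pred.
- by rewrite -ltnS (ltn_predK wn).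
Qed.

End Noncommutative_power_series.

(** * Relations among commutators obtained from relators *)

Section Magnus_relation.
Import GRing.Theory.
Local Open Scope group_scope.
Variables (gT : finGroupType) (p : nat) (Z : nat -> {group gT}).
Hypothesis p_pr : prime p.
Hypothesis Z1 : Z 1 :=: [set: gT].
Hypothesis Zdesc : forall a, 0 < a -> Z a.+1 \subset Z a.
Hypothesis Zcomm : forall a b, 0 < a -> 0 < b -> [~: Z a, Z b] \subset Z (a + b).
Hypothesis Zpow : forall a x, 0 < a -> x \in Z a -> x ^+ p \in Z (p * a).
Variables (D : nat) (x : 'I_D -> gT).

Local Notation A := (fps D 'F_p).
Implicit Types a b : A.

Lemma mem_commZ k u g : 0 < k -> u \in Z k -> [~ u, g] \in Z k.+1.
Proof.
move=> k0 uk; have := Zcomm k0 (ltn0Sn 0); rewrite addn1 => /subsetP; apply.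
by rewrite mem_commg // Z1 inE.
Qed.

Section Evaluation.
Import GRing.Theory.
Variables (m n : nat) (V : lmodType 'F_p) (lam : gT -> V).
Hypothesis nm : n < m.
Hypothesis lamM : {in Z m &, forall u v, lam (u * v) = (lam u + lam v)%R}.
Hypothesis lam0 : forall u, u \in Z (m + n).+1 -> lam u = 0%R.
Local Open Scope ring_scope.

(* The sum over words [w] of length at most [N] of [a w *: lam (cw x u w)]. *)
Fixpoint feval N a (u : gT) : V :=
  a [::] *: lam u +
  (if N is N'.+1 then \sum_l feval N' (fshift l a) [~ u, x l]%g else 0).

Lemma fevalD N a b u : feval N (a + b) u = feval N a u + feval N b u.
Proof.
elim: N a b u => [|N IH] a b u /=; first by rewrite fpsD scalerDl !addr0.
rewrite fpsD scalerDl addrACA -big_split /=; congr (_ + _ + _).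
by apply: eq_bigr => l _; rewrite -IH.
Qed.

Lemma feval0 N a u : u \in Z (m + n).+1 -> feval N a u = 0.
Proof.
elim: N a u => [|N IH] a u uZ /=; first by rewrite lam0 // scaler0 addr0.
rewrite lam0 // scaler0 add0r big1 // => l _; apply: IH.
apply: subsetP (Z_le Zdesc _) _ (mem_commZ _ _ uZ) => //; exact: leqnSn.
Qed.

Lemma feval_zero N u : feval N 0 u = 0.
Proof.
elim: N u => [|N IH] u /=; first by rewrite scale0r addr0.
by rewrite scale0r add0r big1 // => l _; apply: IH.
Qed.

(** Since [n < m] gives [(m + n).+1 <= 2 * m], [Z m] is abelian modulo the term killed by [lam], and
    commutation with [x l] is additive there. *)
Lemma fevalM N a u v : u \in Z m -> v \in Z m ->
  feval N a (u * v)%g = feval N a u + feval N a v.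
Proof.
have m0 : (0 < m)%N by apply: leq_trans nm.
have sZ k g : g \in Z k -> (m <= k)%N -> g \in Z m.
  by move=> gk mk; apply: subsetP (Z_le Zdesc _) _ gk; rewrite m0.
elim: N a u v => [|N IH] a u v um vm /=; first by rewrite lamM // scalerDr !addr0.
rewrite lamM // scalerDr addrACA -big_split /=; congr (_ + _ + _).
apply: eq_bigr => l _; have ux := mem_commZ (x l) m0 um.
have vx := mem_commZ (x l) m0 vm.
have uxm := sZ _ _ ux (leqnSn m); have vxm := sZ _ _ vx (leqnSn m).
have uxv : [~ [~ u, x l], v]%g \in Z (m.+1 + m).
  by apply: (subsetP (Zcomm _ _)) => //; apply: mem_commg.
rewrite commMgJ -[([~ u, x l] ^ v)%g](mulKVg [~ u, x l]%g) -commgEl.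
rewrite IH //; last by rewrite groupM // (sZ _ _ uxv) // addSn leqW ?leq_addl.
rewrite IH //; last by rewrite (sZ _ _ uxv) // addSn leqW ?leq_addl.
rewrite (feval0 _ _ (subsetP (Z_le Zdesc _) _ uxv)) ?addr0 //; lia.
Qed.

Lemma feval_ext N k a u : (0 < k)%N -> u \in Z k -> (m + n <= k + N)%N ->
  feval N.+1 a u = feval N a u.
Proof.
elim: N k a u => [|N IH] k a u k0 uk kN.
  rewrite /= big1 // => l _; rewrite addr0 lam0 ?scaler0 //.
  by apply: subsetP (Z_le Zdesc _) _ (mem_commZ _ k0 uk); lia.
rewrite [LHS]/= [RHS]/=; congr (_ + _); apply: eq_bigr => l _.
by apply: (IH k.+1) => //; [apply: mem_commZ | lia].
Qed.

(** Conjugation by [x l] acts as 1 plus the variable [l], the variable acting as commutation with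
    [x l]; hence a word acts through its Magnus image. *)
Lemma feval_word (s : seq 'I_D) u : (0 < n)%N -> u \in Z m ->
  lam (u ^ (\prod_(l <- s) x l))%g = feval n (\prod_(l <- s) (1 + fvar _ l)) u.
Proof.
move=> n0; have m0 : (0 < m)%N by apply: leq_trans nm.
elim: s u => [|l s IH] u um.
  rewrite !big_nil conjg1.
  suff H k v : feval k 1 v = lam v by rewrite H.
  case: k => [|k] /=; first by rewrite scale1r addr0.
  by rewrite scale1r big1 ?addr0 // => l _; rewrite -(feval_zero k [~ v, x l]%g).
rewrite !big_cons conjgM; have ux := mem_commZ (x l) m0 um.
have uxm : [~ u, x l]%g \in Z m by apply: subsetP (Zdesc m0) _ ux.
have Eu : (u ^ x l = u * [~ u, x l])%g by rewrite commgEl mulKVg.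
rewrite IH; last by rewrite Eu groupM.
rewrite Eu fevalM // mulrDl mul1r fevalD; congr (_ + _).
set b := \prod_(_ <- _) _.
have [k nk] : exists k, n = k.+1 by exists n.-1; rewrite prednK.
have -> : feval n b [~ u, x l]%g = feval k b [~ u, x l]%g.
  by rewrite {1}nk (feval_ext _ (k := m.+1)) // nk addSn addnS.
rewrite {1}nk [RHS]/= fpsM_nil mul0r scale0r add0r.
rewrite (bigD1 l) //= big1 ?addr0 => [|l' /negPf l'l].
  by congr (feval _ _ _); apply/funext => w; rewrite /fshift fpsM_var eqxx.
rewrite (_ : fshift l' _ = 0) ?feval_zero //.
by apply/funext => w; rewrite /fshift fpsM_var l'l.
Qed.

Lemma feval_single N a u w0 : (size w0 <= N)%N ->
  (forall w, (size w <= N)%N -> w != w0 -> a w *: lam (cw x u w) = 0) ->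
  feval N a u = a w0 *: lam (cw x u w0).
Proof.
elim: N a u w0 => [|N IH] a u w0 w0N H.
  by case: w0 w0N H => //= _ _; rewrite addr0.
rewrite /=; case: w0 w0N H => [|l0 w0] w0N H.
  rewrite big1 ?addr0 // => l _.
  by rewrite (IH _ _ [::]) // => [|w wN _]; first rewrite (H [:: l]); rewrite ?(H (l :: w)).
rewrite (H [::]) // add0r (bigD1 l0) //= (IH _ _ w0) //; last first.
  by move=> w wN ww0; apply: (H (l0 :: w)); rewrite // eqseq_cons eqxx.
rewrite big1 ?addr0 // => l ll0; rewrite (IH _ _ [::]) //.
  by apply: (H [:: l]); rewrite // eqseq_cons (negPf ll0).
by move=> w wN _; apply: (H (l :: w)); rewrite // eqseq_cons (negPf ll0).
Qed.

(** A word that is trivial in the group conjugates trivially, so [b - 1] evaluates to 0. Truncation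
    and [order_ge] leave only degree [n], where all terms but the one at [w0] vanish by
    assumption. *)
Lemma feval_relation (s : seq 'I_D) (w0 : n.-tuple 'I_D) u :
  let b := \prod_(l <- s) (1 + fvar 'F_p l) in
  (0 < n)%N -> u \in Z m -> (\prod_(l <- s) x l)%g = 1%g ->
  order_ge n (b - 1) -> b w0 != 0 ->
  (forall w : n.-tuple 'I_D, w != w0 -> lam (cw x u w) = 0) ->
  lam (cw x u w0) = 0.
Proof.
move=> b n0 um s1 bn bw0 H; have := feval_word s n0 um.
rewrite s1 conjg1 -/b -[b](subrK 1) fevalD.
have -> : feval n 1 u = lam u.
  rewrite -[u in RHS]conjg1; have := feval_word [::] n0 um.
  by rewrite !big_nil.
move/esym/eqP; rewrite -subr_eq0 addrK => /eqP.
have nw0 : tval w0 != [::] by case: n w0 n0 {H bw0} => // k w0; rewrite -size_eq0 size_tuple.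
rewrite (feval_single (w0 := w0)) ?size_tuple //.
  rewrite fpsD fpsN fps1; case: (tval w0) nw0 bw0 => // l w _ bw.
  by rewrite subr0 => /eqP; rewrite scaler_eq0 (negPf bw) => /eqP.
move=> w; rewrite leq_eqVlt => /orP[/eqP wn ww0|wn _]; last by rewrite bn ?scale0r.
have [t Dw] : exists t : n.-tuple 'I_D, w = t by move/eqP: wn => wn; exists (Tuple wn).
by rewrite Dw H ?scaler0 //; rewrite Dw in ww0.
Qed.
End Evaluation.

(** Here [lam] is the projection to [Z m / R]. It is an ['F_p]-space because for [n < m] both
    commutators and [p]-th powers of elements of [Z m] fall into [Z (m + n).+1]. *)
Lemma crank_relation m n (s : seq 'I_D) (w0 : n.-tuple 'I_D)
    (b : A := (\prod_(l <- s) (1 + fvar 'F_p l))%R) (R : {group gT}) u :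
  0 < n < m -> \prod_(l <- s) x l = 1 -> order_ge n (b - 1)%R -> b w0 != 0%R ->
  Z (m + n).+1 \subset R -> R \subset Z (m + n) -> u \in Z m ->
  (forall w : n.-tuple 'I_D, w != w0 -> cw x u w \in R) -> cw x u w0 \in R.
Proof.
move=> /andP[n0 nm] s1 bn bw0 ZR RZ um H; have m0 : 0 < m by apply: leq_trans nm.
have nR (B : {set gT}) : B \subset 'N(R).
  apply: subset_trans (subsetT B) _; rewrite -Z1 -commg_subl.
  apply: subset_trans ZR; apply: subset_trans (commSg _ RZ) _.
  by rewrite -[(m + n).+1]addn1 Zcomm // addn_gt0 m0.
have NR v : v \in 'N(R) by apply: (subsetP (nR setT)); rewrite inE.
have pE : p.-abelem (Z m / R).
  rewrite abelemE //; apply/andP; split.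
    rewrite /abelian quotient_cents2 ?nR //; apply: subset_trans ZR.
    by apply: subset_trans (Zcomm m0 m0) (Z_le Zdesc _); lia.
  apply/exponentP => _ /morphimP[v _ vZ ->]; rewrite -morphX //=.
  apply: coset_id; apply: (subsetP ZR); apply: subsetP (Z_le Zdesc _) _ (Zpow m0 vZ).
  have := prime_gt1 p_pr; case: p => [|[|q]] // _; rewrite !mulSn; lia.
have cwZ w : cw x u w \in Z m.
  have := @cw_in _ _ Z1 Zcomm D x m u w m0 um; apply: subsetP.
  by apply: Z_le => //; rewrite m0 leq_addr.
case: (eqVneq (Z m / R) 1) => [E1|ntE].
  have := mem_quotient R (cwZ w0); rewrite E1 => /set1P/coset_idr; exact.
pose lam v := abelem_rV pE ntE (coset R v).
have lamE v : v \in Z m -> lam v = 0%R -> v \in R.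
  move=> vZ l0; apply: coset_idr => //.
  have := @abelem_rV_inj _ _ _ pE ntE (coset R v) 1.
  by apply; rewrite ?mem_quotient ?group1 // abelem_rV_1.
have lam0 v : v \in R -> lam v = 0%R by move=> vR; rewrite /lam coset_id // abelem_rV_1.
apply: lamE => //; apply: (@feval_relation m n _ lam nm _ _ s w0) => //.
- by move=> v v' vZ v'Z; rewrite /lam morphM //= abelem_rV_M ?mem_quotient.
- by move=> v vZ; apply: lam0; apply: (subsetP ZR).
- by move=> w ww0; apply: lam0; apply: H.
Qed.

End Magnus_relation.

From mathcomp Require Import all_classical all_reals all_analysis.

(** * Finite quotients of topological groups *)

Section Finite_images.
Local Open Scope group_scope.
Local Open Scope classical_set_scope.
Context {G : topGroupType}.
Implicit Types (N H : set G) (x y : G).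

Lemma mulgl_continuous x : continuous (fun y : G => x * y).
Proof.
move=> y; apply: (@continuous_comp _ _ _ (fun y : G => (x, y))
  (fun xy : G * G => xy.1 * xy.2)); last exact: mulg_continuous.
by apply: cvg_pair; [apply: cvg_cst | apply: cvg_id].
Qed.

Lemma mulgr_continuous x : continuous (fun y : G => y * x).
Proof.
move=> y; apply: (@continuous_comp _ _ _ (fun y : G => (y, x))
  (fun xy : G * G => xy.1 * xy.2)); last exact: mulg_continuous.
by apply: cvg_pair; [apply: cvg_id | apply: cvg_cst].
Qed.

Lemma open_mulgl x (U : set G) : open U -> open [set y | U (x * y)].
Proof. by move=> oU; apply: open_comp oU => y _; exact: mulgl_continuous. Qed.

Lemma closed_mulgl x (U : set G) : closed U -> closed [set y | U (x * y)].
Proof. by move=> oU; apply: closed_comp oU => y _; exact: mulgl_continuous. Qed.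

Lemma closed_mulgr x (U : set G) : closed U -> closed [set y | U (y * x)].
Proof. by move=> oU; apply: closed_comp oU => y _; exact: mulgr_continuous. Qed.

(** Continuity is expressed by an open kernel, so that [gT] needs no topology. *)
Definition finmor (gT : finGroupType) (q : G -> gT) :=
  {morph q : x y / x * y} /\ open (q @^-1` [set 1]).

Section Finmor.
Variables (gT : finGroupType) (q : G -> gT).
Hypothesis fq : finmor q.
Let qM : {morph q : x y / x * y}. Proof. by case: fq. Qed.

Lemma finmor1 : q 1 = 1.
Proof. by apply: (mulgI (q 1)); rewrite -qM !mulg1. Qed.

Lemma finmorV : {morph q : x / x^-1}.
Proof. by move=> x; apply: (mulgI (q x)); rewrite -qM !mulgV finmor1. Qed.

Lemma finmorJ : {morph q : x y / x ^ y}.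
Proof. by move=> x y; rewrite !conjgE !qM finmorV. Qed.

Lemma finmorR : {morph q : x y / [~ x, y]}.
Proof. by move=> x y; rewrite commgEl qM finmorV finmorJ -commgEl. Qed.

Lemma finmorX n : {morph q : x / x ^+ n}.
Proof. by elim: n => [|n IH] x; rewrite ?expg0 ?finmor1 // !expgS qM IH. Qed.

Lemma finmor_prod (I : Type) (r : seq I) (F : I -> G) :
  q (\prod_(i <- r) F i) = \prod_(i <- r) q (F i).
Proof. by rewrite (big_morph q qM finmor1). Qed.

Lemma finmor_eq x y : q x = q y <-> q (x^-1 * y) = 1.
Proof.
rewrite qM finmorV; split=> [->|H]; first by rewrite mulVg.
by rewrite -[LHS]mulg1 -H mulKVg.
Qed.

Lemma finmor_open (A : set gT) : open (q @^-1` A).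
Proof.
rewrite openE => x Ax; apply: (filterS _ (_ : nbhs x [set y | q (x^-1 * y) = 1])).
  by move=> y /finmor_eq; rewrite /preimage /= => <-.
apply: open_nbhs_nbhs; split; last by rewrite /= mulVg finmor1.
by case: fq => _ oq; exact: open_mulgl oq.
Qed.

Lemma finmor_closed (A : set gT) : closed (q @^-1` A).
Proof. by rewrite -[_ @^-1` _]setCK closedC; exact: (finmor_open (~` A)). Qed.

Lemma subgroup_preim (H : {group gT}) : subgroup [set x | q x \in H].
Proof.
split=> [|x y|x] /=; first by rewrite finmor1 group1.
  by rewrite qM; apply: groupM.
by rewrite finmorV groupV.
Qed.

Lemma closed_subgroup_preim (H : {group gT}) : closed_subgroup [set x | q x \in H].
Proof.
split; first exact: subgroup_preim.
exact: (@finmor_closed (fun z => is_true (z \in H))).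
Qed.

Definition img N : {set gT} := finset (fun z => `[< exists2 x, N x & q x = z >]).

Lemma imgP N (y : gT) : reflect (exists2 x, N x & q x = y) (y \in img N).
Proof. by rewrite inE; apply: asboolP. Qed.

Lemma mem_img N x : N x -> q x \in img N.
Proof. by move=> Nx; apply/imgP; exists x. Qed.

Lemma img_group_set N : subgroup N -> group_set (img N).
Proof.
case=> N1 NM _; apply/group_setP; split; first by rewrite -finmor1 mem_img.
by move=> _ _ /imgP[x Nx <-] /imgP[y Ny <-]; rewrite -qM mem_img //; apply: NM.
Qed.

Definition imgG N (gN : subgroup N) : {group gT} := Group (img_group_set gN).

End Finmor.

Lemma finmor_prodg (gT1 gT2 : finGroupType) (q1 : G -> gT1) (q2 : G -> gT2) :
  finmor q1 -> finmor q2 -> finmor (fun x => (q1 x, q2 x)).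
Proof.
move=> [M1 o1] [M2 o2]; split=> [x y|]; first by rewrite M1 M2.
rewrite (_ : _ @^-1` _ = q1 @^-1` [set 1] `&` q2 @^-1` [set 1]); first exact: openI.
by apply/seteqP; split=> x /=; [case | case => -> ->].
Qed.

Lemma mulset1 x N : mulset [set x] N = [set y | N (x^-1 * y)].
Proof.
apply/seteqP; split=> [_ [_ -> [n Nn <-]]|y Ny] /=; first by rewrite mulKg.
by exists x => //; exists (x^-1 * y); rewrite ?mulKVg.
Qed.

Lemma subg_indexE (T : finType) (q : G -> T) H N : N 1 ->
  (forall x y, q x = q y <-> N (x^-1 * y)) ->
  subg_index (mulset H N) N = #|finset (fun z => `[< exists2 x, H x & q x = z >])|.
Proof.
move=> N1 qN; rewrite /subg_index; set Q := finset _.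
pose phi (y : T) : set G := [set x | q x = y].
rewrite (_ : [set _ | _ in _] = [set phi y | y in [set` Q]]); last first.
  apply/seteqP; split=> [c [x [h Hh [n Nn Ex]] Ec]|c [y /=]].
    subst c; subst x.
    exists (q h); first by rewrite /= inE; apply/asboolP; exists h.
    have Dq : q h = q (h * n) by apply/qN; rewrite mulKg.
    rewrite mulset1; apply/seteqP; split=> z /=; rewrite /phi /=.
      by move=> E; apply/qN; rewrite -Dq -E.
    by move/qN => <-; rewrite -Dq.
  rewrite inE => /asboolP[h Hh <-] <-; exists h.
    by exists h => //; exists 1 => //; rewrite mulg1.
  rewrite mulset1; apply/seteqP; split=> z /=; rewrite /phi /=.
    by move/qN => ->.
  by move=> E; apply/qN.
rewrite fset_set_image; last exact: finite_finset.
rewrite card_in_imfset /=; last first.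
  move=> y y'; rewrite !in_fset_set ?inE; try exact: finite_finset.
  rewrite /= inE => /asboolP[h _ qh] _ /(congr1 (fun A : set G => A h)).
  by rewrite /phi /= qh => E; rewrite -E.
rewrite cardE; apply: perm_size; apply: uniq_perm.
- exact: fset_uniq.
- exact: enum_uniq.
move=> y; rewrite mem_enum in_fset_set; last exact: finite_finset.
by apply/idP/idP => [/set_mem|yQ]; last exact/mem_set.
Qed.

(* The action of [G] on the cosets of an open normal subgroup. *)
Lemma finite_quotient N : open N -> normal_subgroup N -> (subg_index setT N != 0)%N ->
  exists (gT : finGroupType) (q : G -> gT),
    [/\ finmor q, forall z, exists x, q x = z, forall x, q x = 1 <-> N x &
      #|gT| = subg_index setT N].
Proof.
move=> oN nN idx0; have [[N1 NM NV] NJ] := nN.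
pose C := [set mulset [set x] N | x in [set: G]].
(* [fset_set] of an infinite set is empty, so a nonzero index excludes infinitely many cosets. *)
have finC : finite_set C.
  by apply/not_notP => infC; move: idx0; rewrite /subg_index /fset_set; case: pselect.
have mulsetE x y : mulset [set x] N = mulset [set y] N <-> N (x^-1 * y).
  rewrite !mulset1; split=> [E|Nxy].
    have H : [set z | N (y^-1 * z)] y by rewrite /= mulVg.
    by rewrite -E in H.
  apply/seteqP; split=> z /= Nz.
    by rewrite -(mulKVg x z) mulgA; apply: NM => //; rewrite -(invgK x) -invMg; apply: NV.
  by rewrite -(mulKVg y z) mulgA; apply: NM.
pose T : finType := fset_set C.
have inC x : mulset [set x] N \in fset_set C.
  by rewrite in_fset_set //; apply/mem_set; exists x.
pose cl x : T := FSetSub (inC x).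
have clE x y : cl x = cl y <-> N (x^-1 * y).
  by rewrite -mulsetE; split=> [/(congr1 val)|E] //; apply: val_inj.
have cl_surj (c : T) : exists x, cl x = c.
  have := fsvalP c; rewrite in_fset_set // => /set_mem[x _ E].
  by exists x; apply: val_inj.
pose rp c := projT1 (cid (cl_surj c)).
have rpK c : cl (rp c) = c by rewrite /rp; case: cid.
(* The inverse turns left translation into a right action, in agreement with the left-to-right
   product of permutations. *)
pose act x c := cl (x^-1 * rp c).
have actE x y : act x (cl y) = cl (x^-1 * y).
  apply/clE; rewrite invMg invgK -mulgA mulVKg.
  by apply/clE; rewrite rpK.
have actM x y c : act (x * y) c = act y (act x c).
  by rewrite -(rpK c) !actE invMg mulgA.
have act1 c : act 1 c = c by rewrite -{1}(rpK c) actE invg1 mul1g rpK.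
have act_inj x : injective (act x).
  by move=> c c' E; rewrite -(act1 c) -(act1 c') -(mulgV x) !actM E.
pose q x := perm (@act_inj x).
have qM : {morph q : x y / x * y}.
  by move=> x y; apply/permP => c; rewrite permM !permE actM.
have q1 x : q x = 1 <-> N x.
  split=> [E|Nx].
    have := congr1 (fun s : {perm T} => s (cl 1)) E; rewrite permE perm1 actE mulg1.
    by move/clE; rewrite invgK mulg1.
  apply/permP => c; rewrite permE perm1 -{2}(rpK c) -{1}(rpK c) actE.
  apply/clE; rewrite invMg invgK -mulgA.
  by have := NJ _ (rp c) Nx; rewrite conjgE.
have fq : finmor q.
  split=> //; rewrite (_ : _ @^-1` _ = N) //.
  by apply/seteqP; split=> x /=; rewrite /preimage /= q1.
have sT : subgroup [set: G] by split.
pose Q := imgG fq sT.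
pose q' x := subg Q (q x).
have qQ x : q x \in Q by apply: mem_img.
have q'M : {morph q' : x y / x * y}.
  by move=> x y; rewrite /q' qM subgM.
have q'1 x : q' x = 1 <-> N x.
  rewrite -q1; split=> [/(congr1 (@sgval _ Q))|E]; last by rewrite /q' E morph1.
  by rewrite /q' subgK ?morph1.
exists (subg_of Q), q'; split=> //.
- split=> //; rewrite (_ : _ @^-1` _ = N) //.
  by apply/seteqP; split=> x /=; rewrite /preimage /= q'1.
- move=> z; have /imgP[x _ qx] := subgP z.
  by exists x; rewrite /q' qx sgvalK.
- rewrite -(_ : mulset setT N = setT); last first.
    by apply/seteqP; split=> // x _; exists x => //; exists 1; rewrite ?mulg1.
  rewrite (@subg_indexE _ q') //; last first.
    by move=> x y; rewrite -q'1 -finmor_eq //; split=> //; rewrite (_ : _ @^-1` _ = N) //;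
       apply/seteqP; split=> z /=; rewrite /preimage /= q'1.
  apply/eq_card => z; rewrite !inE; apply/esym/asboolP.
  have /imgP[x _ qx] := subgP z.
  by exists x; rewrite // /q' qx sgvalK.
Qed.

End Finite_images.

Section Closed_subgroups.
Local Open Scope group_scope.
Local Open Scope classical_set_scope.
Variable G : topGroupType.
Implicit Types (A B H N : set G) (x y : G).

Lemma sub_topgen A : A `<=` topgen A.
Proof. exact: sub_gen_smallest. Qed.

Lemma topgen_min A H : closed_subgroup H -> A `<=` H -> topgen A `<=` H.
Proof. by move=> cH AH; apply: smallest_sub. Qed.

Lemma topgen_closed_subgroup A : closed_subgroup (topgen A).
Proof.
split; first split.
- by move=> C [[[C1 _ _] _] _].
- move=> a b Ca Cb C AC; have [[gC cC] xC] := AC; have [_ CM _] := gC.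
  by apply: CM; [apply: Ca | apply: Cb].
- move=> a Ca C AC; have [[gC cC] xC] := AC; have [_ _ CV] := gC.
  by apply: CV; apply: Ca.
- apply: (@closed_bigI _ _ [set C | closed_subgroup C /\ A `<=` C] id).
  by move=> C [[gC cC] xC].
Qed.

Lemma closed_subgroup_conj H y : closed_subgroup H -> closed_subgroup [set x | H (x ^ y)].
Proof.
move=> [[H1 HM HV] cH]; split.
  split=> [|a b|a] /=; rewrite ?conj1g ?conjMg ?conjVg //; first exact: HM.
  exact: HV.
rewrite (_ : [set x | _] = [set x | [set z | H (y^-1 * z)] (x * y)]) //.
by apply: closed_mulgr; apply: closed_mulgl.
Qed.

Lemma topgen_normal A : (forall a y, A a -> A (a ^ y)) -> normal_subgroup (topgen A).
Proof.
move=> AJ; split=> [|x y]; first by have [] := topgen_closed_subgroup A.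
have cC := closed_subgroup_conj y (topgen_closed_subgroup A).
by apply: (topgen_min cC) => a /(AJ _ y); apply: sub_topgen.
Qed.

Lemma mulset_normal A B : normal_subgroup A -> normal_subgroup B ->
  normal_subgroup (mulset A B).
Proof.
move=> [[A1 AM AV] AJ] [[B1 BM BV] BJ]; split=> [|_ y [a Aa [b Bb <-]]]; last first.
  by exists (a ^ y); [exact: AJ | exists (b ^ y); [exact: BJ | rewrite conjMg]].
split=> [|_ _ [a Aa [b Bb <-]] [a' Aa' [b' Bb' <-]]|_ [a Aa [b Bb <-]]].
- by exists 1 => //; exists 1 => //; rewrite mulg1.
- exists (a * a'); first exact: AM.
  exists (b ^ a' * b'); first by apply: BM => //; apply: BJ.
  by rewrite conjgE !mulgA mulgK.
- exists (a^-1); first exact: AV.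
  exists (b^-1 ^ a^-1); first by apply: BJ; apply: BV.
  by rewrite conjgE invgK invMg !mulgA mulVg mul1g.
Qed.

Lemma normal_set1 : normal_subgroup [set (1 : G)].
Proof.
split=> [|x y ->]; last by rewrite conj1g.
by split=> [|a b -> ->|a ->] //=; rewrite ?mulg1 ?invg1.
Qed.

Lemma mulset_subl A B : B 1 -> A `<=` mulset A B.
Proof. by move=> B1 a Aa; exists a => //; exists 1 => //; rewrite mulg1. Qed.

Lemma mulset_subr A B : A 1 -> B `<=` mulset A B.
Proof. by move=> A1 b Bb; exists 1 => //; exists b => //; rewrite mul1g. Qed.

Lemma mulset_min A B H : subgroup H -> A `<=` H -> B `<=` H -> mulset A B `<=` H.
Proof. by move=> [_ HM _] AH BH _ [a Aa [b Bb <-]]; apply: HM; [apply: AH | apply: BH]. Qed.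

Lemma bigmulset_sub (r : seq nat) (P : nat -> set G) j :
  (forall i, P i 1) -> j \in r -> P j `<=` \big[mulset/[set 1]]_(i <- r) P i.
Proof.
move=> P1; elim: r => // i r IH; rewrite in_cons big_cons => /orP[/eqP ->|jr].
  apply: mulset_subl; elim: r {IH} => [|k r IHr]; first by rewrite big_nil.
  by rewrite big_cons; exists 1 => //; exists 1 => //; rewrite mulg1.
by apply: subset_trans (IH jr) _; apply: mulset_subr.
Qed.

Hypotheses (cG : compact [set: G]) (hG : hausdorff_space G).

Lemma mulset_closed A B : closed A -> closed B -> closed (mulset A B).
Proof.
move=> cA cB; apply: compact_closed => //.
have kA : compact A by apply: subclosed_compact cG _.
have kB : compact B by apply: subclosed_compact cG _.
rewrite (_ : mulset A B = (fun xy : G * G => xy.1 * xy.2) @` (A `*` B)).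
  apply: continuous_compact; last exact: compact_setX.
  by apply: continuous_subspaceT; exact: mulg_continuous.
apply/seteqP; split=> [_ [a Aa [b Bb <-]]|_ [[a b] [/= Aa Bb] <-]].
  by exists (a, b).
by exists a => //; exists b.
Qed.

End Closed_subgroups.

Section Discrete_groups.
Local Open Scope group_scope.
Local Open Scope classical_set_scope.

(** An alias carrying the discrete topology, through which finite [p]-groups become targets for the
    universal property of free pro-[p] groups. *)
Definition discrete_group (gT : finGroupType) : Type := gT.
HB.instance Definition _ (gT : finGroupType) := Group.on (discrete_group gT).
HB.instance Definition _ (gT : finGroupType) :=
  Topological.copy (discrete_group gT) (discrete_topology gT).
HB.instance Definition _ (gT : finGroupType) :=
  Discrete_ofNbhs.Build (discrete_group gT) erefl.

Variable gT : finGroupType.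
Local Notation T := (discrete_group gT).

Fact discrete_mul_continuous : continuous (fun xy : T * T => xy.1 * xy.2).
Proof.
move=> xy; apply/discrete_cvg; exists ([set xy.1], [set xy.2]) => /=.
  by split; exact: discrete_set1.
by move=> [a b] /= [-> ->].
Qed.

Fact discrete_inv_continuous : continuous (fun x : T => x^-1).
Proof.
move=> x U; rewrite !nbhs_principalE => /principal_filterP Ux.
exact/principal_filterP.
Qed.

HB.instance Definition _ := Group_isTopGroup.Build T
  discrete_mul_continuous discrete_inv_continuous.

Lemma discrete_pro_p (p : nat) : prime p -> p.-group [set: gT]%SET -> pro_p p T.
Proof.
move=> p_pr pG; split.
- by apply: finite_compact; exact: (@finite_finset gT).
- exact: discrete_hausdorff.
- move=> U U1; exists [set 1]; last by move=> x ->; exact: nbhs_singleton.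
  split; first exact: discrete_open.
  by split=> [|x y -> ->|x ->] //=; rewrite ?mulg1 ?invg1.
- move=> N _ [[N1 NM NV] NJ].
  pose M := finset (fun z : gT => `[< N z >]).
  have inM z : (z \in M) = `[< N z >] by rewrite inE.
  have gM : group_set M.
    apply/group_setP; split=> [|u v]; rewrite !inM; first by apply/asboolP.
    by move=> /asboolP Nu /asboolP Nv; apply/asboolP; apply: NM.
  have nM u : u \in 'N(M).
    apply/normP/setP => v; rewrite mem_conjg !inM; apply/asboolP/asboolP => Nv.
      by have := NJ _ u Nv; rewrite conjgKV.
    exact: NJ.
  pose q (z : T) := coset (Group gM) z.
  have sT : mulset setT N = setT :> set T.
    by apply/seteqP; split=> // u _; exists u => //; exists 1 => //; rewrite mulg1.
  rewrite -sT (@subg_indexE _ _ q) //; last first.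
    move=> u v; rewrite /q; split=> [E|Nuv].
      apply/asboolP; rewrite -inM -[M]/(gval (Group gM)); apply: coset_idr => //.
      by rewrite morphM ?morphV //= E mulVg.
    rewrite -[v](mulKVg u) morphM //= [X in _ = _ * X]coset_id ?mulg1 //=.
    by rewrite inM; apply/asboolP.
  exists (logn p #|[set: gT]%SET / Group gM|).
  rewrite -card_pgroup ?quotient_pgroup //; apply: eq_card => z; rewrite inE.
  apply/asboolP/idP => [[u _ <-]|/morphimP[u _ _ ->]]; last by exists u.
  by rewrite mem_quotient // inE.
Qed.

End Discrete_groups.

Section Pro_p_groups.
Local Open Scope group_scope.
Local Open Scope classical_set_scope.
Variables (p : nat) (G : topGroupType).
Hypothesis p_pr : prime p.
Hypothesis pG : pro_p p G.
Implicit Types (N H C : set G) (x y : G).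

Lemma pro_p_quotient N : open N -> normal_subgroup N ->
  exists (gT : finGroupType) (q : G -> gT),
    [/\ finmor q, forall z, exists x, q x = z, forall x, q x = 1 <-> N x &
      p.-group [set: gT]%SET].
Proof.
move=> oN nN; have [_ _ _ /(_ N oN nN)[k idxN]] := pG.
have [|gT [q [fq qs q1 cT]]] := finite_quotient oN nN.
  by rewrite idxN -lt0n expn_gt0 prime_gt0.
exists gT, q; split=> //.
by rewrite /pgroup cardsT cT idxN pnatX pnat_id.
Qed.

(** The normal core of an open subgroup is open: conjugation is jointly continuous, and compactness
    makes the neighbourhood of 1 uniform in the conjugating element. *)
Lemma pro_p_normal_nbhs (U : set G) : nbhs (1 : G) U ->
  exists N, [/\ open N, normal_subgroup N & N `<=` U].
Proof.
have [cG _ base _] := pG => /base[H [oH gH] HU]; have [H1 HM HV] := gH.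
pose N x := forall y, H (x ^ y).
have nN : normal_subgroup N.
  split=> [|x y Nx z]; last by rewrite -conjgM.
  split=> [y|x y Nx Ny z|x Nx y]; first by rewrite conj1g.
    by rewrite conjMg; apply: HM.
  by rewrite conjVg; apply: HV.
have [[N1 NM NV] _] := nN.
have NH : N `<=` H by move=> x /(_ 1); rewrite conjg1.
exists N; split=> //; last exact: subset_trans HU.
have nbN : nbhs (1 : G) N.
  have := proj1 (compact_near_coveringP [set: G]) cG.
  move=> /(_ _ (nbhs (1 : G)) (fun x y => H (x ^ y)) _) H0.
  have : \forall x \near (1 : G), [set: G] `<=` [set y | H (x ^ y)].
    apply: H0 => y _.
    have cJ : {for (y, 1 : G), continuous (fun yx : G * G => yx.2 ^ yx.1)}.
      have c1 : {for (y, 1 : G), continuous (fun yx : G * G => yx.1^-1)}.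
        apply: (@continuous_comp _ _ _ fst (fun x : G => x^-1)); first exact: cvg_fst.
        exact: invg_continuous.
      have c2 : {for (y, 1 : G), continuous (fun yx : G * G => yx.2 * yx.1)}.
        apply: (@continuous_comp _ _ _ (fun yx : G * G => (yx.2, yx.1))
          (fun xy : G * G => xy.1 * xy.2)); last exact: mulg_continuous.
        by apply: cvg_pair; [exact: cvg_snd | exact: cvg_fst].
      apply: (@continuous_comp _ _ _ (fun yx : G * G => (yx.1^-1, yx.2 * yx.1))
        (fun xy : G * G => xy.1 * xy.2)); last exact: mulg_continuous.
      exact: cvg_pair.
    have /cJ : nbhs (1 ^ y : G) H by rewrite conj1g; exact: open_nbhs_nbhs.
    by [].
  by apply: filterS => x Hx y; apply: Hx.
rewrite openE => x Nx; have /mulgl_continuous : nbhs (x^-1 * x) N by rewrite mulVg.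
move=> H0; apply: (@filterS _ (nbhs x) _ [set y | N (x^-1 * y)]) H0 => y /= Nxy.
by rewrite -(mulKVg x y); apply: NM.
Qed.

(** Some coset [x N] of an open normal subgroup [N] avoids [C], so the quotient by [N] separates. *)
Lemma pro_p_separation C x : closed_subgroup C -> ~ C x ->
  exists (gT : finGroupType) (q : G -> gT),
    [/\ finmor q, forall z, exists x, q x = z, p.-group [set: gT]%SET &
      q x \notin img q C].
Proof.
case=> [[C1 CM CV] cC] Cx.
have oU : open [set u | ~ C (x * u)].
  by rewrite -closedC (_ : ~` _ = [set u | C (x * u)]);
    [exact: closed_mulgl | apply/seteqP; split=> u /=; [move/contrapT | move=> ? []]].
have [N [oN nN NU]] : exists N, [/\ open N, normal_subgroup N & N `<=` [set u | ~ C (x * u)]].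
  by apply: pro_p_normal_nbhs; apply: open_nbhs_nbhs; split; rewrite //= mulg1.
have [gT [q [fq qs q1 pT]]] := pro_p_quotient oN nN.
exists gT, q; split=> //; apply/negP => /imgP[c Cc] /esym /(finmor_eq fq)/q1/NU /=.
by rewrite mulKVg.
Qed.

Lemma pro_p_residual x : x <> 1 ->
  exists (gT : finGroupType) (q : G -> gT),
    [/\ finmor q, forall z, exists x, q x = z, p.-group [set: gT]%SET & q x != 1].
Proof.
move=> x1; have C1 : closed_subgroup [set (1 : G)].
  split; first by case: (@normal_set1 G).
  by apply: accessible_closed_set1; apply: hausdorff_accessible; case: pG.
have [//|gT [q [fq qs pT qx]]] := pro_p_separation (x := x) C1.
exists gT, q; split=> //; apply: contra qx => /eqP ->.
by rewrite -(finmor1 fq) mem_img.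
Qed.

End Pro_p_groups.

Section Free_pro_p_groups.
Local Open Scope group_scope.
Local Open Scope classical_set_scope.
Variables (p n : nat) (F : topGroupType) (x : 'I_n -> F).
Hypothesis p_pr : prime p.
Hypothesis freeF : free_pro_p_on p x.

Lemma free_hom (gT : finGroupType) (P : {group gT}) (h : 'I_n -> gT) :
  p.-group P -> (forall i, h i \in P) ->
  exists f : F -> gT, [/\ finmor f, forall i, f (x i) = h i & forall y, f y \in P].
Proof.
move=> pP hP; pose H := discrete_group (subg_of P).
have pH : pro_p p H.
  apply: discrete_pro_p => //; rewrite -(injm_pgroup (injm_sgval P)) ?finset.subsetT //.
  by rewrite im_sgval.
have [_ /(_ H (fun i => subg P (h i)) pH)[f [[cf fM fx] _]]] := freeF.
exists (fun y => sgval (f y)); split=> [|i|y]; last exact: subgP.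
  split=> [y z|]; first by rewrite fM.
  rewrite (_ : _ @^-1` _ = f @^-1` [set 1]).
    by apply: open_comp => [y _|]; [exact: cf | exact: discrete_open].
  apply/seteqP; split=> y /=; rewrite /preimage /=; last by move=> ->.
  by move=> E; apply: val_inj; rewrite /= E.
by rewrite fx subgK.
Qed.

Lemma free_hom_uniq (gT : finGroupType) (f g : F -> gT) :
  p.-group [set: gT]%SET -> finmor f -> finmor g -> (forall i, f (x i) = g (x i)) -> f =1 g.
Proof.
move=> pT ff fg fgx; pose H := discrete_group gT.
have pH : pro_p p H by apply: discrete_pro_p.
have [_ /(_ H (fun i => f (x i)) pH)[k [_ kU]]] := freeF.
have ct (e : F -> gT) : finmor e -> continuous (e : F -> H).
  by move=> fe; apply/continuousP => A _; exact: (@finmor_open _ _ _ fe A).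
have Ef : k = f by apply: kU; split=> //; [exact: ct | case: ff].
have Eg : k = g by apply: kU; split=> //; [exact: ct | case: fg].
by move=> y; rewrite -Ef Eg.
Qed.

(** Generation is hidden in the uniqueness clause of freeness. If the image were not inside [H], a
    maximal subgroup [M] of the image containing its part in [H] would be normal, and reduction
    modulo [M] would agree with the trivial map on all [x i]. *)
Lemma free_generated (gT : finGroupType) (q : F -> gT) (H : {group gT}) :
  finmor q -> p.-group [set: gT]%SET -> (forall i, q (x i) \in H) -> forall y, q y \in H.
Proof.
move=> fq pT qH; have sT : subgroup [set: F] by [].
pose Q := imgG fq sT; have qQ y : q y \in Q by apply: mem_img.
case: (maximal_exists (subsetIl Q H)) => [E|[M maxM sHM]] y.
  by have := qQ y; rewrite -E inE => /andP[].
have pQ : p.-group Q := pgroupS (finset.subsetT _) pT.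
have /andP[sMQ nMQ] := p_maximal_normal pQ maxM.
have nM z : q z \in 'N(M) by apply: (fintype.subsetP nMQ).
have fe : finmor (fun z => coset M (q z)).
  case: (fq) => qM _; split=> [a b|]; first by rewrite qM morphM.
  rewrite (_ : _ @^-1` _ = q @^-1` [set z | z \in M]); first exact: finmor_open.
  apply/seteqP; split=> z /=; rewrite /preimage /=; last exact: coset_id.
  by move=> E; apply: coset_idr.
have fe1 : finmor (fun z : F => 1 : coset_of M).
  split=> [a b|]; first by rewrite mulg1.
  by rewrite (_ : _ @^-1` _ = setT); [exact: openT | apply/seteqP; split].
have pM : p.-group [set: coset_of M]%SET.
  by rewrite -im_quotient quotient_pgroup // (pgroupS _ pT) ?finset.subsetT.
have E1 := free_hom_uniq pM fe fe1 _.
suff sQM : Q \subset M by move/maxgroupp: maxM; rewrite properE sQM andbF.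
apply/fintype.subsetP=> _ /imgP[z _ <-]; apply: coset_idr; first exact: nM.
apply: E1 => i; apply: coset_id; apply: (fintype.subsetP sHM).
by rewrite inE qQ qH.
Qed.

Lemma free_topgen : topgen (range x) = setT.
Proof.
apply/seteqP; split=> // y _; apply: contrapT => Cy.
have cC := topgen_closed_subgroup (range x).
have [gT [q [fq _ pT]]] := pro_p_separation p_pr (proj1 freeF) cC Cy.
case/negP; have gC := proj1 cC.
apply: (free_generated (H := imgG fq gC) fq pT) => i.
by apply: mem_img; apply: sub_gen_smallest; exists i.
Qed.

(** Positive words suffice, as inverses are powers in a finite group. *)
Lemma word_approx (gT : finGroupType) (q : F -> gT) y : finmor q ->
  p.-group [set: gT]%SET -> exists s : seq 'I_n, q y = q (\prod_(i <- s) x i).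
Proof.
move=> fq pT.
have : q y \in <<[set q (x i) | i : 'I_n]%SET>>.
  by apply: free_generated => // i; apply: mem_gen; apply: imset_f.
case/gen_prodgP=> k [c cx ->].
have /fin_all_exists[f fE] (i : 'I_k) : exists j, c i = q (x j).
  by have /imsetP[j _ ->] := cx i; exists j.
exists [seq f i | i <- index_enum 'I_k].
rewrite (finmor_prod fq) big_map.
by apply: eq_bigr => i _; rewrite fE.
Qed.

End Free_pro_p_groups.

(** * The Magnus embedding *)

Lemma pgroup_exp (gT : finGroupType) (p : nat) (H : {group gT}) : prime p ->
  (forall x, x \in H -> exists k, (x ^+ (p ^ k) = 1)%g) -> (p.-group H)%g.
Proof.
move=> p_pr Hp; apply/pgroupP => q q_pr qH.
have [x xH ox] := Cauchy q_pr qH; have [k xk] := Hp x xH.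
have : q %| p ^ k by rewrite -ox order_dvdn xk.
by rewrite Euclid_dvdX // => /andP[+ _]; rewrite dvdn_prime2.
Qed.

Section Truncation.
Import GRing.Theory.
Local Open Scope ring_scope.
Variables (p D N : nat).
Hypothesis p_pr : prime p.
Local Notation A := (fps D 'F_p).
Local Notation V := {ffun N.-bseq 'I_D -> 'F_p}.
Implicit Types a b : A.

Lemma fps_natE n w : (n%:R : A) w = if nilp w then n%:R else 0.
Proof.
elim: n => [|n IH]; first by rewrite mulr0n fps0; case: ifP.
by rewrite !mulrS fpsD IH fps1; case: (nilp w); rewrite ?addr0.
Qed.

Lemma fps_pchar : p \in [pchar A].
Proof.
rewrite inE p_pr; apply/eqP/boolp.funext => w; rewrite fps_natE fps0.
by case: ifP => // _; rewrite pchar_Fp_0.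
Qed.

Lemma fps_expp (b : A) k : (1 + b) ^+ (p ^ k) = 1 + b ^+ (p ^ k).
Proof.
elim: k => [|k IH]; first by rewrite !expr1.
rewrite expnSr exprM IH [in RHS]exprM; set c := b ^+ _.
have c1 : GRing.comm 1 c by rewrite /GRing.comm mul1r mulr1.
by have := pFrobenius_autD_comm fps_pchar c1; rewrite !pFrobenius_autE expr1n.
Qed.

Definition fext (v : V) : A := fun w => if insub w is Some t then v t else 0.
Definition ftr (a : A) : V := [ffun t : N.-bseq 'I_D => a (t : seq 'I_D)].

Lemma ftrE a (w : seq 'I_D) : (size w <= N)%N -> fext (ftr a) w = a w.
Proof. by move=> wN; rewrite /fext insubT ffunE. Qed.

Lemma fextK v : ftr (fext v) = v.
Proof. by apply/ffunP => t; rewrite ffunE /fext valK. Qed.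

Lemma ftr_eq a b : ftr a = ftr b <-> fps_eq N a b.
Proof.
split=> [E w wN|E]; first by rewrite -(ftrE a) // E ftrE.
by apply/ffunP => t; rewrite !ffunE E // size_bseq.
Qed.

(** Right multiplication on truncated series. It realises the units with constant term 1 as
    permutations of a finite set, so that they form a finite group, [fgroup]. *)
Definition fact (a : A) (v : V) : V := ftr (fext v * a).

Lemma factM a b v : fact b (fact a v) = fact (a * b) v.
Proof.
apply/ftr_eq; rewrite mulrA; apply: fps_eqM => // w wN.
by rewrite ftrE.
Qed.

Lemma fact_eq a b v : fps_eq N a b -> fact a v = fact b v.
Proof. by move=> ab; apply/ftr_eq/fps_eqM. Qed.

Lemma fact_ext v : fact 1 v = v.
Proof. by rewrite /fact mulr1 fextK. Qed.

Lemma fact1 a : fact a (ftr 1) = ftr a.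
Proof.
apply/ftr_eq; rewrite -{2}[a]mul1r; apply: fps_eqM => // w wN.
by rewrite ftrE.
Qed.

Lemma fact_exp a k v : a [::] = 1 -> (N < p ^ k)%N -> fact (a ^+ (p ^ k)) v = v.
Proof.
move=> a1 Nk; rewrite -{2}(fact_ext v); apply: fact_eq => w wN.
have Da : a = 1 + (a - 1) by rewrite addrC subrK.
rewrite {1}Da fps_expp fpsD -[RHS]addr0; congr (_ + _).
apply: (@order_geX _ _ 1%N (p ^ k)); last by rewrite muln1 (leq_ltn_trans wN).
by case=> // _; rewrite fpsD fpsN fps1 a1 subrr.
Qed.

Lemma fact_inj a : a [::] = 1 -> injective (fact a).
Proof.
move=> a1 v v' E; have Nk := ltn_expl N (prime_gt1 p_pr).
rewrite -(fact_exp v a1 Nk) -(fact_exp v' a1 Nk).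
have -> : (p ^ N = (p ^ N).-1.+1)%N by rewrite prednK // expn_gt0 prime_gt0.
by rewrite exprS -!factM E.
Qed.

Definition fperm (a : A) (a1 : a [::] = 1) : {perm V} := perm (fact_inj a1).

Definition fgroup_set : {set {perm V}} :=
  finset (fun s : {perm V} => `[< exists2 a : A, a [::] = 1 & forall v, s v = fact a v >]).

Lemma in_fgroup_set (s : {perm V}) :
  reflect (exists2 a : A, a [::] = 1 & forall v, s v = fact a v) (s \in fgroup_set).
Proof. by rewrite inE; apply: asboolP. Qed.

Lemma fgroup_setP : group_set fgroup_set.
Proof.
apply/group_setP; split=> [|s t].
  by apply/in_fgroup_set; exists 1 => // v; rewrite perm1 fact_ext.
move=> /in_fgroup_set[a a1 sa] /in_fgroup_set[b b1 tb]; apply/in_fgroup_set.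
by exists (a * b) => [|v]; rewrite ?fpsM_nil ?a1 ?b1 ?mulr1 // permM sa tb factM.
Qed.

Definition fgroup : {group {perm V}} := Group fgroup_setP.

Lemma fperm_in a (a1 : a [::] = 1) : fperm a1 \in fgroup.
Proof. by apply/in_fgroup_set; exists a => // v; rewrite permE. Qed.

Lemma fgroup_pgroup : (p.-group fgroup)%g.
Proof.
apply: pgroup_exp => // s /in_fgroup_set[a a1 sa]; exists N.
have E k v : (s ^+ k)%g v = fact (a ^+ k) v.
  elim: k v => [|k IH] v; first by rewrite expg0 expr0 perm1 fact_ext.
  by rewrite expgS exprS permM IH sa factM.
apply/permP => v; rewrite E perm1 fact_exp //; exact: ltn_expl (prime_gt1 p_pr).
Qed.

End Truncation.

Section Magnus_map.
Import GRing.Theory.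
Local Open Scope ring_scope.
Variables (p D : nat) (F : topGroupType) (x : 'I_D -> F).
Hypothesis p_pr : prime p.
Hypothesis freeF : free_pro_p_on p x.
Local Notation A := (fps D 'F_p).

Definition gword (s : seq 'I_D) : F := (\prod_(l <- s) x l)%g.
Definition fword (s : seq 'I_D) : A := \prod_(l <- s) (1 + fvar 'F_p l).

Lemma fvar1_nil l : (1 + fvar 'F_p l : A) [::] = 1.
Proof. by rewrite fpsD fps1 addr0. Qed.

Lemma magnus_trunc N : exists f : F -> subg_of (fgroup p D N), finmor f /\
  forall s v, sgval (f (gword s)) v = fact (fword s) v.
Proof.
pose P := fgroup p D N.
have pP : (p.-group [set: subg_of P])%g.
  by rewrite -(injm_pgroup (injm_sgval P)) ?finset.subsetT // im_sgval fgroup_pgroup.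
pose h l := subg P (fperm N p_pr (fvar1_nil l)).
have [f [ff fx _]] := free_hom p_pr freeF (h := h) pP (fun i => finset.in_setT _).
exists f; split=> // s; elim: s => [|l s IH] v.
  by rewrite /gword /fword !big_nil (finmor1 ff) morph1 perm1 fact_ext.
have [fM _] := ff; rewrite /gword /fword !big_cons fM morphM ?inE // permM IH.
by rewrite fx /h /= subgK ?fperm_in // permE factM.
Qed.

(** In place of a topology on the algebra, [M] is controlled by finite data: a word approximates [f]
    in a finite quotient and [M f] up to degree [N] at once, and each truncation of [M] factors
    through a finite [p]-quotient. Identities checked on words then extend to [F]. *)
Record magnus_map (M : F -> A) : Prop := MagnusMap {
  magnus_approx : forall N (gT : finGroupType) (q : F -> gT) f,
    finmor q -> (p.-group [set: gT])%g ->
    exists s, q f = q (gword s) /\ fps_eq N (M f) (fword s);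
  magnus_const : forall N, exists (gT : finGroupType) (q : F -> gT),
    [/\ finmor q, (p.-group [set: gT])%g &
      forall f g, q f = q g -> fps_eq N (M f) (M g)];
  magnus_word : forall s, M (gword s) = fword s
}.

Lemma pgroup_setX (gT1 gT2 : finGroupType) :
  (p.-group [set: gT1])%g -> (p.-group [set: gT2])%g ->
  (p.-group [set: gT1 * gT2])%g.
Proof. by rewrite /pgroup !cardsT card_prod pnatM => -> ->. Qed.

(** The coefficient of [w] is read at level [size w]; a larger level gives the same value because
    [f] has a common approximating word for both levels. *)
Lemma magnus_ex : exists M : F -> A, magnus_map M.
Proof.
have pP N : (p.-group [set: subg_of (fgroup p D N)])%g.
  rewrite -(injm_pgroup (injm_sgval _)) ?finset.subsetT //.
  by rewrite im_sgval fgroup_pgroup.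
pose Phi N := projT1 (cid (magnus_trunc N)).
have PhiF N : finmor (Phi N) by rewrite /Phi; case: cid => ? [].
have PhiE N s v : sgval (Phi N (gword s)) v = fact (fword s) v.
  by rewrite /Phi; case: cid => ? [].
pose M f : A := fun w => fext (sgval (Phi (size w) f) (ftr (size w) 1)) w.
have ME N f w : (size w <= N)%N -> M f w = fext (sgval (Phi N f) (ftr N 1)) w.
  move=> wN; have [|s [E1 E2]] := word_approx p_pr freeF f
    (finmor_prodg (PhiF (size w)) (PhiF N)); first exact: pgroup_setX.
  by rewrite /M E1 E2 !PhiE !fact1 !ftrE.
exists M; split=> [N gT q f fq pT|N|s].
- have [|s [E1 E2]] := word_approx p_pr freeF f (finmor_prodg fq (PhiF N)).
    exact: pgroup_setX.
  exists s; split=> // w wN.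
  by rewrite (ME N) // E2 PhiE fact1 ftrE.
- exists (subg_of (fgroup p D N)), (Phi N).
  split; [exact: PhiF | exact: pP | move=> f g E w wN].
  by  rewrite !(ME N) // E.
- by apply/boolp.funext => w; rewrite /M PhiE fact1 ftrE.
Qed.

Variable M : F -> A.
Hypothesis MM : magnus_map M.

Lemma magnusM : {morph M : f g / (f * g)%g >-> f * g}.
Proof.
move=> f g; apply/boolp.funext => w; set N := size w.
have [gT [q [fq pT qM]]] := magnus_const MM N.
have [s [qs Ms]] := magnus_approx MM N f fq pT.
have [t [qt Mt]] := magnus_approx MM N g fq pT.
have qst : q (f * g)%g = q (gword (s ++ t)).
  by have [qMo _] := fq; rewrite /gword big_cat /= !qMo qs qt.
rewrite (qM _ _ qst) // magnus_word // /fword big_cat /=.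
by rewrite (fps_eqM Ms Mt (leqnn N)).
Qed.

Lemma magnus1 : M 1%g = 1.
Proof. by have := magnus_word MM [::]; rewrite /gword /fword !big_nil. Qed.

Lemma magnus_gen l : M (x l) = 1 + fvar 'F_p l.
Proof. by have := magnus_word MM [:: l]; rewrite /gword /fword !big_seq1. Qed.

Lemma magnus_nil f : M f [::] = 1.
Proof.
have [gT [q [fq pT _]]] := magnus_const MM 0.
have [s [_ ->]] := magnus_approx MM 0 f fq pT => //.
rewrite /fword; elim: s => [|l s IH]; first by rewrite big_nil.
by rewrite big_cons fpsM_nil IH mulr1 fvar1_nil.
Qed.

Lemma magnusX f n : M (f ^+ n)%g = M f ^+ n.
Proof. by elim: n => [|n IH]; rewrite ?expg0 ?magnus1 // expgS exprS magnusM IH. Qed.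

Lemma mulB1B1 (a b : A) : (a - 1) * (b - 1) = a * b - (a + b - 1).
Proof. by rewrite mulrBl mulrBr mulr1 mul1r -addrA -opprD addrA. Qed.

(** This is [f * g = g * f * [~ f, g]] rewritten; keeping the unit [M (g * f)] on the left avoids
    inverting series. *)
Lemma magnusR f g :
  M (g * f)%g * (M [~ f, g]%g - 1) = (M f - 1) * (M g - 1) - (M g - 1) * (M f - 1).
Proof.
rewrite mulrBr mulr1 -magnusM -commgC !magnusM !mulB1B1 [M g + _]addrC.
have aux (u v c : A) : u - v = (u - c) - (v - c) by rewrite opprB addrA subrK.
exact: aux.
Qed.

Lemma order_magnusM n f g : order_ge n (M f - 1) -> order_ge n (M g - 1) ->
  order_ge n (M (f * g)%g - 1).
Proof.
move=> nf ng; have -> : M (f * g)%g - 1 = (M f - 1) * (M g - 1) + (M f - 1) + (M g - 1).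
  have aux (u v : A) : (u - 1) + (v - 1) = (u + v - 1) - 1 by rewrite addrACA addrA.
  by rewrite magnusM mulB1B1 -addrA aux subrKA.
apply: order_geD => //; apply: order_geD => //.
by rewrite -[n]addn0; apply: order_geM => //; apply: order_ge_le ng.
Qed.

End Magnus_map.

(** * Nilpotence of the augmentation ideal and injectivity of the Magnus map *)

Section Augmentation_nilpotent.
Import GRing.Theory.
Local Open Scope ring_scope.
Variables (p D : nat) (gT : finGroupType) (y : 'I_D -> gT).
Hypothesis p_pr : prime p.
Hypothesis pT : (p.-group [set: gT])%g.
Hypothesis y_gen : forall g, (g \in <<[set y l | l : 'I_D]>>)%g.
Local Notation A := (fps D 'F_p).
Implicit Types (phi psi : gT -> 'F_p) (g h z : gT).

Definition trans g phi : gT -> 'F_p := fun z => phi (g * z)%g.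
Definition delta g phi : gT -> 'F_p := fun z => phi (g * z)%g - phi z.

(** Annihilation by the [N]-th power of the augmentation ideal of the group algebra, expressed on
    functions: [delta g] is the action of [g - 1]. *)
Fixpoint killed N phi : Prop :=
  if N is N'.+1 then forall l, killed N' (delta (y l) phi) else phi =1 (fun=> 0).

Lemma killed_ext N phi psi : phi =1 psi -> killed N phi -> killed N psi.
Proof.
elim: N phi psi => [|N IH] phi psi E; first by move=> H z; rewrite -E.
by move=> H l; apply: IH (H l) => z; rewrite /delta !E.
Qed.

Lemma killedD N phi psi : killed N phi -> killed N psi -> killed N (fun z => phi z + psi z).
Proof.
elim: N phi psi => [|N IH] phi psi Hf Hg; first by move=> z; rewrite Hf Hg addr0.
move=> l; apply: killed_ext (IH _ _ (Hf l) (Hg l)) => z.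
by rewrite /delta opprD addrACA.
Qed.

Lemma killedN N phi : killed N phi -> killed N (fun z => - phi z).
Proof.
elim: N phi => [|N IH] phi H; first by move=> z; rewrite H oppr0.
by move=> l; apply: killed_ext (IH _ (H l)) => z; rewrite /delta opprB addrC opprK.
Qed.

Lemma killedS N phi : killed N phi -> killed N.+1 phi.
Proof.
elim: N phi => [|N IH] phi H; last by move=> l; apply: IH.
by move=> l z; rewrite /delta !H subrr.
Qed.

Lemma killed_le N N' phi : (N <= N')%N -> killed N phi -> killed N' phi.
Proof.
move/subnK <-; elim: (N' - N)%N => // k IH H; rewrite addSn.
by apply: killedS; apply: IH.
Qed.

Definition nilp_fun phi := exists N, killed N phi.

Lemma nilpD phi psi : nilp_fun phi -> nilp_fun psi -> nilp_fun (fun z => phi z + psi z).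
Proof.
move=> [N HN] [N' HN']; exists (maxn N N').
by apply: killedD; [apply: killed_le HN | apply: killed_le HN']; rewrite ?leq_maxl ?leq_maxr.
Qed.

Lemma nilp_ext phi psi : phi =1 psi -> nilp_fun phi -> nilp_fun psi.
Proof. by move=> E [N H]; exists N; apply: killed_ext H. Qed.

Lemma nilpB phi psi : nilp_fun phi -> nilp_fun psi -> nilp_fun (fun z => phi z - psi z).
Proof. by move=> Hf [N H]; apply: nilpD => //; exists N; apply: killedN. Qed.

Lemma nilp_delta phi : (forall l, nilp_fun (delta (y l) phi)) -> nilp_fun phi.
Proof.
move=> /fin_all_exists[N HN]; exists (\max_l N l).+1 => l.
by apply: killed_le (HN l); apply: leq_bigmax.
Qed.

Lemma nilp_trans g phi : nilp_fun phi -> nilp_fun (trans g phi).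
Proof.
have /gen_prodgP[n [c cy ->]] := y_gen g; elim: n c cy phi => [|n IH] c cy phi Hf.
  by apply: nilp_ext Hf => z; rewrite /trans big_ord0 mul1g.
have /imsetP[l _ cl] := cy ord0.
have H1 : nilp_fun (trans (c ord0) phi).
  apply: (nilp_ext (phi := fun z => phi z + delta (c ord0) phi z)).
    by move=> z; rewrite /delta /trans addrC subrK.
  case: Hf => N HN; apply: nilpD; exists N => //.
  by rewrite cl; apply: (killedS HN).
apply: nilp_ext (IH (fun i => c (lift ord0 i)) _ _ H1) => [z|i]; last exact: cy.
by rewrite /trans big_ord_recl mulgA.
Qed.

Lemma trans_bin g n phi z :
  phi (g ^+ n * z)%g = \sum_(k < n.+1) iter k (delta g) phi z *+ 'C(n, k).
Proof.
elim: n phi => [|n IH] phi; first by rewrite big_ord1 expg0 mul1g.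
have itD k : iter k (delta g) (trans g phi) z = iter k (delta g) phi z + iter k.+1 (delta g) phi z.
  suff E m v : iter m (delta g) (trans g phi) v = iter m (delta g) phi (g * v)%g.
    by rewrite E iterS {3}/delta addrC subrK.
  by elim: m v => //= m IHm v; rewrite /delta !IHm.
have -> : phi (g ^+ n.+1 * z)%g = trans g phi (g ^+ n * z)%g.
  by rewrite /trans expgS mulgA.
rewrite IH; under eq_bigr do rewrite itD mulrnDl.
rewrite big_split /= [RHS]big_ord_recl /= !bin0.
under [in RHS]eq_bigr do rewrite /= binS mulrnDr.
rewrite big_split /= addrA; congr (_ + _).
by rewrite big_ord_recl bin0 [in RHS]big_ord_recr /= bin_small // mulr0n addr0.
Qed.

(** This is [(g - 1) ^ p = g ^ p - 1] in characteristic [p]. *)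
Lemma delta_expp g phi z : iter p (delta g) phi z = phi (g ^+ p * z)%g - phi z.
Proof.
rewrite trans_bin big_ord_recr (bigD1 (Ordinal (prime_gt0 p_pr))) //= bin0 binn !mulr1n.
rewrite big1 ?addr0 => [|i i0]; first by rewrite addrC addrK.
have /dvdnP[k ->] : (p %| 'C(p, i))%N.
  by apply: prime_dvd_bin => //; rewrite ltn_ord lt0n andbT.
by rewrite mulrnA (mulrn_pchar (pchar_Fp p_pr)).
Qed.
Lemma delta_exppX g e phi z :
  iter (p ^ e) (delta g) phi z = phi (g ^+ (p ^ e) * z)%g - phi z.
Proof.
elim: e phi z => [|e IH] phi z; first by rewrite expn0 expg1.
have it_ext m f1 f2 v : f1 =1 f2 -> iter m (delta g) f1 v = iter m (delta g) f2 v.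
  by move=> E; elim: m v => //= m IHm v; rewrite /delta !IHm.
have E k v : iter (k * p ^ e) (delta g) phi v = iter k (delta (g ^+ (p ^ e))%g) phi v.
  elim: k v => // k IHk v; rewrite mulSn iterD IH /= /delta.
  by rewrite !IHk.
by rewrite expnS E delta_expp -expgM [in LHS]mulnC.
Qed.

(* In the quotient by the nilpotent functions, a nonzero function can be made
   invariant under a p-group, by climbing a chain of normal subgroups. *)
Lemma nilp_all phi : nilp_fun phi.
Proof.
suff fixH (H : {group gT}) : (exists phi, ~ nilp_fun phi) ->
    exists2 phi, ~ nilp_fun phi & forall h, h \in H -> nilp_fun (delta h phi).
  apply: contrapT => Hphi; have [|psi npsi Hpsi] := fixH [set: gT]%G; first by exists phi.
  by apply: npsi; apply: nilp_delta => l; apply: Hpsi; rewrite finset.in_setT.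
have [k] := ubnP #|H|; elim: k H => // k IH H; rewrite ltnS => Hk ex0.
case: (eqVneq (H : {set gT}) 1%g) => [H1|H1].
  case: ex0 => psi npsi; exists psi => // h; rewrite H1 => /set1P ->.
  by exists 0%N => z; rewrite /delta mul1g subrr.
have pH : (p.-group H)%g := pgroupS (finset.subsetT _) pT.
have [E1|[K maxK _]] := maximal_exists (sub1G H).
  by rewrite -E1 eqxx in H1.
have /andP[sKH nKH] := p_maximal_normal pH maxK.
have ltKH : K \proper H := maxgroupp maxK.
have [|f nf Kf] := IH K _ ex0; first exact: leq_trans (proper_card ltKH) Hk.
have [_ [g gH gK]] := properP ltKH.
(* Modulo nilpotent functions [f] is invariant under [K]; differences with respect to [g] preserve
   this because [g] normalises [K]. *)
pose f_ j := iter j (delta g) f.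
have Kf_ j h : h \in K -> nilp_fun (delta h (f_ j)).
  elim: j h => [|j IHj] h hK; first exact: Kf.
  have hgK : (h ^ g^-1)%g \in K by rewrite memJ_norm // groupV (fintype.subsetP nKH).
  apply: nilp_ext (nilpB (nilp_trans g (IHj _ hgK)) (IHj _ hK)) => z.
  rewrite /f_ /= /trans /delta mulgA conjgE invgK !mulgA mulgKV -!mulgA.
  by rewrite opprB opprB addrACA [in RHS]addrACA [- _ + _]addrC.
have [e gE] : exists e, (g ^+ (p ^ e) = 1)%g.
  have [e oe] := p_natP (mem_p_elt pT (finset.in_setT g)).
  by exists e; rewrite -oe expg_order.
(* As [g] has [p]-power order, enough differences give 0. The last [f_ j] that is not nilpotent is
   therefore invariant under [g] as well, modulo nilpotent functions. *)
have [j [nj Hj]] : exists j, ~ nilp_fun (f_ j) /\ nilp_fun (f_ j.+1).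
  apply: contrapT => Hn.
  have H0 j : ~ nilp_fun (f_ j).
    elim: j => // j IHj Hj; apply: Hn; by exists j.
  apply: (H0 (p ^ e)%N); exists 0%N => z.
  by rewrite /f_ delta_exppX gE mul1g subrr.
exists (f_ j) => // h hH.
pose S := finset (fun h => `[< nilp_fun (delta h (f_ j)) >]).
have inS h' : reflect (nilp_fun (delta h' (f_ j))) (h' \in S).
  by rewrite inE; apply: asboolP.
have gS : group_set S.
  apply/group_setP; split=> [|u v].
    by apply/inS; exists 0%N => z; rewrite /delta mul1g subrr.
  move=> /inS Su /inS Sv; apply/inS.
  apply: nilp_ext (nilpD (nilp_trans v Su) Sv) => z.
  by rewrite /trans /delta mulgA addrA subrK.
apply/inS; suff: H \subset Group gS by move/fintype.subsetP; apply.
have sKS : K \subset Group gS by apply/fintype.subsetP => u /Kf_ Su; apply/inS.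
have gSg : g \in Group gS by apply/inS.
have sJH : (K <*> <[g]> \subset H)%g by rewrite join_subG sKH cycle_subG.
have [E|ltJ] := eqVproper sJH.
  by rewrite -E join_subG sKS cycle_subG.
have [_ maxK'] := maxgroupP maxK.
have := maxK' (K <*> <[g]>)%G ltJ (joing_subl _ _) => E.
by case/negP: gK; rewrite -E; apply: (fintype.subsetP (joing_subr _ _)); apply: cycle_id.
Qed.

(* The sum over words [l_1 ... l_k], [k <= N], of the coefficient times
   [(delta (y l_k) ... (delta (y l_1) phi)) 1]. *)
Fixpoint fev N (a : A) phi : 'F_p :=
  a [::] * phi 1%g +
  (if N is N'.+1 then \sum_l fev N' (fshift l a) (delta (y l) phi) else 0).

Lemma fev_congr N (a b : A) phi psi : fps_eq N a b -> phi =1 psi -> fev N a phi = fev N b psi.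
Proof.
elim: N a b phi psi => [|N IH] a b phi psi ab E /=; rewrite ab // E //.
congr (_ + _); apply: eq_bigr => l _; apply: IH => [w wN|z]; first exact: ab.
by rewrite /delta !E.
Qed.

Lemma fevDl N (a b : A) phi : fev N (a + b) phi = fev N a phi + fev N b phi.
Proof.
elim: N a b phi => [|N IH] a b phi /=; first by rewrite fpsD mulrDl !addr0.
rewrite fpsD mulrDl addrACA -big_split /=; congr (_ + _ + _).
by apply: eq_bigr => l _; rewrite -IH.
Qed.

Lemma fevDr N (a : A) phi psi : fev N a (fun z => phi z + psi z) = fev N a phi + fev N a psi.
Proof.
elim: N a phi psi => [|N IH] a phi psi /=; first by rewrite mulrDr !addr0.
rewrite mulrDr addrACA -big_split /=; congr (_ + _ + _); apply: eq_bigr => l _.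
rewrite -IH; apply: fev_congr => // z; by rewrite /delta opprD addrACA.
Qed.

Lemma fevS N (a : A) phi : killed N.+1 phi -> fev N.+1 a phi = fev N a phi.
Proof.
elim: N a phi => [|N IH] a phi H.
  by rewrite /= big1 // => l _; rewrite (H l) mulr0 addr0.
by rewrite [LHS]/= [RHS]/=; congr (_ + _); apply: eq_bigr => l _; apply: IH.
Qed.

Lemma fev_var N l (a : A) phi : killed N.+1 phi ->
  fev N (fvar 'F_p l * a) phi = fev N a (delta (y l) phi).
Proof.
move=> H; rewrite -(fevS _ H) [LHS]/= fpsM_nil mul0r mul0r add0r.
rewrite (bigD1 l) //= big1 ?addr0 => [|l' /negPf l'l].
  by apply: fev_congr => // w _; rewrite /fshift fpsM_var eqxx.
have -> : fshift l' (fvar 'F_p l * a) = 0.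
  by apply/boolp.funext => w; rewrite /fshift fpsM_var l'l.
have E := fevDl N 0 0 (delta (y l') phi); rewrite addr0 in E.
by apply/eqP; rewrite -(subrr (fev N 0 (delta (y l') phi))) {2}E addrK.
Qed.

(** The factor at [l] acts on functions as translation by [y l], and [killed] makes the truncation
    at [N] harmless. *)
Lemma fev_word N s phi : killed N.+1 phi ->
  fev N (\prod_(l <- s) (1 + fvar 'F_p l) : A) phi = phi (\prod_(l <- s) y l)%g.
Proof.
elim: s phi => [|l s IH] phi H.
  rewrite !big_nil; suff E k psi : fev k 1 psi = psi 1%g by [].
  case: k => [|k] /=; first by rewrite mul1r addr0.
  rewrite mul1r big1 ?addr0 // => l _; rewrite (_ : fshift l 1 = 0) //.
  have E := fevDl k 0 0 (delta (y l) psi); rewrite addr0 in E.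
  by apply/eqP; rewrite -(subrr (fev k 0 (delta (y l) psi))) {2}E addrK.
rewrite !big_cons mulrDl mul1r fevDl fev_var // -fevDr.
rewrite -[RHS]/(trans (y l) phi (\prod_(l <- s) y l)%g) -IH.
  by apply: fev_congr => // z; rewrite /delta /trans addrC subrK.
apply: (killed_ext (phi := fun z => phi z + delta (y l) phi z)).
  by move=> z; rewrite /delta /trans addrC subrK.
by apply: killedD => //; apply: killedS.
Qed.

End Augmentation_nilpotent.

Section Faithful.
Import GRing.Theory.
Local Open Scope ring_scope.
Variables (p D : nat) (F : topGroupType) (x : 'I_D -> F).
Hypothesis p_pr : prime p.
Hypothesis freeF : free_pro_p_on p x.
Local Notation A := (fps D 'F_p).
Variable M : F -> A.
Hypothesis MM : magnus_map x M.

(** A word approximating [f] has, up to degree [N], the Magnus image of the empty word, so a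
    function killed by [N.+1] differences takes equal values at [q f] and at 1. The indicator of
    [q f] contradicts this. *)
Theorem magnus_inj f : M f = 1 -> f = 1%g.
Proof.
move=> Mf; apply: contrapT => f1.
have [gT [q [fq qs pT qf]]] := pro_p_residual p_pr (proj1 freeF) f1.
pose y l := q (x l).
have y_gen g : (g \in <<[set y l | l : 'I_D]>>)%g.
  have [h <-] := qs g; apply: (free_generated p_pr freeF fq pT) => i.
  by apply: mem_gen; apply: imset_f.
pose phi z : 'F_p := (z == q f)%:R.
have [N /killedS HN] := nilp_all p_pr pT y_gen phi.
have [s [qs' Ms]] := magnus_approx MM N f fq pT.
have := fev_word s HN; rewrite -(fev_congr y (phi := phi) Ms) // Mf.
have := fev_word [::] HN; rewrite !big_nil => ->.
have -> : (\prod_(l <- s) y l)%g = q f by rewrite qs' /gword (finmor_prod fq).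
rewrite /phi eqxx; case: (eqVneq 1%g (q f)) => [E|_ /eqP]; first by rewrite -E eqxx in qf.
by rewrite eq_sym oner_eq0.
Qed.

End Faithful.

Section Leading_terms.
Import GRing.Theory.
Local Open Scope ring_scope.
Variables (p D : nat) (F : topGroupType) (x : 'I_D -> F).
Hypothesis p_pr : prime p.
Hypothesis freeF : free_pro_p_on p x.
Local Notation A := (fps D 'F_p).
Variable M : F -> A.
Hypothesis MM : magnus_map x M.
Implicit Types (f g : F) (a b : A).

Lemma fps_lead b : b <> 0 -> exists n (w : n.-tuple 'I_D), order_ge n b /\ b w != 0.
Proof.
move=> b0; have [w bw] : exists w, b w != 0.
  apply: contrapT => H; apply: b0; apply/boolp.funext => w.
  by apply/eqP; apply: contrapT => /negP bw; apply: H; exists w.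
have ex : exists n, `[< exists2 w, size w = n & b w != 0 >].
  by exists (size w); apply/asboolP; exists w.
have [n /asboolP[v vn bv] nmin] := ex_minnP ex.
have vn' : size v == n by apply/eqP.
exists n, (Tuple vn'); split=> // u un; apply/eqP; apply: contrapT => /negP bu.
have /nmin : `[< exists2 w, size w = size u & b w != 0 >] by apply/asboolP; exists u.
by rewrite leqNgt un.
Qed.

Lemma magnus_lead f : f <> 1%g -> exists n (w : n.-tuple 'I_D),
  [/\ (0 < n)%N, order_ge n (M f - 1) & M f w != 0].
Proof.
move=> f1; have [|n [w [fn fw]]] := @fps_lead (M f - 1).
  by move/subr0_eq/(magnus_inj p_pr freeF MM).
have n0 : (0 < n)%N.
  case: n w fn fw => // w _; rewrite tuple0 fpsD fpsN fps1 (magnus_nil MM).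
  by rewrite subrr eqxx.
exists n, w; split=> //; move: fw; rewrite fpsD fpsN fps1.
by case: n w n0 {fn} => // n w _; case/tupleP: w => l w; rewrite subr0.
Qed.

Lemma fpsX_lead n b (w : seq 'I_D) k : order_ge n b -> size w = n ->
  (b ^+ k) (flatten (nseq k w)) = b w ^+ k.
Proof.
move=> bn wn; elim: k => [|k IH]; first by rewrite !expr0 fps1.
have bk := @order_geX _ _ _ k _ bn; rewrite !exprS.
have sz : size (w ++ flatten (nseq k w)) = (n + k * n)%N.
  rewrite size_cat wn size_flatten /shape map_nseq wn sumn_nseq mulnC; congr (_ + _)%N.
rewrite /= (order_geM_lead bn bk) sz // eqxx.
by rewrite take_size_cat // drop_size_cat // IH.
Qed.

Lemma fpsMr_var a l v : (a * fvar 'F_p l) (rcons v l) = a v.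
Proof.
elim: v a => [|h v IH] a /=; first by rewrite fpsM_cons fpsM_nil /fvar eqxx mulr1 mulr0 addr0.
rewrite fpsM_cons IH /fvar /fshift.
by case: v {IH} => [|h' v] /=; rewrite eqseq_cons andbF mulr0 add0r.
Qed.

(** [M (f ^+ p) - 1] is [(M f - 1) ^+ p], and its coefficient at the [p]-fold repetition of a
    leading word [w] is the [p]-th power of the coefficient at [w]. *)
Lemma free_torsionfree f : f <> 1%g -> (f ^+ p)%g <> 1%g.
Proof.
move=> f1 fp; have [n [w [n0 fn fw]]] := magnus_lead f1.
have := magnusX MM f p; rewrite fp (magnus1 MM).
have Df : M f = 1 + (M f - 1) by rewrite addrC subrK.
rewrite {1}Df; have := fps_expp p_pr (M f - 1) 1; rewrite expn1 => ->.
move/eqP; rewrite -subr_eq0 opprD addrA subrr sub0r oppr_eq0 => /eqP b0.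
have := fpsX_lead p fn (size_tuple w); rewrite b0 fps0 => /esym/eqP.
rewrite expf_eq0 prime_gt0 //= fpsD fpsN fps1.
case: n w n0 fw {fn} => // n w _; case/tupleP: w => l w fw.
by rewrite subr0 (negPf fw).
Qed.

Lemma free_torsionfree_expn f k : f <> 1%g -> (f ^+ (p ^ k))%g <> 1%g.
Proof.
move=> f1; elim: k => [|k IH]; first by rewrite expg1.
by rewrite expnSr expgM; apply: free_torsionfree.
Qed.

Lemma free_centerless f : (1 < D)%N -> f <> 1%g -> exists l, [~ f, x l]%g <> 1%g.
Proof.
move=> D1 f1; have [n [w [n0 fn fw]]] := magnus_lead f1.
(* With [l] different from the first letter of the leading word [w], the word [rcons w l] occurs in
   [M f] times the variable [l], but not in the product in the other order. *)
have [l lw] : exists l : 'I_D, l != head l w.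
  case: n w n0 {fn fw} => // n w _; case/tupleP: w => h w /=.
  have D0 : (0 < D)%N by apply: ltnW.
  case: (eqVneq h (Ordinal D0)) => [->|]; last by rewrite eq_sym; exists (Ordinal D0).
  by exists (Ordinal D1).
exists l => /eqP/commgP E.
have := congr1 M E; rewrite !(magnusM MM) (magnus_gen MM) mulrDl mulrDr mul1r mulr1.
move/addrI => /(congr1 (fun b : A => b (rcons w l))).
rewrite fpsMr_var fpsM_var; case: n w n0 lw fw {fn} => // n w _.
case/tupleP: w => h w /=; rewrite eq_sym => /negPf -> fw fw0.
by rewrite fw0 eqxx in fw.
Qed.

End Leading_terms.

(** * Zassenhaus series of free pro-p groups *)

Section Zassenhaus_series.
Local Open Scope group_scope.
Local Open Scope classical_set_scope.
Variables (p : nat) (G : topGroupType).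
Hypothesis p_pr : prime p.
Local Notation Z := (@zassenhaus G p).

Let p1 : 1 < p. Proof. exact: prime_gt1. Qed.

Lemma ceil_leq m : 1 < m -> (m + p.-1) %/ p < m.
Proof.
move=> k1; rewrite ltn_divLR ?prime_gt0 //; case: p p1 => [|[|q]] //= _.
by case: m k1 => [|[|k]] // _; rewrite !mulSn !mulnS; lia.
Qed.

Lemma zassenhaus_rec_closed n i : compact [set: G] -> hausdorff_space G ->
  closed (@zassenhaus_rec G p n i) /\ normal_subgroup (@zassenhaus_rec G p n i).
Proof.
move=> cG hG; have nT : normal_subgroup [set: G] by [].
have cT : closed [set: G] by exact: closedT.
elim: n i => [|n IH] i //=; case: ifP => // _; rewrite /zassenhaus_step.
have P0 A : (forall a y, A a -> A (a ^ y)) -> closed (topgen A) /\ normal_subgroup (topgen A).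
  by move=> AJ; split; [have [] := topgen_closed_subgroup A | exact: topgen_normal].
have PM (A B : set G) : closed A /\ normal_subgroup A -> closed B /\ normal_subgroup B ->
    closed (mulset A B) /\ normal_subgroup (mulset A B).
  by move=> [cA nA] [cB nB]; split; [exact: mulset_closed | exact: mulset_normal].
apply: (PM).
  apply: (P0) => _ y [a Za <-]; exists (a ^ y); last by rewrite conjXg.
  by have [_ [_]] := IH ((i + p.-1) %/ p); apply.
apply: (big_ind (fun A => closed A /\ normal_subgroup A)) => //.
  split; last exact: normal_set1.
  by apply: accessible_closed_set1; exact: hausdorff_accessible.
move=> j jT.
rewrite /commutator_subgroup; apply: (P0) => c y [a Za [b Zb <-]].
exists (a ^ y); first by have [_ [_]] := IH j; apply.
by exists (b ^ y); [have [_ [_]] := IH (i - j)%N; apply | rewrite conjRg].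
Qed.

Hypothesis pG : pro_p p G.

Lemma zassenhaus_closed i : closed (Z i).
Proof. by have [cG hG _ _] := pG; have [] := zassenhaus_rec_closed i i cG hG. Qed.

Lemma zassenhaus_normal i : normal_subgroup (Z i).
Proof. by have [cG hG _ _] := pG; have [] := zassenhaus_rec_closed i i cG hG. Qed.

Lemma zassenhaus_subgroup i : subgroup (Z i).
Proof. by have [] := zassenhaus_normal i. Qed.

Lemma zassenhaus01 i : i <= 1 -> Z i = setT.
Proof. by case: i => [|[]]. Qed.

Lemma topgen1 A : topgen A (1 : G).
Proof. by have [[]] := topgen_closed_subgroup A. Qed.

Lemma zassenhaus_pow m x : 1 < m -> Z ((m + p.-1) %/ p) x -> Z m (x ^+ p).
Proof.
move=> m1 Zx; rewrite zassenhausE //; apply: mulset_subl.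
  apply: (big_ind (fun A : set G => A 1)) => // [A B A1 B1|j _]; last exact: topgen1.
  by exists 1 => //; exists 1 => //; rewrite mulg1.
by apply: sub_topgen; exists x.
Qed.

Lemma zassenhaus_comm a b x y : 0 < a -> 0 < b -> Z a x -> Z b y -> Z (a + b) [~ x, y].
Proof.
move=> a0 b0 Zx Zy; rewrite zassenhausE //; last by rewrite -addn1 leq_add.
apply: mulset_subr; first exact: topgen1.
apply: (@bigmulset_sub _ _ (fun j => commutator_subgroup (Z j) (Z (a + b - j))) a).
- by move=> j; exact: topgen1.
- by rewrite mem_index_iota a0 -{1}(addn0 a) ltn_add2l.
by apply: sub_topgen; exists x => //; exists y => //; rewrite addKn.
Qed.

Lemma zassenhaus_min m (H : set G) : 1 < m -> closed_subgroup H ->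
  (forall x, Z ((m + p.-1) %/ p) x -> H (x ^+ p)) ->
  (forall a b x y, 0 < a -> 0 < b -> (a + b = m)%N -> Z a x -> Z b y -> H [~ x, y]) ->
  Z m `<=` H.
Proof.
move=> m1 cH Hp Hc; have gH := proj1 cH; have [H1 _ _] := gH.
rewrite zassenhausE //; apply: mulset_min => //.
  by apply: topgen_min => // _ [x Zx <-]; apply: Hp.
rewrite big_nat; apply: (big_ind (fun A => A `<=` H)).
- by move=> _ ->.
- by move=> A B AH BH; apply: mulset_min.
move=> j /andP[j0 jm]; apply: topgen_min => // _ [x Zx [y Zy <-]].
by apply: (Hc j (m - j)%N) => //; rewrite ?subn_gt0 ?subnKC // ltnW.
Qed.

Lemma zassenhaus_desc i : Z i.+1 `<=` Z i.
Proof.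
elim/ltn_ind: i => i IH; case: (leqP i 1) => i1; first by rewrite (zassenhaus01 i1).
have mono a b : a <= b -> b <= i -> Z b `<=` Z a.
  move=> /subnK <-; elim: (b - a)%N => [|k IHk ki]; first by move=> _ x.
  rewrite addSn.
  by apply: subset_trans (IH _ _) (IHk _); rewrite addSn in ki; rewrite // ltnW.
have cZ : closed_subgroup (Z i).
  by split; [exact: zassenhaus_subgroup | exact: zassenhaus_closed].
apply: zassenhaus_min => // [|x Zx|a b x y a0 b0 ab Zx Zy]; first exact: ltnW.
  apply: zassenhaus_pow => //; apply: (mono _ _ _ _ _ Zx); first by apply: leq_div2r; lia.
  by rewrite -ltnS ceil_leq // ltnW.
(* The degree [i.+1] is lowered to [i] by lowering [b]. For [b = 1] that is impossible, and
   normality of [Z i] is used. *)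
case: (leqP b 1) => b1.
  have -> : [~ x, y] = x^-1 * x ^ y by [].
  have [[Z1 ZM ZV] ZJ] := zassenhaus_normal i.
  have Di : a = i by lia.
  by rewrite Di in Zx; apply: ZM; [exact: ZV | exact: ZJ].
have -> : i = (a + b.-1)%N by lia.
apply: zassenhaus_comm => //; first by lia.
by apply: (mono _ _ _ _ _ Zy); lia.
Qed.

Lemma zassenhaus_le a b : a <= b -> Z b `<=` Z a.
Proof.
move=> /subnK <-; elim: (b - a)%N => [|k IHk]; first by move=> x.
rewrite addSn.
exact: subset_trans (@zassenhaus_desc _) IHk.
Qed.

End Zassenhaus_series.

(** * Leading words and the lower bound for indices *)

Section Word_order.
Import GRing.Theory.
Variable D : nat.
Implicit Types (v w : seq 'I_D).

(* Words of a given length, ordered as the numbers they represent in base D. *)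
Fixpoint wval w : nat := if w is l :: w' then l * D ^ size w' + wval w' else 0.

Lemma wval_lt w : wval w < D ^ size w.
Proof.
elim: w => [|l w IH] //=; have lD := ltn_ord l.
rewrite expnS; apply: (@leq_trans (l.+1 * D ^ size w)); last by rewrite leq_mul2r lD orbT.
by rewrite mulSn addnC -addSn leq_add2r.
Qed.

Lemma wval_cat v w : wval (v ++ w) = wval v * D ^ size w + wval w.
Proof.
elim: v => [|l v IH] //=.
by rewrite IH size_cat expnD mulnA mulnDl addnA.
Qed.

Lemma wval_inj v w : size v = size w -> wval v = wval w -> v = w.
Proof.
elim: v w => [|l v IH] [|h w] //= [vw]; rewrite vw => E.
have W := wval_lt w; have V := wval_lt v; rewrite vw in V.
have P : 0 < D ^ size w by apply: leq_ltn_trans W.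
have lh : (l : nat) = h.
  have := congr1 (divn^~ (D ^ size w)) E.
  by rewrite !divnMDl // !divn_small // !addn0.
rewrite (val_inj lh); congr (_ :: _); apply: IH => //.
by move: E; rewrite lh => /addnI.
Qed.

Lemma wval_lt_cons (l h : 'I_D) v w : size v = size w -> l < h ->
  wval (l :: v) < wval (h :: w).
Proof.
move=> vw lh /=; rewrite vw; have V := wval_lt v; rewrite vw in V.
apply: leq_trans (leq_addr _ _); apply: (@leq_trans (l.+1 * D ^ size w)).
  by rewrite mulSn addnC ltn_add2r.
by rewrite leq_mul2r lh orbT.
Qed.

Lemma wval_lt_cat u v w : size v = size w -> wval v < wval w -> wval (u ++ v) < wval (u ++ w).
Proof. by move=> vw H; rewrite !wval_cat vw ltn_add2l. Qed.

Lemma wval_le_cat v v' w w' : size w = size w' -> wval v <= wval v' -> wval w <= wval w' ->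
  wval (v ++ w) <= wval (v' ++ w').
Proof. by move=> ww H1 H2; rewrite !wval_cat ww leq_add // leq_mul2r H1 orbT. Qed.

End Word_order.

Section Top_words.
Import GRing.Theory.
Local Open Scope ring_scope.
Variables (p D : nat) (F : topGroupType) (x : 'I_D -> F).
Hypothesis p_pr : prime p.
Hypothesis freeF : free_pro_p_on p x.
Local Notation A := (fps D 'F_p).
Variable M : F -> A.
Hypothesis MM : magnus_map x M.
Implicit Types (f g : F) (a b : A).

(** A leading monomial for the order that prefers low degree and, within one degree,
    lexicographically large words. *)
Definition topword f (w : seq 'I_D) :=
  [/\ order_ge (size w) (M f - 1), (M f - 1) w != 0 &
      forall v, size v = size w -> (M f - 1) v != 0 -> (wval v <= wval w)%N].

Lemma topword_gen l : topword (x l) [:: l].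
Proof.
rewrite /topword (magnus_gen MM) addrC addKr; split=> [v|| v vl].
- by case: v.
- by rewrite /fvar eqxx oner_eq0.
by rewrite /fvar; case: (eqVneq v [:: l]) => [->|_] //; rewrite eqxx.
Qed.

Lemma magnusR_lead f g m n z : order_ge m (M f - 1) -> order_ge n (M g - 1) ->
  order_ge (m + n) (M [~ f, g]%g - 1) /\
  (size z = (m + n)%N ->
   (M [~ f, g]%g - 1) z = (M f - 1) (take m z) * (M g - 1) (drop m z)
                        - (M g - 1) (take n z) * (M f - 1) (drop n z)).
Proof.
move=> fm gn; set a := M f - 1; set b := M g - 1; pose d := a * b - b * a.
have Ec : M [~ f, g]%g - 1 = M (g * f)^-1%g * d.
  by rewrite /d -(magnusR MM) mulrA -(magnusM MM) mulVg (magnus1 MM) mul1r.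
have dmn : order_ge (m + n) d.
  by apply: order_geB; [|rewrite addnC]; apply: order_geM.
have u0 : order_ge 0 (M (g * f)^-1%g) by [].
rewrite Ec; split; first by rewrite -[(m + n)%N]add0n; apply: order_geM.
move=> zmn; rewrite (order_geM_lead u0 dmn) zmn // eqxx take0 drop0 (magnus_nil MM) mul1r.
rewrite /d fpsD fpsN (order_geM_lead fm gn) zmn // eqxx.
by rewrite (order_geM_lead gn fm) zmn addnC // eqxx.
Qed.

(** The leading form of [[~ f, g]] is the commutator of the leading forms; its two products have top
    words [v ++ w] and [w ++ v], and the strict inequality excludes cancellation. *)
Lemma topwordR f g v w : topword f v -> topword g w -> (wval (w ++ v) < wval (v ++ w))%N ->
  topword [~ f, g]%g (v ++ w).
Proof.
move=> [fv fv0 fmax] [gw gw0 gmax] lt.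
have wv z : size z = (size v + size w)%N ->
    (M g - 1) (take (size w) z) * (M f - 1) (drop (size w) z) != 0 ->
    (wval z <= wval (w ++ v))%N.
  move=> zs; rewrite mulf_eq0 negb_or => /andP[z1 z2].
  have s2 : size (drop (size w) z) = size v by rewrite size_drop zs addnK.
  rewrite -(cat_take_drop (size w) z); apply: wval_le_cat => //.
    by apply: gmax => //; rewrite size_takel // zs leq_addl.
  exact: fmax.
have vw z : size z = (size v + size w)%N ->
    (M f - 1) (take (size v) z) * (M g - 1) (drop (size v) z) != 0 ->
    (wval z <= wval (v ++ w))%N.
  move=> zs; rewrite mulf_eq0 negb_or => /andP[z1 z2].
  have s2 : size (drop (size v) z) = size w by rewrite size_drop zs addKn.
  rewrite -(cat_take_drop (size v) z); apply: wval_le_cat => //.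
    by apply: fmax => //; rewrite size_takel // zs leq_addr.
  exact: gmax.
rewrite /topword size_cat.
have Rz z := magnusR_lead z fv gw.
split=> [||z zs]; first by have [] := Rz [::].
  have [_ ->] := Rz (v ++ w); last by rewrite size_cat.
  rewrite take_size_cat // drop_size_cat //.
  set t := (X in _ - X); case: (eqVneq t 0) => [->|/wv H].
    by rewrite subr0 mulf_neq0.
  by have := H (size_cat _ _); rewrite leqNgt lt.
have [_ ->] := Rz z => // nz.
case: (eqVneq ((M f - 1) (take (size v) z) * (M g - 1) (drop (size v) z)) 0) => [E|/vw]; last exact.
move: nz; rewrite E sub0r oppr_eq0 => /wv H.
exact: leq_trans (H zs) (ltnW lt).
Qed.

Section Marked_words.
Import GRing.Theory.
Variables (e : 'I_D).
Hypothesis e_max : forall l : 'I_D, l != e -> (l < e)%N.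

(** Realised by [[x e, [x e, ... [x e, x j]]]]: as [j] is below the maximal letter [e], having [e]
    in front gives the larger word. *)
Lemma topword_run k j : j != e -> exists f, topword f (rcons (nseq k e) j).
Proof.
move=> je; elim: k => [|k [f Hf]]; first by exists (x j); apply: topword_gen.
exists [~ x e, f]%g; have -> : rcons (nseq k.+1 e) j = [:: e] ++ rcons (nseq k e) j by [].
apply: topwordR => //; first exact: topword_gen.
have -> : [:: e] ++ rcons (nseq k e) j = nseq k e ++ [:: e; j].
  by rewrite -cats1 -[[:: e]]/(nseq 1 e) catA -nseqD addnC nseqD -catA.
rewrite -cats1 -catA; apply: wval_lt_cat => //.
by apply: wval_lt_cons => //; apply: e_max.
Qed.

(* The maximal prefix [nseq K e] of the first word makes [f] win against [g] in
   the comparison of the two leading words of [[~ f, g]]. *)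
Lemma topword_piece K f r k j : (k < K)%N -> j != e -> topword f (nseq K e ++ r) ->
  exists g, topword g (nseq K e ++ r ++ rcons (nseq k e) j).
Proof.
move=> kK je Hf; have [g Hg] := topword_run k je.
exists [~ f, g]%g; rewrite catA; apply: topwordR => //.
have -> : K = (k + (K - k).-1.+1)%N by lia.
rewrite nseqD -cats1 -!catA; apply: wval_lt_cat; first by rewrite /= ?(size_cat, size_nseq) /= ?(size_cat, size_nseq) /=; lia.
by apply: wval_lt_cons; [rewrite /= ?(size_cat, size_nseq) /= ?(size_cat, size_nseq) /=; lia | apply: e_max].
Qed.

(** A word not ending in [e] is a concatenation of runs of [k] letters [e] followed by some
    [j != e]. Its length keeps each [k] below [K], as [topword_piece] demands. *)
Lemma topword_append K f r u : (size u <= K)%N -> last e u != e ->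
  topword f (nseq K e ++ r) -> exists g, topword g (nseq K e ++ r ++ u).
Proof.
have [n] := ubnP (size u); elim: n u r f => // n IH u r f; rewrite ltnS => un uK ue Hf.
have hu : has (predC1 e) u.
  by apply: contraR ue => /hasPn H; apply/eqP; elim: u H {un uK} => //= a u IHu H;
     rewrite (eqP (negbNE (H a (mem_head _ _)))); apply: IHu => b bu; apply: H; rewrite inE bu orbT.
set k := find (predC1 e) u; pose j := nth e u k.
have ku : (k < size u)%N by rewrite -has_find.
have je : j != e by exact: (nth_find e hu).
have Du : u = rcons (nseq k e) j ++ drop k.+1 u.
  rewrite -cats1 -catA /= -{1}(cat_take_drop k u) (drop_nth e ku); congr (_ ++ _).
  apply: (@eq_from_nth _ e); first by rewrite size_takel ?size_nseq // ltnW.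
  move=> i; rewrite size_takel ?(ltnW ku) // => ik; rewrite nth_take // nth_nseq ik.
  by apply/eqP; have := before_find e ik; rewrite /= => /negbFE.
have [g Hg] := topword_piece (leq_trans ku uK) je Hf.
case Du' : (drop k.+1 u) => [|h u'].
  by exists g; rewrite Du Du' cats0.
have -> : nseq K e ++ r ++ u = nseq K e ++ (r ++ rcons (nseq k e) j) ++ drop k.+1 u.
  by rewrite {1}Du !catA.
apply: (IH _ _ g) => //.
- by rewrite size_drop; lia.
- by rewrite size_drop; lia.
- by move: ue; rewrite {1}Du last_cat Du' /=.
Qed.

Lemma topword_flatten K f r (us : seq (seq 'I_D)) :
  (forall u, u \in us -> size u = K /\ last e u != e) ->
  topword f (nseq K e ++ r) -> exists g, topword g (nseq K e ++ r ++ flatten us).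
Proof.
elim: us r f => [|u us IH] r f H Hf; first by exists f; rewrite cats0.
have [uK ue] := H u (mem_head _ _).
have [g Hg] := topword_append (eq_leq uK) ue Hf.
rewrite /= [r ++ _]catA; apply: (IH _ g) => // u' u'us.
by apply: H; rewrite inE u'us orbT.
Qed.

End Marked_words.
Lemma magnusV_order n f : order_ge n (M f - 1) -> order_ge n (M f^-1%g - 1).
Proof.
move=> fn; have -> : M f^-1%g - 1 = - (M f^-1%g * (M f - 1)).
  by rewrite mulrBr mulr1 -(magnusM MM) mulVg (magnus1 MM) opprB.
by apply: order_geN; rewrite -[n]add0n; apply: order_geM.
Qed.

Lemma magnus_order_closed n : closed_subgroup (fun f => order_ge n (M f - 1)).
Proof.
split; first split.
- by rewrite (magnus1 MM) subrr => w _; rewrite fps0.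
- by move=> f g; apply: (order_magnusM MM).
- exact: magnusV_order.
have [gT [q [fq _ qM]]] := magnus_const MM n.
pose B : set gT := (q @` (fun f => order_ge n (M f - 1)))%classic.
rewrite (_ : (fun f => _) = (q @^-1` B)%classic); first exact: finmor_closed.
apply/seteqP; split=> f /=; first by move=> fn; exists f.
move=> [g gn qgf] w wn; rewrite -(gn w wn) !fpsD !fpsN; congr (_ - _).
by apply: qM (ltnW wn).
Qed.

(** The right-hand side defines a closed subgroup stable under the operations of the recursion:
    [p]-th powers multiply orders by [p], by Frobenius, and commutators add them. *)
Lemma magnus_zassenhaus m f : zassenhaus p m f -> order_ge m (M f - 1).
Proof.
elim/ltn_ind: m f => m IH f; case: (leqP m 1%N) => [m1 _|m1].
  move=> w wm; have -> : w = [::] by case: w wm => // l w wm; case: m m1 wm {IH} => [|[|]].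
  by rewrite fpsD fpsN fps1 (magnus_nil MM) subrr.
apply: (zassenhaus_min p_pr m1 (magnus_order_closed m)) => [g Zg|a b g h a0 b0 abm Zg Zh].
  have c_lt := ceil_leq p_pr m1; have gn := IH _ c_lt _ Zg.
  rewrite (magnusX MM); have Df : M g = 1 + (M g - 1) by rewrite addrC subrK.
  rewrite {1}Df; have := fps_expp p_pr (M g - 1) 1; rewrite expn1 => ->.
  rewrite addrC addKr; apply: order_ge_le (order_geX (n := p) gn).
  have := ltn_ceil (m + p.-1)%N (prime_gt0 p_pr); set c := (_ %/ _)%N.
  have := prime_gt0 p_pr; rewrite mulSn [(c * p)%N]mulnC; lia.
rewrite -abm; have := @magnusR_lead g h a b [::].
case=> //; apply: IH => //; lia.
Qed.

Lemma magnusM_lead m f g z : (0 < m)%N -> order_ge m (M f - 1) -> order_ge m (M g - 1) ->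
  size z = m -> (M (f * g)%g - 1) z = (M f - 1) z + (M g - 1) z.
Proof.
move=> m0 fm gm zm; have E : M (f * g)%g - 1 = (M f - 1) * (M g - 1) + ((M f - 1) + (M g - 1)).
  have aux (u v : A) : (u - 1) + (v - 1) = (u + v - 1) - 1 by rewrite addrACA addrA.
  by rewrite (magnusM MM) mulB1B1 aux subrKA.
have -> : (M (f * g)%g - 1) z = ((M f - 1) * (M g - 1) : A) z + ((M f - 1) z + (M g - 1) z).
  by rewrite E.
rewrite (order_geM_lead fm gm); last by rewrite zm leq_addr.
by rewrite zm -[X in X == _]addn0 eqn_add2l eq_sym eqn0Ngt m0 add0r.
Qed.

(** Distinct top words of one degree make the leading forms linearly independent, so the [p ^ #|W|]
    products of powers of the [h o] stay distinct modulo elements of order above [m]. *)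
Lemma topword_count (W : finType) (m : nat) (wd : W -> seq 'I_D) (gT : finGroupType)
    (q : F -> gT) : (0 < m)%N -> injective wd -> (forall o, size (wd o) = m) ->
  (forall o, exists f, topword f (wd o)) -> finmor q ->
  (forall f, q f = 1%g -> order_ge m.+1 (M f - 1)) -> (p ^ #|W| <= #|gT|)%N.
Proof.
move=> m0 wd_inj wdm /fin_all_exists[h hT] fq qm.
pose g (c : {ffun W -> 'I_p}) : F := (\prod_(o <- index_enum W) h o ^+ c o)%g.
have hm o : order_ge m (M (h o) - 1) by have [H _ _] := hT o; rewrite -(wdm o).
have hX o k : order_ge m (M (h o ^+ k)%g - 1) /\
    forall z, size z = m -> (M (h o ^+ k)%g - 1) z = (M (h o) - 1) z *+ k.
  elim: k => [|k [IH1 IH2]].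
    by rewrite expg0 (magnus1 MM) subrr; split=> // z _; rewrite mulr0n.
  rewrite expgS; split=> [|z zm]; first exact: (order_magnusM MM).
  by rewrite (magnusM_lead m0 (hm o) IH1) // IH2 // mulrS.
have gE c : order_ge m (M (g c) - 1) /\
    forall z, size z = m -> (M (g c) - 1) z = \sum_o (M (h o) - 1) z *+ c o.
  rewrite /g; elim: (index_enum W) => [|o r [IH1 IH2]].
    by rewrite big_nil (magnus1 MM) subrr; split=> // z _; rewrite big_nil.
  rewrite big_cons; have [X1 X2] := hX o (c o).
  split=> [|z zm]; first exact: (order_magnusM MM).
  by rewrite (magnusM_lead m0 X1 IH1) // IH2 // X2 // big_cons.
have q_inj : injective (fun c => q (g c)).
  move=> c c' /(finmor_eq fq) /qm E.
  have E0 z : size z = m -> \sum_o (M (h o) - 1) z *+ c o = \sum_o (M (h o) - 1) z *+ c' o.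
    move=> zm; have [G1 G2] := gE c; have [G1' G2'] := gE c'.
    rewrite -G2 // -G2' // -[in RHS](mulKVg (g c) (g c')).
    rewrite (magnusM_lead m0 G1 _ zm); last by apply: order_ge_le E.
    by rewrite (E z) ?addr0 // zm.
  apply/ffunP => o0; apply: contrapT => /eqP co0.
  (* Triangularity: at the largest word where [c] and [c'] differ, the leading forms of the other
     differing indices have coefficient 0. *)
  have [ o co omax] := @arg_maxnP _ o0 (fun o => c o != c' o) (fun o => wval (wd o)) co0.
  have := E0 (wd o) (wdm o); rewrite (bigD1 o) //= [in RHS](bigD1 o) //=.
  set s := (X in _ + X = _); set s' := (X in _ = _ + X).
  have -> : s = s'.
    apply: eq_bigr => o' o'o; case: (eqVneq (c o') (c' o')) => [-> //|co'].
    case: (eqVneq ((M (h o') - 1) (wd o)) 0) => [->|nz]; first by rewrite !mul0rn.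
    have [_ _ H] := hT o'; have := H (wd o); rewrite !wdm => /(_ erefl nz) L1.
    have L2 := omax o' co'.
    case/eqP: o'o; apply: wd_inj; apply: wval_inj; first by rewrite !wdm.
    by apply/eqP; rewrite eqn_leq L1 andbT.
  move/addIr/eqP; have [_ nz _] := hT o.
  have Fp_small (a b : 'I_p) : (M (h o) - 1) (wd o) *+ a == (M (h o) - 1) (wd o) *+ b -> a = b.
    rewrite -mulr_natr -[in X in _ == X]mulr_natr => /eqP/(mulfI nz).
    move/(congr1 val); rewrite /= !val_Fp_nat // !modn_small // => ab.
    exact: val_inj.
  by move/Fp_small => E1; rewrite E1 eqxx in co.
have := max_card (mem [set q (g c) | c : {ffun W -> 'I_p}]%SET).
by rewrite card_imset // card_ffun card_ord.
Qed.

End Top_words.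

(** * Growth of sequences satisfying the rank recursion *)

Section Growth.
Import GRing.Theory.
Local Open Scope nat_scope.

Lemma leq_wexp2r m n e : m <= n -> m ^ e <= n ^ e.
Proof. by case: e => // e mn; rewrite leq_exp2r. Qed.

Lemma poly_le_exp C k : exists q0, forall q, q0 <= q -> C * q ^ k <= 2 ^ q.
Proof.
pose E := C * k.+1 ^ k; exists (k.+1 * E) => q Eq.
pose t := q %/ k.+1.
have Et : E <= t by rewrite leq_divRL // mulnC.
have qt : q <= k.+1 * 2 ^ t.
  apply: leq_trans (ltnW (ltn_ceil q (ltn0Sn k))) _; rewrite mulnC leq_mul2l /=.
  exact: ltn_expl.
apply: (@leq_trans (C * (k.+1 * 2 ^ t) ^ k)).
  by rewrite leq_mul2l leq_wexp2r ?orbT.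
rewrite expnMn mulnA -expnM.
apply: (@leq_trans (2 ^ t * 2 ^ (t * k))).
  by rewrite leq_mul2r (leq_trans Et) ?orbT // ltnW // ltn_expl.
by rewrite -expnD -mulnS leq_exp2l // leq_trunc_div.
Qed.

(* [c m] stands for the rank of the [m]-th factor of a Zassenhaus series in which
   a relation of degree [n] holds. *)
Lemma crank_growth D n (c : nat -> nat) : 1 < D -> 1 < n ->
  (forall m, 0 < m -> c m <= m * D ^ m) ->
  (forall m, n < m -> c (m + n) <= (D ^ n).-1 * c m + n * D ^ n * ((m + n) * D ^ ((m + n) %/ 2))) ->
  let K := 4 * n * n * D ^ (4 * n) in
  forall m, 0 < m -> c m <= K * (m %/ n + 2) ^ 2 * (D ^ n).-1 ^ (m %/ n).
Proof.
move=> D1 n1 c1 cn K; set s := (D ^ n).-1.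
have D0 : 0 < D by apply: ltnW.
have Dpos k : 0 < D ^ k by rewrite expn_gt0 D0.
have s1 : 0 < s.
  rewrite /s; have : D ^ 1 <= D ^ n by rewrite leq_exp2l // ltnW.
  by rewrite expn1; lia.
(* Half of [n] rounded up, which is smaller than [n] as [n > 1]. Hence [D ^ h <= s], and the
   half-degree error term of the recursion is at most a multiple of [s ^ r], up to a linear
   factor. *)
pose h := (n + 1) %/ 2.
have hs : D ^ h <= s.
  have : D ^ h < D ^ n by rewrite ltn_exp2l // /h; lia.
  by rewrite /s; lia.
have base m : 0 < m <= 2 * n -> c m <= 2 * n * D ^ (2 * n).
  move=> /andP[m0 mn]; apply: leq_trans (c1 m m0) _; apply: leq_mul => //.
  by rewrite leq_exp2l.
have baseK : 2 * n * D ^ (2 * n) <= K.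
  by rewrite /K; apply: leq_mul; [nia | rewrite leq_exp2l //; lia].
(* The recursion starts above [n], hence this window. Each step adds an error [K * (r + 3) * s ^ r],
   which the square absorbs as [(r + 2) ^ 2 + (r + 3) <= (r + 3) ^ 2]. *)
have main r m0 : n < m0 <= 2 * n -> c (m0 + r * n) <= K * (r + 2) ^ 2 * s ^ r.
  move=> /andP[nm0 m0n]; elim: r => [|r IH].
    rewrite addn0 expn0 muln1; apply: leq_trans (base _ _) _; first by lia.
    by apply: leq_trans baseK _; rewrite leq_pmulr.
  rewrite mulSn [n + _]addnC addnA; apply: leq_trans (cn _ _) _; first by lia.
  have L1 : n * D ^ n * ((m0 + r * n + n) * D ^ ((m0 + r * n + n) %/ 2))
            <= K * (r + 3) * s ^ r.
    have e1 : (m0 + r * n + n) %/ 2 <= 3 * n + r * h by rewrite /h; nia.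
    have e2 : D ^ ((m0 + r * n + n) %/ 2) <= D ^ (3 * n) * s ^ r.
      apply: leq_trans (leq_pexp2l D0 e1) _.
      by rewrite expnD leq_mul2l [r * h]mulnC [D ^ (h * r)]expnM leq_wexp2r ?orbT.
    have e3 : m0 + r * n + n <= n * (r + 3) by nia.
    apply: (@leq_trans (n * D ^ n * (n * (r + 3) * (D ^ (3 * n) * s ^ r)))).
      by rewrite leq_mul2l leq_mul ?orbT.
    rewrite (_ : n * D ^ n * _ = n * n * (D ^ n * D ^ (3 * n)) * (r + 3) * s ^ r); last by ring.
    rewrite -expnD (_ : n + 3 * n = 4 * n); last by ring.
    by rewrite leq_mul2r leq_mul2r /K leq_mul2r; apply/orP; right; apply/orP; right; apply/orP; right; nia.
  have sr : 0 < s ^ r by rewrite expn_gt0 s1.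
  apply: (@leq_trans (s * (K * (r + 2) ^ 2 * s ^ r) + K * (r + 3) * s ^ r)).
    by rewrite leq_add // leq_mul2l IH orbT.
  rewrite [s ^ r.+1]expnS.
  have L2 : K * (r + 3) * s ^ r <= s * (K * (r + 3) * s ^ r) by rewrite leq_pmull.
  apply: (@leq_trans (s * (K * (r + 2) ^ 2 * s ^ r) + s * (K * (r + 3) * s ^ r))).
    by rewrite leq_add2l.
  have -> : s * (K * (r + 2) ^ 2 * s ^ r) + s * (K * (r + 3) * s ^ r) =
            K * ((r + 2) ^ 2 + (r + 3)) * (s * s ^ r) by ring.
  rewrite leq_mul2r leq_mul2l; apply/orP; right; apply/orP; right.
  by rewrite -!mulnn; lia.
move=> m m1; case: (leqP m n) => mn.
  apply: leq_trans (base _ _) _; first by lia.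
  apply: leq_trans baseK _; rewrite -mulnA leq_pmulr // muln_gt0 !expn_gt0 s1.
  by rewrite addn2.
have [r [m0 [Dm m0n]]] : exists r m0, m = m0 + r * n /\ n < m0 <= 2 * n.
  exists ((m - n).-1 %/ n), ((m - n).-1 %% n + n.+1).
  have := divn_eq (m - n).-1 n; have := ltn_pmod (m - n).-1 (ltnW n1); lia.
have rn : r <= m %/ n by rewrite leq_divRL ?(ltnW n1) //; lia.
rewrite {1}Dm; apply: leq_trans (main _ _ m0n) _.
apply: leq_mul; last by rewrite leq_pexp2l.
by rewrite leq_mul2l leq_wexp2r ?orbT // leq_add2r.
Qed.

End Growth.

(** * Rank bounds in finite images of free groups *)

Section Zassenhaus_images.
Import GRing.Theory.
Local Open Scope group_scope.
Variables (p : nat) (G : topGroupType).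
Hypothesis p_pr : prime p.
Hypothesis pG : pro_p p G.
Variables (gT : finGroupType) (q : G -> gT).
Hypothesis fq : finmor q.
Hypothesis qs : forall z, exists f, q f = z.

Definition Zimg m : {group gT} := imgG fq (zassenhaus_subgroup pG m).

Lemma Zimg1 : Zimg 1 :=: [set: gT]%SET.
Proof.
apply/setP=> z; rewrite finset.in_setT; have [f <-] := qs z.
by apply: mem_img; rewrite zassenhaus01.
Qed.

Lemma Zimg_desc a : 0 < a -> Zimg a.+1 \subset Zimg a.
Proof.
move=> _; apply/fintype.subsetP => _ /imgP[f Zf <-]; apply: mem_img.
exact: zassenhaus_desc Zf.
Qed.

Lemma Zimg_comm a b : 0 < a -> 0 < b -> [~: Zimg a, Zimg b] \subset Zimg (a + b).
Proof.
move=> a0 b0; rewrite gen_subG; apply/fintype.subsetP => _ /imset2P[_ _ /imgP[f Zf <-] /imgP[g Zg <-] ->].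
by rewrite -(finmorR fq); apply: mem_img; apply: zassenhaus_comm.
Qed.

Lemma Zimg_pow a z : 0 < a -> z \in Zimg a -> z ^+ p \in Zimg (p * a).
Proof.
move=> a0 /imgP[f Zf <-]; rewrite -(finmorX fq); apply: mem_img.
have p1 := prime_gt1 p_pr; have p0 := prime_gt0 p_pr.
apply: zassenhaus_pow => //; first by rewrite (leq_trans p1) // leq_pmulr.
have cl: p.-1 < p by rewrite ltn_predL.
by rewrite mulnC divnMDl // (divn_small cl) addn0.
Qed.

Lemma Zimg_min m (H : {group gT}) : 1 < m ->
  (forall z, z \in Zimg ((m + p.-1) %/ p) -> z ^+ p \in H) ->
  (forall a b, 0 < a -> 0 < b -> (a + b = m)%N -> [~: Zimg a, Zimg b] \subset H) ->
  Zimg m \subset H.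
Proof.
move=> m1 Hp Hc; apply/fintype.subsetP => _ /imgP[f Zf <-].
apply: (zassenhaus_min p_pr m1 (closed_subgroup_preim fq H)) Zf => [g Zg|a b g h a0 b0 abm Zg Zh] /=.
  by rewrite (finmorX fq); apply: Hp; apply: mem_img.
rewrite (finmorR fq); apply: (fintype.subsetP (Hc a b a0 b0 abm)).
by apply: mem_commg; apply: mem_img.
Qed.

Lemma Zimg_index i : 0 < i -> Zimg i :=: 1 ->
  logn p #|gT| = (\sum_(1 <= m < i) crank p Zimg m)%N.
Proof.
move=> i0 Zi; rewrite -cardsT -Zimg1.
suff H k : (logn p #|Zimg 1| = \sum_(1 <= m < k.+1) crank p Zimg m + logn p #|Zimg k.+1|)%N.
  by have := H i.-1; rewrite prednK // => ->; rewrite Zi cards1 logn1 addn0.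
elim: k => [|k IH]; first by rewrite big_nil.
rewrite IH [in RHS]big_nat_recr //= -[in RHS]addnA; congr (_ + _)%N.
by rewrite -(LagrangeI (Zimg k.+1) (Zimg k.+2)) (finset.setIidPr (Zimg_desc _)) // lognM // addnC.
Qed.

End Zassenhaus_images.

Section Free_Zassenhaus_bounds.
Import GRing.Theory.
Variables (p D : nat) (F : topGroupType) (x : 'I_D -> F).
Hypothesis p_pr : prime p.
Hypothesis freeF : free_pro_p_on p x.
Let pF : pro_p p F := proj1 freeF.
Variables (gT : finGroupType) (q : F -> gT).
Hypothesis fq : finmor q.
Hypothesis qs : forall z, exists f, q f = z.
Hypothesis pT : (p.-group [set: gT])%g.
Local Notation Z := (Zimg pF fq).
Local Notation c := (crank p Z).
Local Notation y := (fun l => q (x l)).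

Lemma y_gen : (<<[set y l | l : 'I_D]>> = [set: gT])%g.
Proof.
apply/setP=> z; rewrite finset.in_setT; have [f <-] := qs z.
apply: (free_generated p_pr freeF fq pT) => i.
by apply: mem_gen; apply: imset_f.
Qed.

Let Z1 := Zimg1 pF fq qs.
Let ZD := Zimg_desc p_pr pF fq.
Let ZC := Zimg_comm p_pr pF fq.
Let ZP := Zimg_pow p_pr (pG := pF) (fq := fq).
Let ZM := Zimg_min p_pr (pG := pF) (fq := fq).

Lemma crank1 : c 1 <= D.
Proof.
have := crank_le p_pr Z1 ZD ZC ZP (ltn0Sn 0) (Zgens1 Z1 y_gen).
by move/leq_trans; apply; apply: leq_trans (leq_imset_card _ _) _; rewrite card_ord.
Qed.

Lemma crank_block_F m n : 0 < m -> c (m + n) <= D ^ n * c m + pgens p Z D m n.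
Proof. by move=> m0; apply: (crank_block p_pr Z1 ZD ZC ZP ZM y_gen). Qed.

Lemma crank_step m : 0 < m ->
  c m.+1 <= D * c m + (if p %| m.+1 then c (m.+1 %/ p) else 0).
Proof.
move=> m0; have := crank_block_F 1 m0.
by rewrite /= expn1 muln0 add0n addn1.
Qed.

Lemma ratio_bounds m : p %| m.+1 -> 0 < m.+1 %/ p /\ (m.+1 %/ p) * 2 <= m.+1.
Proof.
move=> pm; have p1 := prime_gt1 p_pr.
split; first by rewrite divn_gt0 ?(ltnW p1) // dvdn_leq.
by rewrite -[X in _ <= X](divnK pm) leq_mul2l p1 orbT.
Qed.

(** Valid for every [D], including 0 and 1, and independent of the quotient: this is the bound
    behind [zassenhaus_open]. *)
Lemma crank_crude m : 0 < m -> c m <= D.+1 ^ m.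
Proof.
elim/ltn_ind: m => -[|[|m]] // IH _.
  by rewrite expn1; apply: leq_trans crank1 _.
have m1 := IH m.+1 (ltnSn _) isT.
apply: leq_trans (crank_step _) _ => //.
rewrite [D.+1 ^ m.+2]expnS mulSn addnC; apply: leq_add; last by rewrite leq_mul2l m1 orbT.
case: ifP => // /ratio_bounds[s0 s2]; set s := m.+2 %/ p in s0 s2 *.
apply: leq_trans (IH s _ s0) _; first by lia.
by rewrite leq_pexp2l //; lia.
Qed.

(** The term from [p]-th powers has degree [s] at most [m / 2], and [s * D ^ s <= D ^ (2 * s)], so
    each step adds at most one summand [D ^ m]. *)
Lemma crank_le_pow m : 1 < D -> 0 < m -> c m <= m * D ^ m.
Proof.
move=> D1; elim/ltn_ind: m => -[|[|m]] // IH _.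
  by rewrite expn1 mul1n; exact: crank1.
have m1 := IH m.+1 (ltnSn _) isT.
apply: leq_trans (crank_step _) _ => //.
apply: (@leq_trans (D * (m.+1 * D ^ m.+1) + D ^ m.+2)); last by rewrite mulnCA -expnS mulSn addnC.
apply: leq_add; first by rewrite leq_mul2l m1 orbT.
case: ifP => // /ratio_bounds[s0 s2]; set s := m.+2 %/ p in s0 s2 *.
apply: leq_trans (IH s _ s0) _; first by lia.
apply: (@leq_trans (D ^ s * D ^ s)); first by rewrite leq_mul2r ltnW ?orbT // ltn_expl.
by rewrite -expnD leq_exp2l //; lia.
Qed.

Lemma pgens_le m k n : 1 < D -> 0 < m -> k <= n ->
  pgens p Z D m k <= k * D ^ k * ((m + n) * D ^ ((m + n) %/ 2)).
Proof.
move=> D1 m0; elim: k => [|k IH] kn //=; set B := (m + n) * _ in IH *.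
have {}IH := IH (ltnW kn).
have Dk : 0 < D ^ k.+1 by rewrite expn_gt0 (ltnW D1).
apply: (@leq_trans (D * (k * D ^ k * B) + D ^ k.+1 * B)); last first.
  by rewrite expnS; apply: eq_leq; ring.
apply: leq_add; first by rewrite leq_mul2l IH orbT.
case: ifP => //; rewrite addnS => /ratio_bounds[s0 s2]; set s := _ %/ p in s0 s2 *.
apply: leq_trans (crank_le_pow D1 s0) _; apply: leq_trans (leq_pmull _ Dk).
by apply: leq_mul; [lia | rewrite leq_exp2l //; lia].
Qed.

Lemma Zimg_bound i : 0 < i -> (forall f, zassenhaus p i f -> q f = 1%g) ->
  logn p #|gT| <= \sum_(1 <= m < i) D.+1 ^ m.
Proof.
move=> i0 qi; rewrite (Zimg_index p_pr (pG := pF) (fq := fq) qs i0).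
  by rewrite big_nat [X in _ <= X]big_nat; apply: leq_sum => m /andP[m0 _]; apply: crank_crude.
by apply/trivgP/fintype.subsetP => _ /imgP[f /qi -> <-]; rewrite finset.in_set1.
Qed.

Variable M : F -> fps D 'F_p.
Hypothesis MM : magnus_map x M.

Lemma crank_relation_F f n (w0 : n.-tuple 'I_D) m : q f = 1%g ->
  order_ge n (M f - 1)%R -> M f w0 != 0%R -> 0 < n < m ->
  c (m + n) <= (D ^ n).-1 * c m + pgens p Z D m n.
Proof.
move=> qf fn fw nm; have m0 : 0 < m by lia.
have [s [qs' Ms]] := magnus_approx MM n f fq pT.
apply: (crank_block_rel p_pr Z1 ZD ZC ZP ZM y_gen (w0 := w0) m0) => R u ZR RZ um.
apply: (crank_relation p_pr Z1 ZD ZC ZP (s := s) nm) => //.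
- by rewrite -(finmor_prod fq) -/(gword x s) -qs'.
- move=> w wn; rewrite -(fn w wn) !fpsD !fpsN; congr (_ - _)%R.
  by rewrite Ms // ltnW.
- by rewrite -[(\prod_(l <- s) _)%R]/(fword p s) -Ms // size_tuple.
Qed.

Lemma crank_growth_F f n (w0 : n.-tuple 'I_D) : 1 < D -> 1 < n -> q f = 1%g ->
  order_ge n (M f - 1)%R -> M f w0 != 0%R ->
  forall m, 0 < m ->
    c m <= (4 * n * n * D ^ (4 * n)) * (m %/ n + 2) ^ 2 * (D ^ n).-1 ^ (m %/ n).
Proof.
move=> D1 n1 qf fn fw; apply: crank_growth => // m m0; first exact: crank_le_pow.
have mpos : 0 < m by lia.
apply: leq_trans (crank_relation_F qf fn fw _) _; first by lia.
by rewrite leq_add2l pgens_le.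
Qed.

End Free_Zassenhaus_bounds.

Definition little_o (h f : nat -> nat) := forall M, exists i0, forall i, i0 <= i -> M * h i <= f i.

(** * Logarithmic indices *)

Section Log_index.
Local Open Scope group_scope.
Local Open Scope classical_set_scope.
Variables (p : nat) (G : topGroupType).
Implicit Types (H N : set G).

(* [log_p |H N : N|] *)
Definition lidx H N : nat := logn p (subg_index (mulset H N) N).

Lemma mulsetT N : N 1 -> mulset setT N = setT.
Proof. by move=> N1; apply/seteqP; split=> // x _; exists x => //; exists 1; rewrite ?mulg1. Qed.

Lemma subg_index_img (gT : finGroupType) (q : G -> gT) H N : finmor q ->
  (forall x, q x = 1 <-> N x) -> subg_index (mulset H N) N = #|img q H|.
Proof.
move=> fq qN; rewrite (@subg_indexE _ _ q) //; first by apply/qN; rewrite (finmor1 fq).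
by move=> x y; rewrite -qN finmor_eq.
Qed.

Lemma img_setT (gT : finGroupType) (q : G -> gT) : (forall z, exists f, q f = z) ->
  img q setT = [set: gT]%SET.
Proof. by move=> qs; apply/setP => z; rewrite finset.in_setT; have [f <-] := qs z; apply: mem_img. Qed.

Lemma lidxE (gT : finGroupType) (q : G -> gT) H N : finmor q ->
  (forall x, q x = 1 <-> N x) -> lidx H N = logn p #|img q H|.
Proof. by move=> fq qN; rewrite /lidx (subg_index_img H fq qN). Qed.

Lemma lidxTE (gT : finGroupType) (q : G -> gT) N : finmor q -> (forall z, exists f, q f = z) ->
  (forall x, q x = 1 <-> N x) -> lidx setT N = logn p #|gT|.
Proof. by move=> fq qs qN; rewrite (lidxE setT fq qN) img_setT // cardsT. Qed.

Lemma img_normal (gT : finGroupType) (q : G -> gT) (fq : finmor q) H (nH : normal_subgroup H) :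
  (forall z, exists f, q f = z) -> normal (imgG fq (proj1 nH)) [set: gT]%SET.
Proof.
move=> qs; rewrite /normal finset.subsetT; apply/fintype.subsetP => z _.
have [f <-] := qs z; rewrite inE; apply/fintype.subsetP => _ /imsetP[_ /imgP[h Hh <-] ->].
by rewrite -(finmorJ fq) mem_img //; apply: (proj2 nH).
Qed.

Lemma mulset_kerP (gT : finGroupType) (q : G -> gT) (fq : finmor q) H N :
  (forall x, q x = 1 <-> N x) -> forall x, q x \in img q H <-> mulset H N x.
Proof.
move=> qN x; split=> [/imgP[h Hh qh]|[h Hh [n Nn <-]]].
  by exists h => //; exists (h^-1 * x); rewrite ?mulKVg //; apply/qN; rewrite -finmor_eq.
by have [qM _] := fq; have/qN qn := Nn; rewrite qM qn mulg1 mem_img.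
Qed.

Lemma open_mulset H N : open N -> open (mulset H N).
Proof.
move=> oN; rewrite (_ : mulset H N = \bigcup_(h in H) [set x | N (h^-1 * x)]).
  by apply: bigcup_open => h _; exact: open_mulgl.
apply/seteqP; split=> [_ [h Hh [n Nn <-]]|x [h Hh Nx]].
  by exists h => //=; rewrite mulKg.
by exists h => //; exists (h^-1 * x); rewrite ?mulKVg.
Qed.

Lemma finmor_coset (gT : finGroupType) (q : G -> gT) (K : {group gT}) : finmor q ->
  normal K [set: gT]%SET -> finmor (fun x => coset K (q x)) /\
    forall x, coset K (q x) = 1 <-> q x \in K.
Proof.
move=> fq /andP[_ nK]; have nKq x : q x \in 'N(K) by apply: (fintype.subsetP nK).
have E x : coset K (q x) = 1 <-> q x \in K.
  by split=> [E|]; [exact: coset_idr | exact: coset_id].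
split=> //; have [qM _] := fq; split=> [x y|]; first by rewrite qM morphM.
rewrite (_ : _ @^-1` _ = q @^-1` [set z | z \in K]); first exact: finmor_open.
by apply/seteqP; split=> x; rewrite /preimage /= E.
Qed.

Lemma quotient_mulset (gT : finGroupType) (q : G -> gT) H N :
  finmor q -> (forall z, exists f, q f = z) -> (forall x, q x = 1 <-> N x) ->
  normal_subgroup H -> exists (hT : finGroupType) (q' : G -> hT),
  [/\ finmor q', forall z, exists f, q' f = z, forall x, q' x = 1 <-> mulset H N x &
     (#|img q H| * #|hT| = #|gT|)%N].
Proof.
move=> fq qs qN nH; have nK := img_normal fq nH qs; set K := imgG _ _ in nK.
have [fc cE] := finmor_coset fq nK.
exists (coset_of K), (fun x => coset K (q x)); split=> //.
- move=> z; have : z \in [set: gT]%SET / K by have [y Ny ->] := cosetP z; rewrite mem_quotient ?finset.in_setT.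
  by case/morphimP=> y Ny _ ->; have [f <-] := qs y; exists f.
- by move=> x; rewrite cE; exact: mulset_kerP.
rewrite -[X in (_ * X)%N]cardsT; have -> : [set: coset_of K]%SET = [set: gT]%SET / K.
  apply/setP => z; rewrite finset.in_setT; apply/esym.
  by have [y Ny ->] := cosetP z; rewrite mem_quotient ?finset.in_setT.
have nK' := normal_norm nK.
by rewrite card_quotient // -[X in (X * _)%N]/#|K| Lagrange ?cardsT ?finset.subsetT.
Qed.

Definition pquot N := exists (gT : finGroupType) (q : G -> gT),
  [/\ finmor q, forall z, exists x, q x = z, forall x, q x = 1 <-> N x & p.-group [set: gT]%SET].

Hypothesis p_pr : prime p.

Lemma pquot_mulset H N : normal_subgroup H -> pquot N -> pquot (mulset H N).
Proof.
move=> nH [gT [q [fq qs qN pT]]].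
have [hT [q' [fq' qs' qN' Eq]]] := quotient_mulset fq qs qN nH.
exists hT, q'; split=> //; apply: (pnat_dvd _ pT).
by rewrite !cardsT -Eq dvdn_mull.
Qed.

Lemma lidx_pow H N : subgroup H -> pquot N -> (p ^ lidx H N)%N = subg_index (mulset H N) N.
Proof.
move=> gH [gT [q [fq qs qN pT]]].
rewrite (lidxE H fq qN) (subg_index_img H fq qN).
by have /p_natP[k Ek] := pgroupS (finset.subsetT (imgG fq gH)) pT; rewrite Ek pfactorK.
Qed.

Lemma lidx_split H N : normal_subgroup H -> pquot N ->
  lidx setT N = (lidx H N + lidx setT (mulset H N))%N.
Proof.
move=> nH [gT [q [fq qs qN pT]]].
have [hT [q' [fq' qs' qN' Eq]]] := quotient_mulset fq qs qN nH.
rewrite (lidxTE fq qs qN) (lidxTE fq' qs' qN') (lidxE H fq qN) -Eq.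
by rewrite lognM //; [move: Eq; case: (#|img q H|) | move: Eq; case: (#|hT|)]; rewrite ?muln0 // => E;
  have := cardG_gt0 [set: gT]%SET; rewrite cardsT -E.
Qed.

Lemma lidx_mono N N' : pquot N -> normal_subgroup N -> normal_subgroup N' -> N `<=` N' ->
  lidx setT N = (lidx N' N + lidx setT N')%N.
Proof.
move=> qN nN nN' NN'; rewrite (lidx_split nN') //; congr (_ + lidx _ _)%N.
have [[N1 _ _] _] := nN; have [[N'1 N'M _] _] := nN'.
by apply/seteqP; split=> [_ [a Na [b Nb <-]]|a Na]; [apply: N'M => //; apply: NN' | apply: mulset_subl].
Qed.

Lemma lidx_gt0 H N x : subgroup H -> pquot N -> H x -> ~ N x -> (0 < lidx H N)%N.
Proof.
move=> gH [gT [q [fq qs qN pT]]] Hx Nx.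
rewrite (lidxE H fq qN) lognE p_pr (cardG_gt0 (imgG fq gH)) /=.
case: ifP => // /negP; case.
have [|_ //] := pgroup_pdiv (pgroupS (finset.subsetT (imgG fq gH)) pT).
apply/trivgPn; exists (q x); first exact: mem_img.
by apply/eqP => /qN.
Qed.

Lemma lidx_le H H' N : subgroup H -> subgroup H' -> pquot N -> H `<=` H' ->
  (lidx H N <= lidx H' N)%N.
Proof.
move=> gH gH' [gT [q [fq qs qN pT]]] HH'; rewrite !(lidxE _ fq qN).
have sI : imgG fq gH \subset imgG fq gH'.
  by apply/fintype.subsetP => _ /imgP[x Hx <-]; apply: mem_img; apply: HH'.
exact: dvdn_leq_log (cardG_gt0 (imgG fq gH')) (cardSg sI).
Qed.

Hypothesis pG : pro_p p G.

(** Among the open normal subgroups over [C] take [N] of largest index. A point of [N] outside [C]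
    is separated from [C] in a finite quotient, and intersecting [N] with the preimage of the image
    of [C] would increase the index. *)
Lemma open_of_bounded_index C B : closed C -> normal_subgroup C ->
  (forall N, open N -> normal_subgroup N -> C `<=` N -> (lidx setT N <= B)%N) -> open C.
Proof.
move=> cC nC bC; pose P k := `[< exists N, [/\ open N, normal_subgroup N, C `<=` N & lidx setT N = k] >].
have exP : exists k, P k.
  by exists (lidx setT setT); apply/asboolP; exists setT; split=> //; exact: openT.
have [k /asboolP[N [oN nN CN Nk]] kmax] : {k | P k & forall j, P j -> (j <= k)%N}.
  have Pb j : P j -> (j <= B)%N by move/asboolP=> [N [? ? ? <-]]; apply: bC.
  by case: (ex_maxnP exP Pb) => k Pk kmax; exists k.
suff -> : C = N by [].
apply/seteqP; split=> // x Nx; apply: contrapT => Cx.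
have gC := proj1 nC.
have [gT [q [fq qs pT qx]]] := pro_p_separation p_pr pG (conj gC cC) Cx.
pose K := [set y | q y \in img q C].
have nK : normal_subgroup K.
  have nI := img_normal fq nC qs.
  split=> [|y z Ky]; first exact: subgroup_preim fq (imgG fq (proj1 nC)).
  by rewrite /K /= (finmorJ fq) memJ_norm // (fintype.subsetP (normal_norm nI)) ?finset.in_setT.
have oK : open K by exact: (@finmor_open _ _ _ fq (fun z => is_true (z \in img q C))).
have oNK : open (N `&` K) by apply: openI.
have nNK : normal_subgroup (N `&` K).
  case: nN nK => -[N1 NM NV] NJ [[K1 KM KV] KJ]; split=> [|a b [Na Ka]]; last by split; [exact: NJ | exact: KJ].
  by split=> // [a b [Na Ka] [Nb Kb]|a [Na Ka]]; split; [exact: NM|exact: KM|exact: NV|exact: KV].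
have CNK : C `<=` N `&` K by move=> c Cc; split; [exact: CN | exact: mem_img].
have NNK : N `&` K `<=` N by move=> y [].
have : (lidx setT (N `&` K) <= k)%N by apply: kmax; apply/asboolP; exists (N `&` K).
rewrite (lidx_mono (pro_p_quotient p_pr pG oNK nNK) nNK nN NNK) Nk => H.
have : (0 < lidx N (N `&` K))%N.
  by apply: (@lidx_gt0 _ _ x) => //; [case: nN | exact: pro_p_quotient | move=> [_]; exact/negP].
by move: H; lia.
Qed.

End Log_index.

(** Bernoulli's inequality for [1 + 1/s] with denominators cleared. *)
Lemma bernoulli_nat s k : s ^ k * (s + k) <= s.+1 ^ k * s.
Proof.
elim: k => [|k IH]; first by rewrite !expn0 addn0.
rewrite !expnS; apply: (@leq_trans (s.+1 * (s ^ k * (s + k)))).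
  rewrite [s * s ^ k]mulnC -mulnA [s.+1 * _]mulnCA leq_mul2l; apply/orP; right; nia.
by rewrite -mulnA leq_mul2l IH orbT.
Qed.

Lemma exp_gap_base D n : 1 < D -> 1 < n -> exists2 s', 0 < s' &
  2 * (D ^ n).-1 ^ s' <= D.-1 * D ^ (n * s').-1.
Proof.
move=> D1 n1; set s := (D ^ n).-1; have D0 : 0 < D by apply: ltnW.
have Ds : D ^ n = s.+1 by rewrite prednK // expn_gt0 D0.
have s0 : 0 < s.
  have : D ^ 1 <= D ^ n by rewrite leq_exp2l // ltnW.
  by rewrite expn1; lia.
(* By Bernoulli, [D ^ n / s] raised to [3 * s] is at least 4. One factor 2 pays for [D <= 2 * D.-1],
   the other remains as the gap. *)
pose s' := 3 * s; have s'0 : 0 < s' by rewrite muln_gt0 s0.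
exists s' => //; set K := n * s'.
have K_gt0 : 0 < K by rewrite muln_gt0 s'0 (ltnW n1).
set w := D.-1 * _.
have := bernoulli_nat s s'; rewrite -Ds -expnM -/K.
rewrite (_ : s + s' = 4 * s); last by rewrite /s' -mulSn.
rewrite mulnA leq_pmul2r // => B4.
have Kw : D ^ K <= 2 * w.
  rewrite -{1}(prednK K_gt0) expnS /w mulnA leq_mul2r.
  by apply/orP; right; clear -D1; lia.
have := leq_trans B4 Kw; clear; set u := s ^ s'; lia.
Qed.

(** With [K = n * s'] and [q] about [i / K], the lower bound exceeds [s ^ (s' * q)] by the factor
    [2 ^ q], which beats every polynomial in [i]. The condition [(q.+1 * K).+2 <= i] is the one in
    [zassenhaus_lower]. *)
Lemma exp_gap D n K0 M : 1 < D -> 1 < n -> exists K i0, 0 < K /\ forall i, i0 <= i ->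
  exists q, (q.+1 * K).+2 <= i /\
    M * (i * (K0 * (i + 2) ^ 2 * (D ^ n).-1 ^ (i %/ n))) <= (D.-1 * D ^ K.-1) ^ q.
Proof.
move=> D1 n1; have [s' s'0 ws] := exp_gap_base D1 n1.
set s := (D ^ n).-1 in ws *; have D0 : 0 < D by apply: ltnW.
have s0 : 0 < s.
  have : D ^ 1 <= D ^ n by rewrite leq_exp2l // ltnW.
  by rewrite expn1 /s; clear -D1; lia.
set K := n * s' in ws; set w := D.-1 * _ in ws.
have K_gt0 : 0 < K by rewrite muln_gt0 s'0 (ltnW n1).
(* Collects the cost of rounding: [i + 2 <= q * (3 * K + 3)] and
   [i %/ n <= q * s' + (2 * s').+1]. *)
pose C := M * K0 * (3 * K + 3) ^ 3 * s ^ (2 * s').+1.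
have [q0 Hq0] := poly_le_exp C 3.
exists K, (q0.+3 * K).+2; split=> // i iq0; rewrite -/w.
pose q := ((i - 2) %/ K).-1.
have q3 : q0.+3 <= (i - 2) %/ K by rewrite leq_divRL //; clear -iq0; lia.
have qK : q.+1 = (i - 2) %/ K by rewrite /q prednK //; apply: leq_trans q3.
have iq : (q.+1 * K).+2 <= i.
  have := leq_trunc_div (i - 2) K; rewrite -qK; clear -iq0; lia.
have iq' : i <= (q + 2) * K + 1.
  have := ltn_ceil (i - 2) K_gt0; rewrite -qK addn2; clear -iq0; lia.
have [q0q q1] : q0 <= q /\ 0 < q by rewrite -qK in q3; clear -q3; lia.
exists q; split=> //; clear iq0 qK q3.
apply: (@leq_trans (2 ^ q * (s ^ s') ^ q)); last by rewrite -expnMn leq_wexp2r.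
have i3 : i + 2 <= q * (3 * K + 3).
  apply: leq_trans (_ : (q + 2) * K + 3 <= _); first by clear -iq'; lia.
  by rewrite mulnDr leq_add ?leq_pmull // -mulnCA mulnA leq_mul2r; clear -q1; lia.
have e1 : i %/ n <= q * s' + (2 * s').+1.
  rewrite -ltnS ltn_divLR ?(ltnW n1) //; apply: leq_ltn_trans iq' _.
  rewrite (_ : (q + 2) * K = (q * s' + 2 * s') * n); last by rewrite /K; ring.
  by rewrite !addnS !mulSn; clear -n1; lia.
apply: (@leq_trans (M * K0 * (q * (3 * K + 3)) ^ 3 * s ^ (q * s' + (2 * s').+1))).
  rewrite [_ ^ 3]expnS (_ : M * (i * _) = M * K0 * (i * (i + 2) ^ 2) * s ^ (i %/ n)); last by ring.
  apply: leq_mul; last by rewrite leq_pexp2l.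
  rewrite leq_mul2l; apply/orP; right; apply: leq_mul; last by rewrite leq_wexp2r.
  by apply: leq_trans i3; rewrite leq_addr.
rewrite expnD expnMn -[in X in _ <= X]expnM [s' * q]mulnC.
rewrite (_ : _ * _ = C * q ^ 3 * s ^ (q * s')); last by rewrite /C; ring.
by rewrite leq_mul2r Hq0 ?orbT.
Qed.

Section Free_zassenhaus.
Import GRing.Theory.
Variables (p D : nat) (F : topGroupType) (x : 'I_D -> F).
Hypothesis p_pr : prime p.
Hypothesis freeF : free_pro_p_on p x.
Let pF : pro_p p F := proj1 freeF.
Local Notation Z := (@zassenhaus F p).
Local Notation li := (@lidx p F setT).

Lemma zassenhaus_open i : open (Z i).
Proof.
case: (posnP i) => [->|i0]; first by rewrite zassenhaus01 //; exact: openT.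
apply: (open_of_bounded_index p_pr pF (B := \sum_(1 <= m < i) D.+1 ^ m)).
- exact: zassenhaus_closed.
- exact: zassenhaus_normal.
move=> N oN nN ZN; have [gT [q [fq qs qN pT]]] := pro_p_quotient p_pr pF oN nN.
rewrite (lidxTE p fq qs qN).
by apply: (Zimg_bound p_pr freeF fq qs pT i0) => f /ZN/qN.
Qed.

(** The top words consist of [K] letters [e], one smaller letter, and [q] blocks of length [K] not
    ending in [e], with [D.-1 * D ^ K.-1] choices for each block. Their length is [(q.+1 * K).+1],
    and elements of [Z i] have larger order. *)
Lemma zassenhaus_lower K q i : 1 < D -> 0 < K -> (q.+1 * K).+2 <= i ->
  (D.-1 * D ^ K.-1) ^ q <= li (Z i).
Proof.
move=> D1 K0 iq; have [M MM] := magnus_ex p_pr freeF.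
have D0 : 0 < D by apply: ltnW.
have De : D.-1 < D by rewrite ltn_predL.
pose e := Ordinal De.
have e_max (l : 'I_D) : l != e -> l < e.
  by rewrite -val_eqE /= => le; have := ltn_ord l; lia.
have [gT [f [ff fs fZ pT]]] := pro_p_quotient p_pr pF (zassenhaus_open i) (zassenhaus_normal pF i).
rewrite (lidxTE p ff fs fZ).
pose U : finType := (K.-1.-tuple 'I_D * {j : 'I_D | j != e})%type.
pose W : finType := q.-tuple U.
pose us (w : W) : seq (seq 'I_D) := [seq rcons (tval u.1) (val u.2) | u <- w].
pose o0 : 'I_D := Ordinal D0.
pose wd (w : W) : seq 'I_D := nseq K e ++ [:: o0] ++ flatten (us w).
have usK w u : u \in us w -> size u = K /\ last e u != e.
  move=> /mapP[[a [j je]] _ ->] /=; rewrite size_rcons size_tuple prednK // last_rcons.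
  by split.
have usS w : shape (us w) = nseq q K.
  apply: (@eq_from_nth _ 0); first by rewrite !size_map size_tuple size_nseq.
  move=> j; rewrite !size_map size_tuple => jq; rewrite nth_nseq jq.
  rewrite (nth_map [::]) ?size_map ?size_tuple //.
  by have [] := @usK w (nth [::] (us w) j) (mem_nth _ _); rewrite ?size_map ?size_tuple.
have wd_size w : size (wd w) = (q.+1 * K).+1.
  rewrite !size_cat size_nseq size_flatten usS sumn_nseq /=.
  by rewrite mulSn mulnC; lia.
have wd_inj : injective wd.
  move=> w w' /eqP; rewrite eqseq_cat // eqseq_cat // !eqxx /= => /eqP E.
  have {}E : us w = us w' by apply: eq_from_flatten_shape; rewrite ?usS.
  apply: val_inj; apply: inj_map E => -[a [j je]] [a' [j' je']] /= /rcons_inj[] /val_inj -> jj.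
  by congr (_, _); apply: val_inj.
have oe : o0 != e by rewrite -val_eqE /=; lia.
have wd_top w : exists f, topword M f (wd w).
  have [f0 Hf0] := topword_run MM e_max K oe.
  apply: (topword_flatten p_pr MM e_max (f := f0) (usK w)).
  by move: Hf0; rewrite -cats1.
have := topword_count p_pr MM (gT := gT) (q := f) (ltn0Sn _) wd_inj wd_size wd_top ff.
have -> : #|W| = (D.-1 * D ^ K.-1) ^ q.
  rewrite card_tuple card_prod card_tuple card_sig !card_ord mulnC.
  by rewrite cardC1 card_ord.
move=> H; have {}H : p ^ ((D.-1 * D ^ K.-1) ^ q) <= #|gT|.
  apply: H => g /fZ Zg; apply: (magnus_zassenhaus p_pr MM).
  exact: (zassenhaus_le p_pr pF iq).
have /p_natP[k Ek] := pT; rewrite cardsT in Ek; move: H; rewrite Ek pfactorK //.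
by rewrite leq_exp2l // prime_gt1.
Qed.

(** Passing from [f] to [[~ f, x l]], nontrivial since [F] is centreless, raises the leading degree
    above 1, as [crank_growth] requires. *)
Lemma zassenhaus_upper N : 1 < D -> normal_subgroup N -> (exists2 f, N f & f <> 1%g) ->
  exists n K, 1 < n /\ forall i, 0 < i ->
    li (mulset N (Z i)) <= i * (K * (i + 2) ^ 2 * (D ^ n).-1 ^ (i %/ n)).
Proof.
move=> D1 nN [f Nf f1]; have [M MM] := magnus_ex p_pr freeF.
have [l fl] := free_centerless p_pr freeF MM D1 f1.
have [n [w [n0 fn fw]]] := magnus_lead p_pr freeF MM f1.
have [m [w' [m0 gm gw]]] := magnus_lead p_pr freeF MM fl.
have gN : N [~ f, x l]%g.
  by have [[_ NM NV] NJ] := nN; rewrite commgEl; apply: NM; [exact: NV | exact: NJ].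
have m1 : 1 < m.
  rewrite ltnNge; apply/negP => m1; have Dm : m = 1%N by lia.
  subst m; case/tupleP: w' gw {gm} => h w'; rewrite tuple0 /= => /eqP; apply.
  have xl : order_ge 1 (M (x l) - 1)%R.
    by rewrite (magnus_gen MM) addrC addKr => -[].
  have [+ _] := magnusR_lead MM [::] fn xl.
  move/(_ [:: h]); rewrite addn1 => /(_ n0).
  by rewrite fpsD fpsN fps1 subr0.
exists m, (4 * m * m * D ^ (4 * m)); split=> // i i0; set K := 4 * m * m * _.
have s0 : 0 < (D ^ m).-1.
  have : D ^ 1 <= D ^ m by rewrite leq_exp2l // ltnW.
  by rewrite expn1; lia.
have oZ := zassenhaus_open i; have nZ := zassenhaus_normal pF i.
have [gT [q [fq qs qN pT]]] := pro_p_quotient p_pr pF (open_mulset N oZ) (mulset_normal nN nZ).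
rewrite (lidxTE p fq qs qN) (Zimg_index p_pr (pG := pF) (fq := fq) qs i0); last first.
  apply/trivgP/fintype.subsetP => _ /imgP[h Zh <-]; rewrite finset.in_set1; apply/eqP/qN.
  by apply: mulset_subr => //; case: nN => -[].
apply: (@leq_trans (\sum_(1 <= j < i) K * (i + 2) ^ 2 * (D ^ m).-1 ^ (i %/ m))); last first.
  by rewrite sum_nat_const_nat leq_mul2r leq_subr orbT.
rewrite big_nat [X in _ <= X]big_nat; apply: leq_sum => j /andP[j0 ji].
have qf : q [~ f, x l]%g = 1%g.
  by apply/qN; apply: mulset_subl => //; case: nZ => -[].
apply: leq_trans (crank_growth_F p_pr freeF fq qs pT MM D1 m1 qf gm gw j0) _.
have ji' : j %/ m <= i %/ m by apply: leq_div2r; apply: ltnW.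
apply: leq_mul; last by rewrite leq_pexp2l.
by rewrite leq_mul2l leq_wexp2r ?orbT // leq_add2r (leq_trans ji') // leq_div.
Qed.

Lemma zassenhaus_little_o N : 1 < D -> normal_subgroup N -> (exists2 f, N f & f <> 1%g) ->
  little_o (fun i => li (mulset N (Z i))) (fun i => li (Z i)).
Proof.
move=> D1 nN Nf M; have [n [K0 [n1 up]]] := zassenhaus_upper D1 nN Nf.
have [K [i0 [K_gt0 H]]] := exp_gap K0 M D1 n1.
exists i0.+1 => i ii0; have [q [iq Hq]] := H i (ltnW ii0).
apply: leq_trans (zassenhaus_lower D1 K_gt0 iq); apply: leq_trans Hq.
by rewrite leq_mul2l up ?orbT //; apply: leq_trans ii0.
Qed.

End Free_zassenhaus.

(** * Iterated verbal filtrations of free pro-p groups *)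

Section Schreier.
Local Open Scope group_scope.

Lemma gen_mulr_closed (gT : finGroupType) (D : nat) (y : 'I_D -> gT) (A : {set gT}) :
  <<[set y l | l : 'I_D]%SET>> = [set: gT]%SET -> 1 \in A ->
  (forall a l, a \in A -> a * y l \in A) -> A = [set: gT]%SET.
Proof.
move=> gy A1 AM; apply/setP => z; rewrite finset.in_setT.
have : z \in <<[set y l | l : 'I_D]%SET>> by rewrite gy finset.in_setT.
case/gen_prodgP=> n [c cy ->]; elim: n c cy => [|n IH] c cy; first by rewrite big_ord0.
rewrite big_ord_recr /=; have /imsetP[l _ ->] := cy ord_max.
by apply: AM; apply: IH.
Qed.

Lemma schreier_generators (gT : finGroupType) (D : nat) (y : 'I_D -> gT) (K : {group gT}) :
  <<[set y l | l : 'I_D]%SET>> = [set: gT]%SET ->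
  exists S : {set gT}, [/\ S \subset K, K \subset <<S>> & #|S| <= D * #|[set: gT]%SET : K|].
Proof.
move=> gy; pose rep z := repr (K :* z).
have repP z : rep z \in K :* z by exact: mem_repr_rcoset.
have repK z : K :* rep z = K :* z by apply/rcoset_eqP.
have repE z w : K :* z = K :* w -> rep z = rep w by rewrite /rep => ->.
pose S := [set repr (A : {set gT}) * y l * (rep (repr (A : {set gT}) * y l))^-1 |
   A in rcosets K [set: gT]%SET, l in [set: 'I_D]%SET]%SET.
exists S; split.
- apply/fintype.subsetP => _ /imset2P[A l _ _ ->]; set h := _ * y l.
  have /rcosetP[k kK ->] := repP h.
  by rewrite invMg mulKVg groupV.
- have E : [set h | h * (rep h)^-1 \in <<S>>]%SET = [set: gT]%SET.
    apply: (gen_mulr_closed gy).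
      by rewrite inE /rep rcoset1 repr_group mul1g invg1 group1.
    move=> a l; rewrite !inE => aS.
    have -> : a * y l * (rep (a * y l))^-1
      = a * (rep a)^-1 * (rep a * y l * (rep (rep a * y l))^-1).
      rewrite (repE (rep a * y l) (a * y l)); last by rewrite !rcosetM repK.
      by rewrite !mulgA mulgKV.
    apply: groupM => //; apply: mem_gen; apply/imset2P; exists (K :* a) l => //.
    by apply/rcosetsP; exists a.
  apply/fintype.subsetP => k kK; have : k \in [set: gT]%SET by rewrite finset.in_setT.
  by rewrite -E inE /rep rcoset_id // repr_group invg1 mulg1.
- apply: leq_trans (leq_card_imset2 _ _ _) _.
  by rewrite cardsT card_ord mulnC.
Qed.

End Schreier.

Section Cocycles.
Local Open Scope group_scope.
Variables (p D : nat) (F : topGroupType) (x : 'I_D -> F).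
Hypothesis p_pr : prime p.
Hypothesis freeF : free_pro_p_on p x.
Variables (Q H : finGroupType) (q : F -> Q).
Hypotheses (fq : finmor q) (pQ : p.-group [set: Q]%SET) (pH : p.-group [set: H]%SET).

(* [phi ^~ 1] is a homomorphism on the kernel of [q], and by Shapiro's lemma
   every homomorphism on that kernel arises in this way. *)
Record cocycle (phi : F -> Q -> H) : Prop := Cocycle {
  cocycleM : forall f g y, phi (f * g) y = phi f y * phi g (y * q f);
  cocycle_const : exists (W : finGroupType) (s : F -> W),
    finmor s /\ forall f g, s f = s g -> q f = q g /\ phi f = phi g }.

(** A permutation form of the wreath product of [K] with [Q]: homomorphisms from [F] into it lying
    over [q] correspond to cocycles with values in [K]. *)
Definition monomial_set (K : {group H}) : {set {perm Q * H}} :=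
  finset (fun s : {perm Q * H} => `[< exists t (phi : Q -> H), (forall y, phi y \in K) /\
     forall y g, s (y, g) = (y * t, g * phi y) >]).

Lemma in_monomial (K : {group H}) (s : {perm Q * H}) :
  reflect (exists t (phi : Q -> H), (forall y, phi y \in K) /\
     forall y g, s (y, g) = (y * t, g * phi y)) (s \in monomial_set K).
Proof. by rewrite inE; apply: asboolP. Qed.

Lemma monomial_group_set (K : {group H}) : group_set (monomial_set K).
Proof.
apply/group_setP; split.
  apply/in_monomial; exists 1, (fun=> 1); split=> [y|y g]; first exact: group1.
  by rewrite perm1 !mulg1.
move=> s s' /in_monomial[t [phi [pK sE]]] /in_monomial[t' [phi' [pK' sE']]].
apply/in_monomial; exists (t * t'), (fun y => phi y * phi' (y * t)).
by split=> [y|y g]; rewrite ?groupM // permM sE sE' !mulgA.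
Qed.

Definition monomial_group K : {group {perm Q * H}} := Group (monomial_group_set K).

Lemma monomial_pgroup K : p.-group (monomial_group K).
Proof.
have [a Ea] : exists a, #|Q| = (p ^ a)%N by have := pQ; rewrite /pgroup cardsT => /p_natP[k ->]; exists k.
have [b Eb] : exists b, #|H| = (p ^ b)%N by have := pH; rewrite /pgroup cardsT => /p_natP[k ->]; exists k.
have X1 (gT : finGroupType) (z : gT) : z ^+ #|gT| = 1.
  by apply/eqP; rewrite -order_dvdn -cardsT order_dvdG ?finset.in_setT.
(* The [#|Q|]-th power fixes all first coordinates, and the [#|H|]-th power of that is trivial. *)
apply: pgroup_exp => // s /in_monomial[t [phi [_ sE]]]; exists (a + b)%N.
have E1 n : exists psi : Q -> H, forall y g, (s ^+ n) (y, g) = (y * t ^+ n, g * psi y).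
  elim: n => [|n [psi IH]].
    by exists (fun=> 1) => y g; rewrite !expg0 perm1 !mulg1.
  exists (fun y => psi y * phi (y * t ^+ n)) => y g.
  by rewrite !expgSr permM IH sE !mulgA.
have [psi E2] := E1 (p ^ a)%N.
have E3 n y g : (s ^+ (p ^ a * n)) (y, g) = (y, g * psi y ^+ n).
  elim: n g => [|n IH] g; first by rewrite muln0 !expg0 perm1 mulg1.
  rewrite mulnS expgD permM E2 -Ea X1 mulg1 Ea IH expgS mulgA //.
by apply/permP => -[y g]; rewrite expnD E3 -Eb X1 mulg1 perm1.
Qed.

(** By freeness the values at the generators are arbitrary: send [x l] to the monomial permutation
    over [q (x l)] with entries [c ^~ l] and read off second coordinates. *)
Lemma cocycle_ex (K : {group H}) (c : Q -> 'I_D -> H) : (forall y l, c y l \in K) ->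
  exists phi, [/\ cocycle phi, forall f y, phi f y \in K & forall l y, phi (x l) y = c y l].
Proof.
move=> cK.
have inj l : injective (fun yg : Q * H => (yg.1 * q (x l), yg.2 * c yg.1 l)).
  by move=> [y g] [y' g'] [/mulIg -> /mulIg ->].
have [l|s [fs sx sP]] := free_hom p_pr freeF (h := fun l => perm (@inj l)) (monomial_pgroup K).
  apply/in_monomial; exists (q (x l)), (fun y => c y l).
  by split=> // y g; rewrite permE.
have [sM _] := fs; have [qM _] := fq.
have s1 f : forall y g, (s f (y, g)).1 = y * q f.
  have sub : subgroup [set f | forall y g, (s f (y, g)).1 = y * q f]%classic.
    split=> [y g|f1 f2 H1 H2 y g|f1 H1 y g] /=.
    - by rewrite (finmor1 fs) perm1 (finmor1 fq) mulg1.
    - by rewrite sM permM [s f1 _]surjective_pairing H2 H1 qM mulgA.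
    - have E := permKV (s f1) (y, g); rewrite (finmorV fs) (finmorV fq).
      apply: (mulIg (q f1)); rewrite mulgKV.
      by rewrite -(H1 _ ((s f1)^-1 (y, g)).2) -surjective_pairing E.
  have fW := finmor_prodg fs fq.
  pose S := [set f | forall y g, (s f (y, g)).1 = y * q f]%classic.
  have cS : closed S.
    rewrite (_ : S = (fun z => (s z, q z)) @^-1` [set w : {perm Q * H} * Q | forall y g, (w.1 (y, g)).1 = y * w.2])%classic //.
    exact: (@finmor_closed _ _ _ fW).
  have : topgen (range x) f by rewrite (free_topgen p_pr freeF).
  apply: (topgen_min (conj sub cS)) => _ [l _ <-] y g.
  by rewrite sx permE.
have s2 f : forall y g, (s f (y, g)).2 = g * (s f (y, 1)).2.
  have /in_monomial[t [phi [_ E]]] := sP f.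
  by move=> y g; rewrite !E /= mul1g.
exists (fun f y => (s f (y, 1)).2); split.
- split=> [f g y|].
    by rewrite sM permM [s f _]surjective_pairing s2 s1.
  exists {perm Q * H}, s; split=> // f g E; split; last by rewrite E.
  by apply: (mulgI 1); rewrite -!(s1 _ _ 1) E.
- move=> f y; have /in_monomial[t [phi [pK E]]] := sP f.
  by rewrite E /= mul1g.
- by move=> l y; rewrite sx permE /= mul1g.
Qed.

Section Cocycle_theory.
Variable phi : F -> Q -> H.
Hypothesis cphi : cocycle phi.

Lemma cocycle1 y : phi 1 y = 1.
Proof.
have := cocycleM cphi 1 1 y; rewrite mulg1 (finmor1 fq) mulg1 => E.
by apply: (mulgI (phi 1 y)); rewrite -E mulg1.
Qed.

Lemma cocycle_kerM u v : q u = 1 -> phi (u * v) 1 = phi u 1 * phi v 1.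
Proof. by move=> qu; rewrite (cocycleM cphi) qu mulg1. Qed.

Lemma cocycle_kerV u : q u = 1 -> phi u^-1 1 = (phi u 1)^-1.
Proof. by move=> qu; apply: (mulgI (phi u 1)); rewrite -cocycle_kerM // !mulgV cocycle1. Qed.

Lemma cocycle_closed_subgroup (L : {group H}) :
  closed_subgroup [set u | q u = 1 /\ phi u 1 \in L]%classic.
Proof.
have [qM _] := fq; split; first split.
- by rewrite /= (finmor1 fq) cocycle1 group1.
- by move=> u v [qu pu] [qv pv]; rewrite /= qM qu qv mulg1 cocycle_kerM // groupM.
- by move=> u [qu pu] /=; rewrite (finmorV fq) qu invg1 cocycle_kerV // groupV.
have [W [s [fs sP]]] := cocycle_const cphi; set S := (X in closed X).
rewrite (_ : S = s @^-1` (s @` S))%classic; first exact: (@finmor_closed _ _ _ fs).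
apply/seteqP; split=> u /=; first by move=> Su; exists u.
by move=> [v Sv /sP[qq pp]]; rewrite /S /= -qq -pp.
Qed.

End Cocycle_theory.

(* [E] is a spanning tree of the Schreier graph of [Q], and [s y] is the word read
   along the path of the tree from [1] to [y]. *)
Lemma schreier_tree : (forall z, exists f, q f = z) ->
  exists (E : {set Q * 'I_D}) (s : Q -> F), [/\ #|E| < #|Q|, forall y, q (s y) = y &
    forall phi, cocycle phi -> (forall y l, (y, l) \in E -> phi (x l) y = 1) ->
      forall y, phi (s y) 1 = 1].
Proof.
move=> qs; have [qM _] := fq.
have gy : <<[set q (x l) | l : 'I_D]%SET>> = [set: Q]%SET.
  apply/setP=> z; rewrite finset.in_setT; have [f <-] := qs z.
  apply: (free_generated p_pr freeF fq pQ) => i.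
  by apply: mem_gen; apply: imset_f.
(* The tree grows by one vertex at a time, [A] being the set of vertices reached. While [A] is not
   all of [Q] some edge leaves it, because the [q (x l)] generate. *)
suff H0 n : n < #|Q| -> exists (A : {set Q}) (E : {set Q * 'I_D}) (s : Q -> F),
   [/\ #|A| = n.+1, 1 \in A, #|E| <= n & forall y, y \in A -> q (s y) = y /\
    forall phi, cocycle phi -> (forall y l, (y, l) \in E -> phi (x l) y = 1) ->
      phi (s y) 1 = 1].
  have Q0 : 0 < #|Q| by apply/card_gt0P; exists 1.
  have [|A [E [s [An _ En sP]]]] := H0 #|Q|.-1; first by rewrite prednK.
  rewrite prednK // in An.
  have AT y : y \in A.
    have : A == [set: Q]%SET by rewrite finset.eqEcard finset.subsetT cardsT An /=.
    by move/eqP->; rewrite finset.in_setT.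
  exists E, s; split=> [|y|phi cp pE y]; first by rewrite -ltnS prednK in En.
    by have [] := sP y (AT y).
  by have [_] := sP y (AT y); apply.
elim: n => [|n IH] nQ.
  exists (finset.set1 1), finset.set0, (fun=> 1); split; rewrite ?cards1 ?cards0 ?finset.set11 //.
  move=> y /finset.set1P ->; split=> [|phi cp _]; first exact: finmor1.
  exact: cocycle1.
have [A [E [s [An A1 En sP]]]] := IH (ltnW nQ).
have [a [l [aA alA]]] : exists a l, a \in A /\ a * q (x l) \notin A.
  apply: contrapT => H0; suff E0 : A = [set: Q]%SET by move: nQ; rewrite -An E0 cardsT ltnn.
  apply: (gen_mulr_closed gy) => // a l aA; apply: contrapT => /negP alA.
  by apply: H0; exists a, l.
exists ((a * q (x l)) |: A)%SET, ((a, l) |: E)%SET.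
exists (fun y => if y == a * q (x l) then s a * x l else s y); split.
- by rewrite cardsU1 alA An.
- by rewrite finset.in_setU1 A1 orbT.
- by rewrite cardsU1; apply: leq_add (leq_b1 _) En.
have [qsa psa] := sP a aA.
move=> y; rewrite finset.in_setU1; case: eqP => [-> _|_ /= yA].
  split=> [|phi cp pE]; first by rewrite qM qsa.
  rewrite (cocycleM cp) mul1g psa // ?qsa ?mul1g.
    by rewrite pE // finset.setU11.
  by move=> y' l' yl; apply: pE; rewrite finset.in_setU1 yl orbT.
have [q1 p1] := sP y yA; split=> // phi cp pE; apply: p1 => // y' l' yl.
by apply: pE; rewrite finset.in_setU1 yl orbT.
Qed.

(* Each pair of a cocycle and a generator of [K] gets its own edge outside the
   tree. *)
Lemma independent_cocycles (K : {group H}) (J : finType) (k : J -> H) m :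
  (forall z, exists f, q f = z) -> (forall j, k j \in K) -> K \subset <<[set k j | j : J]%SET>> ->
  m * #|J| <= D.-1 * #|Q| ->
  exists phi : 'I_m -> F -> Q -> H, [/\ forall s, cocycle (phi s),
    forall s f y, phi s f y \in K &
    forall kk : 'I_m -> H, (forall s, kk s \in K) ->
      exists u, q u = 1 /\ forall s, phi s u 1 = kk s].
Proof.
move=> qs kK Kk mJ; have [qM _] := fq.
have [E [t [EQ qt tP]]] := schreier_tree qs.
(* At least [D.-1 * #|Q|] of the [D * #|Q|] edges lie outside the tree. *)
have le : #|{: 'I_m * J}| <= #|~: E|.
  rewrite card_prod card_ord cardsCs finset.setCK card_prod card_ord.
  have aux a b n : (b < n -> a.-1 * n <= n * a - b)%N by case: a => [|a] //=; rewrite mulnS mulnC; lia.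
  exact: leq_trans mJ (aux _ _ _ EQ).
pose e (a : 'I_m * J) : Q * 'I_D := enum_val (widen_ord le (enum_rank a)).
have eE a : e a \notin E by have := enum_valP (widen_ord le (enum_rank a)); rewrite inE.
have e_inj : injective e.
  move=> a b /enum_val_inj /(congr1 val) /= /val_inj; exact: enum_rank_inj.
(* Cocycle [s] takes the value [k j] on the edge assigned to [(s, j)] and 1 on every other edge, in
   particular on the tree. *)
pose c s y l := if [pick j | e (s, j) == (y, l)] is Some j then k j else 1.
have cK s y l : c s y l \in K by rewrite /c; case: pickP.
have cE s s' j : c s (e (s', j)).1 (e (s', j)).2 = if s == s' then k j else 1.
  rewrite /c -surjective_pairing; case: pickP => [j' /eqP/e_inj[-> ->]|H0]; first by rewrite eqxx.
  by case: eqP => // Ess; have := H0 j; rewrite Ess eqxx.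
have cT s y l : (y, l) \in E -> c s y l = 1.
  by move=> yE; rewrite /c; case: pickP => // j /eqP ej; have := eE (s, j); rewrite ej yE.
have /fin_all_exists[phi phiP] (s : 'I_m) := cocycle_ex (cK s).
have cp s : cocycle (phi s) by case: (phiP s).
exists phi; split=> [//|s|kk kkK]; first by case: (phiP s).
have tp s y : phi s (t y) 1 = 1.
  by apply: tP => // y' l yE; have [_ _ ->] := phiP s; apply: cT.
(* The Schreier generator of the edge assigned to [(s, j)]. Since the cocycles are trivial along the
   tree, its value is the value on that edge. *)
have gen s j : exists u, q u = 1 /\ forall s', phi s' u 1 = if s' == s then k j else 1.
  pose y := (e (s, j)).1; pose l := (e (s, j)).2.
  have tu : q (t y * x l) = q (t (y * q (x l))) by rewrite qM !qt.
  exists (t y * x l * (t (y * q (x l)))^-1); split.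
    by rewrite qM tu (finmorV fq) mulgV.
  move=> s'; apply: (mulIg (phi s' (t (y * q (x l))) 1)).
  rewrite -cocycle_kerM ?mulgKV //; last by rewrite qM tu (finmorV fq) mulgV.
  rewrite (cocycleM (cp s')) !tp !mul1g mulg1 qt.
  by have [_ _ ->] := phiP s'; rewrite cE.
have single s g : g \in K -> exists u, q u = 1 /\ forall s', phi s' u 1 = if s' == s then g else 1.
  move=> /(fintype.subsetP Kk)/gen_prodgP[n [h hk ->]].
  elim: n h hk => [|n IH] h hk.
    by exists 1; rewrite (finmor1 fq); split=> // s'; rewrite big_ord0 (cocycle1 (cp s')) if_same.
  have [|u [qu pu]] := IH (fun i => h (widen_ord (leqnSn n) i)); first by move=> i; apply: hk.
  have /imsetP[j _ hj] := hk ord_max; have [v [qv pv]] := gen s j.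
  exists (u * v); split=> [|s']; first by rewrite qM qu qv mulg1.
  rewrite cocycle_kerM // pu pv big_ord_recr /= hj.
  by case: eqP => //; rewrite mulg1.
have [u [qu pu]] : exists u, q u = 1 /\
    forall s', phi s' u 1 = if s' \in index_enum 'I_m then kk s' else 1.
  have: uniq (index_enum 'I_m) by apply: index_enum_uniq.
  elim: (index_enum _) => [_|s r IH /= /andP[sr /IH[u [qu pu]]]].
    by exists 1; rewrite (finmor1 fq); split=> // s'; rewrite (cocycle1 (cp s')).
  have [v [qv pv]] := single s (kk s) (kkK s).
  exists (u * v); split=> [|s']; first by rewrite qM qu qv mulg1.
  rewrite cocycle_kerM // pu pv in_cons; case: (eqVneq s' s) => [->|_] /=.
    by rewrite (negPf sr) mul1g.
  by rewrite mulg1.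
by exists u; split=> // s; rewrite pu mem_index_enum.
Qed.

End Cocycles.

Section Iterated_verbal.
Local Open Scope group_scope.
Local Open Scope classical_set_scope.
Variables (G : topGroupType).

Lemma word_value_J (w : seq (nat * bool)) (h : nat -> G) y :
  (word_value w h) ^ y = word_value w (fun n => h n ^ y).
Proof.
rewrite /word_value; elim: w => [|l w IH]; first by rewrite !big_nil conj1g.
rewrite !big_cons conjMg IH; congr (_ * _).
by case: ifP; rewrite ?conjVg.
Qed.

Lemma word_value_in (H : set G) w (h : nat -> G) : subgroup H -> (forall n, H (h n)) ->
  H (word_value w h).
Proof.
move=> [H1 HM HV] Hh; rewrite /word_value; elim: w => [|l w IH]; first by rewrite big_nil.
by rewrite big_cons; apply: HM => //; case: ifP => _; [apply: HV|].
Qed.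

Lemma verbal_normal W (H : set G) : normal_subgroup H -> normal_subgroup (verbal_subgroup W H).
Proof.
move=> nH; apply: topgen_normal => _ y [w [h [Ww Hh ->]]].
exists w, (fun n => h n ^ y); split=> // [n|]; first exact: (proj2 nH).
exact: word_value_J.
Qed.

Lemma verbal_sub W (H : set G) : closed H -> subgroup H -> verbal_subgroup W H `<=` H.
Proof.
by move=> cH gH; apply: topgen_min => // _ [w [h [_ Hh ->]]]; apply: word_value_in.
Qed.

End Iterated_verbal.

Section Filtrations.
Local Open Scope group_scope.
Local Open Scope classical_set_scope.
Variables (p D : nat) (F : topGroupType) (x : 'I_D -> F).
Hypothesis p_pr : prime p.
Hypothesis freeF : free_pro_p_on p x.
Let pF : pro_p p F := proj1 freeF.
Variables (V : nat -> set F).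
Hypothesis fV : filtration V.
Local Notation li := (@lidx p F setT).

Let V_open i : open (V i).
Proof. by have [_ /(_ i)[]] := fV. Qed.
Let V_normal i : normal_subgroup (V i).
Proof. by have [_ /(_ i)[]] := fV. Qed.
Let V1 : \bigcap_i V i = [set 1].
Proof. by case: fV. Qed.

Lemma filtration_desc i j : i <= j -> V j `<=` V i.
Proof.
move=> /subnK <-; elim: (j - i)%N => [|k IH] //; rewrite addSn.
by have [VD _ _] := fV; apply: subset_trans (VD _) IH.
Qed.
Let V_desc := filtration_desc.

(** By torsion-freeness some [V k] misses [f ^+ (p ^ B)], so the image of [f] modulo [V k] has order
    above [p ^ B]. *)
Lemma lidx_unbounded (H : set F) f B : subgroup H -> H f -> f <> 1 ->
  exists k, B < lidx p H (V k).
Proof.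
move=> gH Hf f1; have [M MM] := magnus_ex p_pr freeF.
have := free_torsionfree_expn p_pr freeF MM (k := B) f1.
move=> fB.
have [k Vk] : exists k, ~ V k (f ^+ (p ^ B)%N).
  apply/not_existsP => H0; apply: fB.
  by have : (\bigcap_i V i) (f ^+ (p ^ B)%N); [move=> i _; apply: contrapT | rewrite V1].
exists k; have [gT [q [fq qs qV pT]]] := pro_p_quotient p_pr pF (V_open k) (V_normal k).
rewrite (lidxE p _ fq qV) ltnNge; apply/negP => le; apply: Vk; apply/qV.
rewrite (finmorX fq); apply/eqP; rewrite -order_dvdn.
have /p_natP[a Ea] := pgroupS (finset.subsetT (imgG fq gH)) pT.
apply: (@dvdn_trans #|imgG fq gH|); first by apply: order_dvdG; exact: mem_img.
by rewrite Ea dvdn_exp2l // -(pfactorK a p_pr) -Ea.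
Qed.

Lemma li_mono i j : i <= j -> li (V i) <= li (V j).
Proof.
move=> ij; rewrite (lidx_mono (pro_p_quotient p_pr pF (V_open j) (V_normal j)) (V_normal j) (V_normal i) (V_desc ij)).
exact: leq_addl.
Qed.

Lemma li_unbounded (f : F) B : f <> 1 -> exists i0, forall i, i0 <= i -> B <= li (V i).
Proof.
move=> f1; have gT : subgroup [set: F] by [].
have [i0 Hi0] := lidx_unbounded B gT (f := f) I f1.
by exists i0 => i i0i; apply: leq_trans (ltnW Hi0) (li_mono i0i).
Qed.

End Filtrations.

Section Free_verbal.
Local Open Scope group_scope.
Local Open Scope classical_set_scope.
Variables (p D : nat) (F : topGroupType) (x : 'I_D -> F).
Hypothesis p_pr : prime p.
Hypothesis freeF : free_pro_p_on p x.
Let pF : pro_p p F := proj1 freeF.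
Variables (V : nat -> set F).
Hypothesis vV : iterated_verbal_filtration V.
Local Notation li := (@lidx p F setT).

Let V_open i : open (V i).
Proof. by have [[_ /(_ i)[]]] := vV. Qed.
Let V_normal i : normal_subgroup (V i).
Proof. by have [[_ /(_ i)[]]] := vV. Qed.
Let fV : filtration V.
Proof. by case: vV. Qed.
Let V_desc := filtration_desc fV.

Section Kill.
Variables (Q H : finGroupType) (q : F -> Q) (r : F -> H) (k : nat) (phi : F -> Q -> H).
Hypotheses (fq : finmor q) (fr : finmor r) (qV : forall f, q f = 1 <-> V k f).
Hypotheses (cphi : cocycle q phi) (phiV : forall f y, phi f y \in img r (V k)).

(** On the kernel [V k] of [q], [phi ^~ 1] is a homomorphism into the image of [V k] under [r].
    Homomorphisms respect verbal subgroups, so down the chain its values fall into the images of the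
    later terms. *)
Lemma cocycle_verbal j u : V (j + k) u -> phi u 1 \in img r (V (j + k)).
Proof.
elim: j u => [|j IH] u Vu; first exact: phiV.
have sub n : V (n + k) `<=` V k by apply: V_desc; apply: leq_addl.
have [_ _ /(_ (j + k)%N)[W EW]] := vV; rewrite addSn in Vu *.
have gV := proj1 (V_normal (j + k).+1).
have cS := cocycle_closed_subgroup fq cphi (imgG fr gV).
suff : [set u | q u = 1 /\ phi u 1 \in imgG fr gV] u by case.
move: Vu; rewrite {1}EW; apply: topgen_min cS _ u => _ [w [h [Ww Vh ->]]].
have qh n : q (h n) = 1 by apply/qV/sub/Vh.
have /choice[h' h'P] n : exists h', V (j + k) h' /\ r h' = phi (h n) 1.
  by have /imgP[h' ? ?] := IH _ (Vh n); exists h'.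
have Vw : V (j + k).+1 (word_value w h').
  by rewrite EW; apply: sub_topgen; exists w, h'; split=> // n; case: (h'P n).
have [rM _] := fr; have [qM _] := fq.
suff [qw E] : q (word_value w h) = 1 /\ r (word_value w h') = phi (word_value w h) 1.
  by split=> //=; rewrite -E; exact: mem_img.
rewrite /word_value; elim: w {Ww Vw} => [|l w [IH1 IH2]].
  by rewrite !big_nil (finmor1 fq) (finmor1 fr) (cocycle1 fq cphi).
have [ql E] : q (if l.2 then (h l.1)^-1 else h l.1) = 1 /\
   r (if l.2 then (h' l.1)^-1 else h' l.1) = phi (if l.2 then (h l.1)^-1 else h l.1) 1.
  have [_ E] := h'P l.1; case: ifP => _; last by rewrite qh E.
  by rewrite (finmorV fq) (finmorV fr) qh invg1 E (cocycle_kerV fq cphi).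
by rewrite !big_cons qM rM ql IH1 mulg1 IH2 (cocycle_kerM cphi) // E.
Qed.

End Kill.

(** The truncated difference is the logarithm of the order of [K], the image of [V k] modulo
    [N V_i]. The [m] cocycles map [V k] onto the [m]-th power of [K] and are trivial on [V i]. *)
Lemma verbal_step N k i : 1 < D -> normal_subgroup N -> k <= i ->
  p ^ lidx p N (V k) %/ 2 * (li (mulset N (V i)) - li (mulset N (V k))) + li (V k) <= li (V i).
Proof.
move=> D1 nN ki; set m := _ %/ 2.
have [gT [q [fq qs qV pT]]] := pro_p_quotient p_pr pF (V_open i) (V_normal i).
have [Q [u [fu us uV pQ]]] := pro_p_quotient p_pr pF (V_open k) (V_normal k).
have oNi := open_mulset N (V_open i); have nNi := mulset_normal nN (V_normal i).
have [H [r [fr rs rN pH]]] := pro_p_quotient p_pr pF oNi nNi.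
have gU : subgroup (V k) := proj1 (V_normal k).
pose K := imgG fr gU.
have NVk : mulset (V k) (mulset N (V i)) = mulset N (V k).
  have [[N1 NM NV] NJ] := nN; have [V1 VM VV] := gU.
  apply/seteqP; split=> [_ [v Vv [_ [n Nn [w Vw <-]] <-]]|_ [n Nn [v Vv <-]]].
    exists (n ^ v^-1); first exact: NJ.
    exists (v * w); first by apply: VM => //; apply: (V_desc ki).
    by rewrite conjgE invgK !mulgA mulgKV.
  exists v => //; exists (n ^ v); last by rewrite conjgE mulKVg.
  by exists (n ^ v); [exact: NJ | exists 1; rewrite ?mulg1 //; case: (V_normal i) => -[]].
have hik : li (mulset N (V i)) = (logn p #|K| + li (mulset N (V k)))%N.
  by rewrite (lidx_split (V_normal k) (pro_p_quotient p_pr pF oNi nNi)) NVk (lidxE p _ fr rN).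
have fik : li (V i) = (logn p #|img q (V k)| + li (V k))%N.
  by rewrite (lidx_mono (pro_p_quotient p_pr pF (V_open i) (V_normal i)) (V_normal i) (V_normal k) (V_desc ki)) (lidxE p _ fq qV).
rewrite hik addnK fik leq_add2r.
have gr : <<[set r (x l) | l : 'I_D]%SET>> = [set: H]%SET.
  apply/setP=> z; rewrite finset.in_setT; have [f <-] := rs z.
  apply: (free_generated p_pr freeF fr pH) => l.
  by apply: mem_gen; apply: imset_f.
have [S [SK KS Sn]] := schreier_generators K gr.
have indK : #|[set: H]%SET : K| = (p ^ li (mulset N (V k)))%N.
  have [b Eb] : exists b, #|H| = (p ^ b)%N by have := pH; rewrite /pgroup cardsT => /p_natP[b ->]; exists b.
  have := lidxTE p fr rs rN; rewrite hik Eb pfactorK // => E.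
  have /p_natP[a Ea] := pgroupS (finset.subsetT K) pH.
  apply/eqP; rewrite -(eqn_pmul2l (cardG_gt0 K)) Lagrange ?finset.subsetT // cardsT Eb Ea.
  by rewrite -expnD -E Ea pfactorK.
have indQ : #|Q| = (p ^ (lidx p N (V k) + li (mulset N (V k))))%N.
  rewrite -(lidx_split nN (pro_p_quotient p_pr pF (V_open k) (V_normal k))) (lidxTE p fu us uV).
  by have := pQ; rewrite /pgroup cardsT => /p_natP[b ->]; rewrite pfactorK.
pose kk (j : 'I_#|S|) : H := enum_val j.
have kkK j : kk j \in K by apply: (fintype.subsetP SK); exact: enum_valP.
have Kkk : K \subset <<[set kk j | j : 'I_#|S|]%SET>>.
  apply: fintype.subset_trans KS _; apply: genS; apply/fintype.subsetP => z zS.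
  by apply/imsetP; exists (enum_rank_in zS z); rewrite // /kk enum_rankK_in.
have [|phi [cphi phiK phis]] := independent_cocycles p_pr freeF fu pQ pH (m := m) us kkK Kkk.
  (* [#|Q|] is the index of [V k] in [N V_k] times the index of [K]; the halving in [m] pays for
     [D <= 2 * D.-1]. *)
  rewrite card_ord; apply: (@leq_trans (m * (D * #|[set: H]%SET : K|))); first by rewrite leq_mul2l Sn orbT.
  rewrite indK indQ expnD !mulnA leq_mul2r; apply/orP; right.
  apply: (@leq_trans (m * (2 * D.-1))); first by rewrite leq_mul2l; apply/orP; right; clear -D1; lia.
  rewrite mulnA [X in _ <= X]mulnC leq_mul2r; apply/orP; right.
  exact: leq_trunc_div.
have phiV s v : V i v -> phi s v 1 = 1.
  move=> Vv; have := cocycle_verbal (j := i - k) fu fr uV (cphi s) (phiK s) (u := v).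
  rewrite subnK // => /(_ Vv) /imgP[v' Vv' <-]; apply/rN.
  by apply: mulset_subr Vv'; case: nN => -[].
have uk v : u v = 1 <-> V k v by [].
have /fin_all_exists[g gP] (c : {ffun 'I_m -> H}) : exists v, c \in ffun_on (mem K) ->
    u v = 1 /\ forall s, phi s v 1 = c s.
  case: (boolP (c \in _)) => [/ffun_onP cK|_]; last by exists 1.
  by have [v vP] := phis c cK; exists v.
pose B := [set q (g c) | c in ffun_on (mem K)]%SET.
have cB : #|B| = (#|K| ^ m)%N.
  rewrite card_in_imset ?card_ffun_on ?card_ord //.
  move=> c c' /gP[uc pc] /gP[uc' pc'] /(finmor_eq fq) /qV Vc.
  apply/ffunP => s; rewrite -pc -pc' -[in RHS](mulKVg (g c) (g c')).
  by rewrite (cocycle_kerM (cphi s)) // (phiV s _ Vc) mulg1.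
have BU : B \subset img q (V k).
  by apply/fintype.subsetP => _ /imsetP[c /gP[/uV Vc _] ->]; apply: mem_img.
have := subset_leq_card BU; rewrite cB.
have /p_natP[a Ea] := pgroupS (finset.subsetT K) pH.
have /p_natP[b Eb] := pgroupS (finset.subsetT (imgG fq gU)) pT.
rewrite -[#|img q (V k)|]/#|imgG fq gU| Ea Eb !pfactorK // -expnM leq_exp2l ?prime_gt1 //.
by rewrite mulnC.
Qed.

Lemma verbal_little_o N : 1 < D -> normal_subgroup N -> (exists2 f, N f & f <> 1) ->
  little_o (fun i => li (mulset N (V i))) (fun i => li (V i)).
Proof.
move=> D1 nN [f Nf f1] M.
have [k Hk] := lidx_unbounded p_pr freeF fV (4 * M) (proj1 nN) Nf f1.
have [i0 Hi0] := li_unbounded p_pr freeF fV (2 * M * li (mulset N (V k))) f1.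
exists (maxn k i0) => i; rewrite geq_max => /andP[ki i0i].
have := verbal_step D1 nN ki; set m := _ %/ 2 => st.
have mM : 2 * M <= m.
  rewrite /m leq_divRL // mulnC mulnA; apply: leq_trans (ltnW Hk) _.
  by apply: ltnW; apply: ltn_expl; exact: prime_gt1.
have fi := Hi0 i i0i.
set h := li (mulset N (V i)) in st *; set hk := li (mulset N (V k)) in st fi *.
(* Either [h] is bounded in terms of [k], while [li (V i)] is unbounded, or [h - hk] is at least
   half of [h]. Hence the factors 4 and 2 in the choices of [k] and [i0]. *)
case: (leqP h (2 * hk)) => hh.
  by apply: leq_trans fi; rewrite [(2 * M)%N]mulnC -mulnA leq_mul2l hh orbT.
apply: leq_trans (leq_trans (leq_addr _ _) st).
apply: leq_trans (leq_mul mM (leqnn _)); rewrite -mulnA mulnCA leq_mul2l; apply/orP; right.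
by clear -hh; lia.
Qed.

End Free_verbal.

(** * Direct products *)

Definition toghom (F F' : topGroupType) (h : F -> F') :=
  continuous h /\ {morph h : f g / (f * g)%g}.

Section Homomorphisms.
Local Open Scope group_scope.
Local Open Scope classical_set_scope.
Variables (F F' : topGroupType) (h : F -> F').
Hypothesis hh : toghom h.

Lemma toghom1 : h 1 = 1.
Proof. by have [_ hM] := hh; apply: (mulgI (h 1)); rewrite -hM !mulg1. Qed.

Lemma toghomV : {morph h : f / f^-1}.
Proof. by have [_ hM] := hh; move=> f; apply: (mulgI (h f)); rewrite -hM !mulgV toghom1. Qed.

Lemma toghomJ : {morph h : f g / f ^ g}.
Proof. by have [_ hM] := hh; move=> f g; rewrite !conjgE !hM toghomV. Qed.

Lemma toghomR : {morph h : f g / [~ f, g]}.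
Proof. by have [_ hM] := hh; move=> f g; rewrite commgEl hM toghomV toghomJ -commgEl. Qed.

Lemma toghomX n : {morph h : f / f ^+ n}.
Proof. by have [_ hM] := hh; elim: n => [|n IH] f; rewrite ?expg0 ?toghom1 // !expgS hM IH. Qed.

Lemma toghom_word w k : h (word_value w k) = word_value w (h \o k).
Proof.
have [_ hM] := hh; rewrite /word_value; elim: w => [|l w IH].
  by rewrite !big_nil toghom1.
by rewrite !big_cons hM IH; congr (_ * _); case: ifP; rewrite ?toghomV.
Qed.

Lemma toghom_subgroup (C : set F') : subgroup C -> subgroup (h @^-1` C).
Proof.
have [_ hM] := hh; move=> [C1 CM CV]; split=> [|f g Cf Cg|f Cf]; rewrite /preimage /=.
- by rewrite toghom1.
- by rewrite hM; apply: CM.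
- by rewrite toghomV; apply: CV.
Qed.

Lemma toghom_closed_subgroup (C : set F') : closed_subgroup C -> closed_subgroup (h @^-1` C).
Proof.
move=> [gC cC]; split; first exact: toghom_subgroup.
by apply: closed_comp cC => f _; case: hh => + _; apply.
Qed.

Lemma toghom_normal (C : set F') : normal_subgroup C -> normal_subgroup (h @^-1` C).
Proof.
move=> [gC CJ]; split; first exact: toghom_subgroup.
by move=> f g Cf; rewrite /preimage /= toghomJ; apply: CJ.
Qed.

Lemma toghom_finmor (gT : finGroupType) (q : F' -> gT) : finmor q -> finmor (q \o h).
Proof.
move=> [qM oq]; have [ch hM] := hh; split=> [f g|]; first by rewrite /= hM qM.
by rewrite comp_preimage; apply: open_comp oq => f _; apply: ch.
Qed.

Lemma toghom_verbal W (C : set F) (C' : set F') : closed_subgroup (verbal_subgroup W C') ->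
  (forall f, C f -> C' (h f)) -> forall f, verbal_subgroup W C f -> verbal_subgroup W C' (h f).
Proof.
move=> cC' CC'; apply: (topgen_min (toghom_closed_subgroup cC')) => _ [w [k [Ww Ck ->]]].
rewrite /preimage /= toghom_word; apply: sub_topgen; exists w, (h \o k); split=> // n.
exact: CC'.
Qed.

Lemma toghom_zassenhaus p : prime p -> pro_p p F' ->
  forall i f, zassenhaus p i f -> zassenhaus p i (h f).
Proof.
move=> p_pr pF' i; elim/ltn_ind: i => i IH; case: (leqP i 1) => i1 f.
  by rewrite !zassenhaus01.
apply: (zassenhaus_min p_pr i1 _ _ _ (H := h @^-1` zassenhaus p i)).
- apply: toghom_closed_subgroup; split; first exact: zassenhaus_subgroup pF' _.
  exact: zassenhaus_closed.
- move=> g Zg; rewrite /preimage /= toghomX; apply: zassenhaus_pow => //.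
  by apply: IH => //; exact: ceil_leq.
- move=> a b g k a0 b0 abi Zg Zk; rewrite /preimage /= toghomR -abi.
  by apply: zassenhaus_comm => //; apply: IH => //; lia.
Qed.

Lemma pquot_preim p (C : set F') : (forall g, exists f, h f = g) -> pquot p C ->
  pquot p (h @^-1` C) /\ lidx p setT (h @^-1` C) = lidx p setT C.
Proof.
move=> hs [gT [q [fq qs qC pT]]]; have fqh := toghom_finmor fq.
have qhs z : exists f, (q \o h) f = z.
  by have [g <-] := qs z; have [f <-] := hs g; exists f.
have qhC f : (q \o h) f = 1 <-> (h @^-1` C) f by exact: qC.
split; first by exists gT, (q \o h).
by rewrite (lidxTE p fq qs qC) (lidxTE p fqh qhs qhC).
Qed.

End Homomorphisms.

Section Free_ranks.
Local Open Scope group_scope.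
Local Open Scope classical_set_scope.
Variables (p D : nat) (F : topGroupType) (x : 'I_D -> F).
Hypothesis p_pr : prime p.
Hypothesis freeF : free_pro_p_on p x.

Lemma free_gen_neq1 l : x l <> 1.
Proof.
move=> xl; have [M MM] := magnus_ex p_pr freeF.
have := congr1 (fun a : fps D 'F_p => a [:: l]) (magnus_gen MM l).
rewrite xl (magnus1 MM) fpsD /fvar eqxx fps1 /= => /eqP.
by rewrite GRing.add0r eq_sym GRing.oner_eq0.
Qed.

(** Surplus generators are sent to 1, and the first of them is the nontrivial kernel element. *)
Lemma free_surjection D' (F' : topGroupType) (x' : 'I_D' -> F') :
  free_pro_p_on p x' -> D' <= D -> exists h : F -> F',
  [/\ toghom h, forall g, exists f, h f = g & D' < D -> exists2 f, h f = 1 & f <> 1].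
Proof.
move=> freeF' D'D; have pF' := proj1 freeF'.
pose y (l : 'I_D) : F' := if insub (val l) is Some l' then x' l' else 1.
have [h [[ch hM hx] _]] := proj2 freeF F' y pF'.
have hh : toghom h by split.
exists h; split=> // [g|D'lt]; last first.
  exists (x (Ordinal D'lt)); last exact: free_gen_neq1.
  by rewrite hx /y insubF //= ltnn.
have [cF hF' _ _] := pF'; have [cF0 _ _ _] := proj1 freeF.
have cI : closed_subgroup (range h).
  split.
    split=> [|_ _ [f _ <-] [g' _ <-]|_ [f _ <-]]; first by exists 1 => //; exact: toghom1.
      by exists (f * g').
    by exists f^-1 => //; rewrite (toghomV hh).
  apply: compact_closed => //; apply: continuous_compact => //.
  exact: continuous_subspaceT.
have : topgen (range x') g by rewrite (free_topgen p_pr freeF').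
suff H : range x' `<=` range h by move=> /(topgen_min cI H)[f _ <-]; exists f.
move=> _ [l _ <-]; exists (x (widen_ord D'D l)) => //.
by rewrite hx /y /= insubT //= => lD; congr (x' _); apply: val_inj.
Qed.

(** Freeness gives [p ^ D] homomorphisms to a group of order [p], and these are determined by their
    values on any [m] topological generators. *)
Lemma free_mingen : mingen F = D.
Proof.
have topF : topgen_by F D by exists x; exact: free_topgen p_pr freeF.
have minF m : topgen_by F m -> D <= m.
  move=> [y yF].
  have pZ : p.-group [set: 'Z_p]%SET by rewrite /pgroup cardsT card_ord Zp_cast ?pnat_id // prime_gt1.
  have p2 : #|{: 'Z_p}| = p by rewrite card_ord Zp_cast // prime_gt1.
  have /fin_all_exists[k kP] (c : {ffun 'I_D -> 'Z_p}) : exists k : F -> 'Z_p,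
      finmor k /\ forall i, k (x i) = c i.
    by have [i|k [fk kx _]] := free_hom p_pr freeF (h := c) pZ; [rewrite finset.in_setT | exists k].
  have inj : injective (fun c => [ffun i => k c (y i)] : {ffun 'I_m -> 'Z_p}).
    move=> c c' /ffunP E; apply/ffunP => i; have [fk <-] := kP c; have [fk' <-] := kP c'.
    have fkk := finmor_prodg fk fk'.
    have : topgen (range y) (x i) by rewrite yF.
    pose B : set F := (fun f => (k c f, k c' f)) @^-1` [set zz | zz.1 = zz.2].
    suff cB : closed_subgroup B.
      apply: (topgen_min cB) => _ [j _ <-]; rewrite /B /preimage /=.
      by have := E j; rewrite !ffunE.
    have [kM _] := fk; have [kM' _] := fk'.
    split; last exact: (@finmor_closed _ _ _ fkk).
    split=> [|f g|f]; rewrite /B /preimage /=; first by rewrite !finmor1.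
      by rewrite kM kM' => -> ->.
    by rewrite !finmorV // => ->.
  by have := leq_card _ inj; rewrite !card_ffun p2 !card_ord leq_exp2l // prime_gt1.
rewrite /mingen; apply: xget_unique => [|n [nF nmin]]; first by split.
by apply/eqP; rewrite eqn_leq nmin //= minF.
Qed.

Lemma zassenhaus_filtration : filtration (@zassenhaus F p).
Proof.
have pF := proj1 freeF; split=> [i|i|]; first exact: zassenhaus_desc.
  by split; [exact: zassenhaus_open freeF i | exact: zassenhaus_normal].
apply/seteqP; split=> [f Zf|_ -> i _]; last by case: (zassenhaus_subgroup pF i).
have [M MM] := magnus_ex p_pr freeF; apply: (magnus_inj p_pr freeF MM).
apply/boolp.funext => w; apply/eqP; rewrite -GRing.subr_eq0; apply/eqP.
exact: (magnus_zassenhaus p_pr MM (Zf (size w).+1 I)).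
Qed.

End Free_ranks.

Section Boxes.
Local Open Scope group_scope.
Local Open Scope classical_set_scope.
Variables (r : nat) (F : 'I_r -> topGroupType).
Local Notation G := (prod_topology F).

Definition box (B : forall j, set (F j)) : set G := [set x | forall j, B j (x j)].

Definition inj j (y : F j) : G := mathcomp_extra.dfwith (fun i => 1 : F i) j y.

Lemma inj_in j (y : F j) : inj y j = y.
Proof. exact: dfwithin. Qed.

Lemma inj_out j i (y : F j) : j != i -> inj y i = 1.
Proof. exact: dfwithout. Qed.

Lemma box_inj (B : forall j, set (F j)) j (y : F j) : (forall i, B i 1) -> B j y -> box B (inj y).
Proof.
move=> B1 Bj i; case: (eqVneq j i) => [ji|ji]; last by rewrite inj_out.
by case: i / ji; rewrite inj_in.
Qed.

Lemma toghom_inj j : toghom (@inj j : F j -> G).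
Proof.
split=> [y|y z]; first exact: dfwith_continuous.
apply: functional_extensionality_dep => i; change (inj (y * z) i = inj y i * inj z i).
case: (eqVneq j i) => [ji|ji]; first by case: i / ji; rewrite !inj_in.
by rewrite !inj_out // mulg1.
Qed.

Lemma toghom_proj j : toghom (fun x : G => x j).
Proof. by split=> // x; apply: proj_continuous. Qed.

Lemma prod_compact : (forall j, compact [set: F j]) -> compact [set: G].
Proof.
move=> cF; have := @tychonoff 'I_r F (fun=> setT) cF.
by rewrite (_ : [set f | _] = setT) //; apply/seteqP; split.
Qed.

Lemma box_sub (B : forall j, set (F j)) (C : set G) : subgroup C ->
  (forall j y, B j y -> C (inj y)) -> box B `<=` C.
Proof.
move=> [C1 CM CV] BC x Bx.
pose y (s : seq 'I_r) : G := fun j => if j \in s then x j else 1.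
have : C (y (index_enum 'I_r)).
  elim: (index_enum 'I_r) => [|i s IH].
    by rewrite (_ : y [::] = 1).
  case: (boolP (i \in s)) => is_.
    rewrite (_ : y (i :: s) = y s) //; apply: functional_extensionality_dep => j.
    by rewrite /y in_cons; case: eqP => //= ->; rewrite is_.
  rewrite (_ : y (i :: s) = inj (x i) * y s); first by apply: CM => //; apply: BC.
  apply: functional_extensionality_dep => j.
  change (y (i :: s) j = inj (x i) j * y s j); rewrite /y in_cons.
  case: (eqVneq j i) => [->|ji] /=; first by rewrite inj_in (negPf is_) mulg1.
  by rewrite inj_out ?mul1g // eq_sym.
rewrite (_ : y _ = x) //; apply: functional_extensionality_dep => j.
by rewrite /y mem_index_enum.
Qed.

Lemma box_bigcap (B : forall j, set (F j)) :
  box B = \bigcap_j ((fun x : G => x j) @^-1` B j).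
Proof. by apply/seteqP; split=> x Bx => [j _|j]; apply: Bx. Qed.

Lemma box_closed_subgroup (B : forall j, set (F j)) :
  (forall j, closed_subgroup (B j)) -> closed_subgroup (box B).
Proof.
move=> cB; split; last first.
  rewrite box_bigcap; apply: closed_bigI => j _.
  by have [] := toghom_closed_subgroup (toghom_proj j) (cB j).
have gB j : subgroup (B j) by case: (cB j).
split=> [j|x y Bx By j|x Bx j]; have [B1 BM BV] := gB j; first exact: B1.
  by apply: BM; [apply: Bx | apply: By].
by apply: BV; apply: Bx.
Qed.

Lemma box_subgroup (B : forall j, set (F j)) : (forall j, subgroup (B j)) -> subgroup (box B).
Proof.
move=> gB; split=> [j|x y Bx By j|x Bx j]; have [B1 BM BV] := gB j; first exact: B1.
  by apply: BM; [apply: Bx | apply: By].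
by apply: BV; apply: Bx.
Qed.

Lemma box_normal (B : forall j, set (F j)) :
  (forall j, normal_subgroup (B j)) -> normal_subgroup (box B).
Proof.
move=> nB; split; first by apply: box_subgroup => j; case: (nB j).
by move=> x y Bx j; have [_ BJ] := nB j; apply: BJ; apply: Bx.
Qed.

Lemma box_topgen (A : set G) (B : forall j, set (F j)) :
  (forall j y, B j y -> topgen A (inj y)) -> A `<=` box B ->
  (forall j, closed_subgroup (B j)) -> topgen A = box B.
Proof.
move=> BA AB cB; apply/seteqP; split.
  by apply: topgen_min => //; exact: box_closed_subgroup.
by apply: box_sub => //; case: (topgen_closed_subgroup A).
Qed.

Lemma verbal_box W (B : forall j, set (F j)) : (forall j, subgroup (B j)) ->
  verbal_subgroup W (box B) = box (fun j => verbal_subgroup W (B j)).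
Proof.
move=> gB; apply: box_topgen.
- move=> j y; apply: (toghom_verbal (toghom_inj j)) => [|f Bf].
    exact: topgen_closed_subgroup.
  by apply: box_inj => // i; case: (gB i).
- move=> _ [w [h [Ww Bh ->]]] j; rewrite (toghom_word (toghom_proj j)).
  by apply: sub_topgen; exists w, (fun n => h n j); split=> // n; apply: Bh.
- by move=> j; exact: topgen_closed_subgroup.
Qed.

(** Projections and injections of the factors are continuous homomorphisms, so they respect the
    recursion; closedness in the product comes from compactness. *)
Lemma zassenhaus_box p i : prime p -> (forall j, pro_p p (F j)) ->
  @zassenhaus G p i = box (fun j => zassenhaus p i).
Proof.
move=> p_pr pF.
have cG : compact [set: G] by apply: prod_compact => j; case: (pF j).
have hG : hausdorff_space G by apply: hausdorff_product => j; case: (pF j).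
apply/seteqP; split.
  move=> x Zx j; move: i x Zx; elim/ltn_ind => i IH; case: (leqP i 1) => i1 x.
    by rewrite !zassenhaus01.
  apply: (zassenhaus_min p_pr i1 (H := (fun x : G => x j) @^-1` zassenhaus p i)).
  - apply: (toghom_closed_subgroup (toghom_proj j)); split; last exact: zassenhaus_closed.
    exact: zassenhaus_subgroup.
  - move=> g Zg; rewrite /preimage /= (toghomX (toghom_proj j)).
    by apply: zassenhaus_pow => //; apply: IH => //; exact: ceil_leq.
  - move=> a b g k a0 b0 abi Zg Zk; rewrite /preimage /= (toghomR (toghom_proj j)) -abi.
    by apply: zassenhaus_comm => //; apply: IH => //; lia.
have cZ k : closed_subgroup (@zassenhaus G p k).
  by have [cZ nZ] := @zassenhaus_rec_closed p G k k cG hG; split=> //; case: nZ.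
apply: box_sub => [|j]; first by case: (cZ i).
elim/ltn_ind: i => i IH; case: (leqP i 1) => i1 y; first by rewrite !zassenhaus01.
apply: (zassenhaus_min p_pr i1 (toghom_closed_subgroup (toghom_inj j) (cZ i))).
- move=> g Zg; rewrite /preimage /= (toghomX (toghom_inj j)).
  by apply: zassenhaus_pow => //; apply: IH => //; exact: ceil_leq.
- move=> a b g k a0 b0 abi Zg Zk; rewrite /preimage /= (toghomR (toghom_inj j)) -abi.
  by apply: zassenhaus_comm => //; apply: IH => //; lia.
Qed.

Section Box_index.
Variables (p : nat) (V : forall j, set (F j)).
Arguments V : clear implicits.
Hypothesis p_pr : prime p.
Hypothesis qV : forall j, pquot p (V j).

Lemma box_quotient : exists (gT : 'I_r -> finGroupType) (q : forall j, F j -> gT j),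
  [/\ finmor (fun x : G => [ffun j => q j (x j)] : {dffun forall j, gT j}),
      forall j, finmor (q j), forall j z, exists x, q j x = z, forall j x, q j x = 1 <-> V j x &
      forall j, p.-group [set: gT j]%SET].
Proof.
pose gT j := projT1 (cid (qV j)); have gTP j := projT2 (cid (qV j)).
pose q j : F j -> gT j := projT1 (cid (gTP j)); have qP j := projT2 (cid (gTP j)).
exists gT, q.
have fq j : finmor (q j) by have [] := qP j.
split=> [|//|j|j|j]; try by have [] := qP j.
split=> [x y|].
  by apply/ffunP => j; rewrite !ffunE; have [qM _] := fq j; rewrite -qM.
rewrite (_ : _ @^-1` _ = [set x : G | forall j, j \in index_enum 'I_r -> q j (x j) = 1]).
  elim: (index_enum _) => [|i s IH].
    by rewrite (_ : [set x | _] = setT); [exact: openT | apply/seteqP; split].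
  rewrite (_ : [set x | _] = ((q i \o (fun x : G => x i)) @^-1` [set 1]) `&`
     [set x : G | forall j, j \in s -> q j (x j) = 1]).
    by apply: openI => //; have [] := toghom_finmor (toghom_proj i) (fq i).
  apply/seteqP; split=> x; rewrite /preimage /=.
    move=> H; split; first by apply: H; rewrite mem_head.
    by move=> j js; apply: H; rewrite in_cons js orbT.
  by move=> [Hi Hs] j; rewrite in_cons => /orP[/eqP ->|/Hs].
apply/seteqP; split=> x; rewrite /preimage /=.
  by move=> /ffunP E j _; have := E j; rewrite !ffunE.
by move=> H; apply/ffunP => j; rewrite !ffunE H ?mem_index_enum.
Qed.

Lemma box_pquot : pquot p (box V).
Proof.
have [gT [q [fQ fq qs qK pT]]] := box_quotient.
exists {dffun forall j, gT j}, (fun x : G => [ffun j => q j (x j)]); split=> //.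
- move=> z; have H j := cid (qs j (z j)).
  by exists (fun j => projT1 (H j)); apply/ffunP => j; rewrite ffunE; case: (H j).
- move=> x; split=> [/ffunP E j|Vx].
    by apply/qK; have := E j; rewrite !ffunE.
  by apply/ffunP => j; rewrite !ffunE; apply/qK.
have := cardsXn (fun j => [set: gT j]%SET); rewrite (_ : setXn _ = [set: _]%SET) => [E|].
  rewrite /pgroup E; apply: (big_ind (fun n => p.-nat n)) => // [a b pa pb|j _].
    by rewrite pnatM pa.
  exact: pT.
by apply/setP => z; rewrite finset.in_setT; apply/setXnP => j; rewrite finset.in_setT.
Qed.

Lemma lidx_box (H : forall j, set (F j)) : (forall j, subgroup (H j)) ->
  lidx p (box H) (box V) = (\sum_j lidx p (H j) (V j))%N.
Proof.
move=> gH; have [gT [q [fQ fq qs qK pT]]] := box_quotient.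
rewrite (lidxE p (box H) fQ); last first.
  move=> x; split=> [/ffunP E j|Vx].
    by apply/qK; have := E j; rewrite !ffunE.
  by apply/ffunP => j; rewrite !ffunE; apply/qK.
have -> : img (fun x : G => [ffun j => q j (x j)] : {dffun forall j, gT j}) (box H)
    = setXn (fun j => img (q j) (H j)).
  apply/setP => z; apply/imgP/setXnP => [[x Hx <-] j|Hz].
    by rewrite ffunE; apply: mem_img; apply: Hx.
  have K j : {y | H j y & q j y = z j} by have /imgP/cid2 := Hz j.
  exists (fun j => s2val (K j)); first by move=> j; case: (K j).
  by apply/ffunP => j; rewrite ffunE; case: (K j).
rewrite cardsXn.
have pos j : (0 < #|img (q j) (H j)|)%N by exact: (cardG_gt0 (imgG (fq j) (gH j))).
rewrite [RHS](eq_bigr (fun j => logn p #|img (q j) (H j)|)); last by move=> j _; rewrite (lidxE p _ (fq j) (qK j)).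
suff [] : 0 < (\prod_j #|img (q j) (H j)|)%N /\
  logn p (\prod_j #|img (q j) (H j)|) = (\sum_j logn p #|img (q j) (H j)|)%N by [].
elim/big_rec2: _ => [|j m n _ [IH0 IH]]; first by rewrite logn1.
by rewrite muln_gt0 pos IH0 lognM // IH.
Qed.

End Box_index.

End Boxes.

(** * Abelian groups and the case of rank one *)

Lemma nonincreasing_stationary (u : nat -> nat) : (forall k, u k.+1 <= u k) ->
  exists c k0, forall k, k0 <= k -> u k = c.
Proof.
move=> u_dec; have exP : exists n, `[< exists k, u k = n >] by exists (u 0); apply/asboolP; exists 0.
have [c /asboolP[k0 uk0] cmin] := ex_minnP exP.
exists c, k0 => k /subnK <-; apply/eqP; rewrite eqn_leq; apply/andP; split; last first.
  by apply: cmin; apply/asboolP; eexists.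
elim: (k - k0) => [|n IH]; first by rewrite uk0.
by rewrite addSn (leq_trans (u_dec _)).
Qed.

Definition gpow (G : topGroupType) (n : nat) : set G := range (fun x : G => (x ^+ n)%g).
Arguments gpow : clear implicits.

Section Abelian.
Local Open Scope group_scope.
Local Open Scope classical_set_scope.
Variables (p : nat) (G : topGroupType) (N : set G).
Hypothesis p_pr : prime p.
Hypothesis cG : forall x y : G, x * y = y * x.
Hypothesis gN : subgroup N.
Hypothesis qG : forall k, pquot p (gpow G (p ^ k)).

Local Notation P k := (gpow G (p ^ k)%N).
Local Notation M k := (mulset N (P k)).

Lemma abelian_normal (C : set G) : subgroup C -> normal_subgroup C.
Proof. by move=> gC; split=> // x y Cx; rewrite conjgE [x * y]cG mulKg. Qed.

Lemma expgMc (x y : G) n : (x * y) ^+ n = x ^+ n * y ^+ n.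
Proof. by apply: expgMn; apply: cG. Qed.

Lemma gpow_subgroup n : subgroup (gpow G n).
Proof.
split=> [|_ _ [x _ <-] [y _ <-]|_ [x _ <-]]; first by exists 1; rewrite ?expg1n.
  by exists (x * y); rewrite ?expgMc.
by exists x^-1; rewrite ?expgVn.
Qed.

Let nM k : normal_subgroup (M k).
Proof. by apply: mulset_normal; apply: abelian_normal => //; exact: gpow_subgroup. Qed.

Let qM k : pquot p (M k).
Proof. by apply: pquot_mulset => //; exact: abelian_normal. Qed.

Let gam k := lidx p setT (M k).
Let del k := lidx p (M k) (M k.+1).

Lemma powS k x : M k x -> M k.+1 (x ^+ p).
Proof.
have [N1 NM NV] := gN; move=> [n Nn [_ [y _ <-] <-]]; rewrite expgMc.
exists (n ^+ p); first by elim: (p) => [|m IH]; rewrite ?expg0 ?expgS //; apply: NM.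
by exists ((y ^+ (p ^ k)) ^+ p); rewrite // -expgM -expnSr; exists y.
Qed.

Lemma gamS k : gam k.+1 = (del k + gam k)%N.
Proof.
apply: lidx_mono => // x [n Nn [_ [y _ <-] <-]]; exists n => //.
by exists (y ^+ (p ^ k.+1)) => //; exists (y ^+ p); rewrite // -expgM -expnS.
Qed.

(* [x |-> x ^+ p] induces an epimorphism from [M k / M k.+1] onto
   [M k.+1 / M k.+2]. *)
Lemma del_desc k : del k.+1 <= del k.
Proof.
have [gT [q [fq _ qK pT]]] := qM k.+1; have [hT [q' [fq' _ qK' pT']]] := qM k.+2.
rewrite /del (lidxE p _ fq qK) (lidxE p _ fq' qK').
have /fin_all_exists[s sP] (z : gT) : exists y, z \in img q (M k) -> M k y /\ q y = z.
  case: (boolP (z \in img q (M k))) => [/imgP[y My <-]|_]; last by exists 1.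
  by exists y.
have sub : img q' (M k.+1) \subset [set q' (s z ^+ p) | z in img q (M k)]%SET.
  apply/fintype.subsetP => _ /imgP[_ [n Nn [_ [y _ <-] <-]] <-].
  have My : M k (y ^+ (p ^ k)).
    by exists 1; [case: gN | exists (y ^+ (p ^ k)); rewrite ?mul1g //; exists y].
  apply/imsetP; exists (q (y ^+ (p ^ k))); first exact: mem_img.
  have [|Ms qs] := sP (q (y ^+ (p ^ k))); first exact: mem_img.
  apply/(finmor_eq fq')/qK'; set w := s _ in Ms qs *.
  have /(finmor_eq fq)/qK : q (y ^+ (p ^ k)) = q w by [].
  move/powS; rewrite expgMc => Mw.
  have [[M1 MM MV] _] := nM k.+2; have Mn : M k.+2 n^-1.
    by exists n^-1; [case: gN => _ _; apply | exists 1; rewrite ?mulg1 //; exists 1; rewrite ?expg1n].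
  have := MM _ _ Mn Mw; rewrite expgVn -expgM -expnSr invMg -!mulgA.
  by rewrite [n^-1 * _]cG -!mulgA [w ^+ p * _]cG.
have := leq_trans (subset_leq_card sub) (leq_imset_card _ _).
have /p_natP[a Ea] := pgroupS (finset.subsetT (imgG fq (proj1 (nM k)))) pT.
have /p_natP[b Eb] := pgroupS (finset.subsetT (imgG fq' (proj1 (nM k.+1)))) pT'.
have -> : #|img q (M k)| = (p ^ a)%N := Ea; have -> : #|img q' (M k.+1)| = (p ^ b)%N := Eb.
by rewrite !pfactorK // leq_exp2l // prime_gt1.
Qed.

(** [gam] is a sum of increments [del] that are eventually equal to a constant [c], so it is linear
    up to a bounded error. *)
Lemma abelian_growth : exists c C, forall k,
  (lidx p setT (M k) <= c * k + C /\ c * k <= lidx p setT (M k) + C)%N.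
Proof.
have [c [k0 Hc]] := nonincreasing_stationary del_desc.
exists c, (gam k0 + c * k0)%N => k.
have mono i j : i <= j -> gam i <= gam j.
  move=> /subnK <-; elim: (j - i)%N => [|n IH] //; rewrite addSn gamS.
  exact: leq_trans IH (leq_addl _ _).
rewrite -/(gam k).
case: (leqP k k0) => kk0.
  split; first by apply: leq_trans (mono _ _ kk0) _; rewrite addnCA leq_addr.
  by rewrite addnA (leq_trans _ (leq_addl _ _)) // leq_mul2l kk0 orbT.
suff -> : gam k = (gam k0 + c * (k - k0))%N.
  rewrite mulnBr; have : c * k0 <= c * k by rewrite leq_mul2l ltnW ?orbT.
  by clear; lia.
rewrite -{1}(subnK (ltnW kk0)); elim: (k - k0)%N => [|n IH]; first by rewrite muln0 addn0.
by rewrite addSn gamS IH Hc ?leq_addl // mulnS addnCA.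
Qed.

End Abelian.

Section Rank_one.
Local Open Scope group_scope.
Local Open Scope classical_set_scope.
Variables (p D : nat) (F : topGroupType) (x : 'I_D -> F).
Hypothesis p_pr : prime p.
Hypothesis freeF : free_pro_p_on p x.
Hypothesis D1 : D <= 1.
Let pF : pro_p p F := proj1 freeF.

Lemma rank1_cyclic (gT : finGroupType) (q : F -> gT) : finmor q -> (forall z, exists f, q f = z) ->
  p.-group [set: gT]%SET -> exists g, [set: gT]%SET = <[g]>.
Proof.
move=> fq qs pT; have gen : <<[set q (x l) | l : 'I_D]%SET>> = [set: gT]%SET.
  apply/setP=> z; rewrite finset.in_setT; have [f <-] := qs z.
  by apply: (free_generated p_pr freeF fq pT) => l; apply: mem_gen; apply: imset_f.
case: (posnP D) => D0.
  exists 1; rewrite cycle1 -gen; apply/trivgP; rewrite gen_subG; apply/fintype.subsetP.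
  by move=> z /imsetP[l _ _]; have := leq_ltn_trans (leq0n l) (ltn_ord l); rewrite D0.
exists (q (x (Ordinal D0))); rewrite -gen /cycle; congr <<_>>; apply/setP => z.
rewrite finset.in_set1; apply/imsetP/eqP => [[l _ ->]|->]; last by exists (Ordinal D0).
by congr (q (x _)); apply: val_inj => /=; have := ltn_ord l; clear -D1; lia.
Qed.

Lemma rank1_abelian (f g : F) : f * g = g * f.
Proof.
apply/eqP/negPn/negP => fg; have fg1 : [~ f, g] <> 1 by move=> /eqP/commgP E; case/eqP: fg.
have [gT [q [fq qs pT /eqP qfg]]] := pro_p_residual p_pr pF fg1.
apply: qfg; rewrite (finmorR fq); apply/eqP/commgP.
have [z Ez] := rank1_cyclic fq qs pT.
have cz := cycle_abelian z; rewrite -Ez in cz.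
by apply: (centsP cz); rewrite finset.in_setT.
Qed.

Lemma gpow_closed n : closed (gpow F n).
Proof.
have [cF hF _ _] := pF; apply: compact_closed => //; apply: continuous_compact => //.
apply: continuous_subspaceT; elim: n => [|n IH].
  rewrite (_ : (fun _ => _) = fun=> 1); first by move=> f; apply: cvg_cst.
  by apply/boolp.funext => f; rewrite expg0.
rewrite (_ : (fun _ => _) = fun f : F => f * f ^+ n); last by apply/boolp.funext => f; rewrite expgS.
move=> f; apply: (@continuous_comp _ _ _ (fun f : F => (f, f ^+ n))
  (fun fg : F * F => fg.1 * fg.2)); last exact: mulg_continuous.
by apply: cvg_pair; [exact: cvg_id | exact: IH].
Qed.

Lemma rank1_index C k : open C -> normal_subgroup C -> gpow F (p ^ k) `<=` C -> lidx p setT C <= k.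
Proof.
move=> oC nC PC; have [gT [q [fq qs qC pT]]] := pro_p_quotient p_pr pF oC nC.
rewrite (lidxTE p fq qs qC); have [z Ez] := rank1_cyclic fq qs pT.
have [f qf] := qs z.
rewrite -cardsT Ez -[X in _ <= X](pfactorK k p_pr); apply: dvdn_leq_log.
  by rewrite expn_gt0 prime_gt0.
by rewrite order_dvdn -qf -(finmorX fq); apply/eqP/qC/PC; exists f.
Qed.

Lemma gpow_normal k : normal_subgroup (gpow F (p ^ k)).
Proof. apply: (abelian_normal rank1_abelian); exact: (gpow_subgroup rank1_abelian). Qed.

Lemma gpow_open k : open (gpow F (p ^ k)).
Proof.
apply: (open_of_bounded_index p_pr pF (B := k)) => [||C oC nC]; first exact: gpow_closed.
  exact: gpow_normal.
exact: rank1_index.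
Qed.

(** [C] contains [gpow F (p ^ k)] by Lagrange, and that subgroup has index at most [p ^ k] because
    finite quotients are cyclic; so the two coincide. *)
Lemma rank1_open C : open C -> normal_subgroup C -> C = gpow F (p ^ lidx p setT C).
Proof.
move=> oC nC; set k := lidx p setT C.
have PC : gpow F (p ^ k) `<=` C.
  move=> _ [f _ <-]; have [gT [q [fq qs qC pT]]] := pro_p_quotient p_pr pF oC nC.
  apply/qC; rewrite (finmorX fq); apply/eqP; rewrite -order_dvdn.
  have /p_natP[a Ea] := pT; rewrite /k (lidxTE p fq qs qC) -cardsT Ea pfactorK // -Ea.
  by apply: order_dvdG; rewrite finset.in_setT.
apply/seteqP; split=> // f Cf; apply: contrapT => Pf.
have qP := pro_p_quotient p_pr pF (gpow_open k) (gpow_normal k).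
have := lidx_gt0 p_pr (proj1 nC) qP Cf Pf.
have := rank1_index (gpow_open k) (gpow_normal k) (fun x Hx => Hx).
rewrite (lidx_mono qP (gpow_normal k) nC PC) -/k.
by case: (lidx _ _ _) => // n; rewrite addSn; have := leq_addl n k; clear; lia.
Qed.

End Rank_one.

(** * Hausdorff dimensions as limits of ratios *)

Lemma little_o_add h1 h2 f : little_o h1 f -> little_o h2 f -> little_o (fun i => h1 i + h2 i) f.
Proof.
move=> H1 H2 M; have [i1 {}H1] := H1 (2 * M); have [i2 {}H2] := H2 (2 * M).
exists (maxn i1 i2) => i; rewrite geq_max => /andP[/H1 + /H2].
by rewrite mulnDr -!mulnA; set a := M * h1 i; set b := M * h2 i; lia.
Qed.

Lemma little_o_le h h' f : (forall i, h i <= h' i) -> little_o h' f -> little_o h f.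
Proof.
move=> hh' H M; have [i0 {}H] := H M; exists i0 => i /H; apply: leq_trans.
by rewrite leq_mul2l hh' orbT.
Qed.

Lemma little_o_sum (I : finType) (P : pred I) (h : I -> nat -> nat) f :
  (forall j, P j -> little_o (h j) f) -> little_o (fun i => \sum_(j | P j) h j i) f.
Proof.
move=> H; suff E (s : seq I) : little_o (fun i => \sum_(j <- s | P j) h j i) f by exact: E.
elim: s => [|j s IH].
  by move=> M; exists 0 => i _; rewrite big_nil muln0.
case: (boolP (P j)) => Pj.
  by apply: little_o_le (little_o_add (H j Pj) IH) => i; rewrite big_cons Pj.
by apply: little_o_le IH => i; rewrite big_cons (negPf Pj).
Qed.

Section Ratio.
Import Order.TTheory GRing.Theory Num.Theory numFieldNormedType.Exports.
Local Open Scope ring_scope.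
Local Open Scope classical_set_scope.
Variables (R : realType) (a b f h : nat -> nat) (k t : nat).
Hypotheses (ak : forall i, (k * f i <= a i + h i /\ a i <= k * f i + h i)%N).
Hypotheses (bt : forall i, (t * f i <= b i + h i /\ b i <= t * f i + h i)%N).
Hypotheses (t0 : (0 < t)%N) (ho : little_o h f).
Hypothesis f_gt0 : exists i0, forall i, (i0 <= i -> 0 < f i)%N.

Lemma ratio_cvg : (a i)%:R / (b i)%:R @[i --> \oo] --> (k%:R / t%:R : R).
Proof.
apply/cvgrPdist_le => e e0.
(* The bound makes the error [(t + k) * h / (t * b)] at most [e]; the [.+2] ensures [2 * h <= f],
   hence [f <= 2 * b] and a positive denominator. *)
pose M := (Num.bound (2 * (t + k)%:R / e : R)).+2.
have [i1 H1] := ho M; have [i2 H2] := f_gt0.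
near=> i.
have {H1}H1 : (M * h i <= f i)%N by apply: H1; near: i; exact: nbhs_infty_ge.
have {H2}H2 : (0 < f i)%N by apply: H2; near: i; exact: nbhs_infty_ge.
have [ak1 ak2] := ak i; have [bt1 bt2] := bt i.
set A := a i in ak1 ak2 *; set B := b i in bt1 bt2 *.
set f0 := f i in H1 H2 ak1 ak2 bt1 bt2; set h0 := h i in H1 ak1 ak2 bt1 bt2.
have h2 : (2 * h0 <= f0)%N by apply: leq_trans H1; rewrite leq_mul2r orbT.
have tf : (f0 <= t * f0)%N by rewrite leq_pmull.
have fB : (f0 <= 2 * B)%N by clear -h2 tf bt1; lia.
have B0 : (0 < B)%N by clear -fB H2; lia.
have E1 : (k * B <= t * A + (t + k) * h0)%N.
  have := leq_mul (leqnn t) ak1; have := leq_mul (leqnn k) bt2.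
  rewrite !mulnDr mulnDl mulnCA; clear; lia.
have E2 : (t * A <= k * B + (t + k) * h0)%N.
  have := leq_mul (leqnn t) ak2; have := leq_mul (leqnn k) bt1.
  rewrite !mulnDr mulnDl [(t * (k * _))%N]mulnCA; clear; lia.
have E3 : (M * h0 <= 2 * B)%N := leq_trans H1 fB.
have Me : 2 * (t + k)%:R / e <= M%:R :> R.
  apply: le_trans (ltW (archi_boundP _)) _; last by rewrite ler_nat /M; lia.
  by rewrite divr_ge0 ?mulr_ge0 // ltW.
rewrite ler_pdivrMr // in Me.
have tR : 0 < t%:R :> R by rewrite ltr0n.
have BR : 0 < B%:R :> R by rewrite ltr0n.
have -> : k%:R / t%:R - A%:R / B%:R = (k%:R * B%:R - t%:R * A%:R) / (t%:R * B%:R) :> R.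
  by field; rewrite !lt0r_neq0.
rewrite normrM normfV (gtr0_norm (mulr_gt0 tR BR)) ler_pdivrMr ?mulr_gt0 //.
have M0 : 0 < M%:R :> R by rewrite ltr0n.
have E4 : (t + k)%:R * h0%:R <= e * (t%:R * B%:R) :> R.
  rewrite -(ler_pM2l M0).
  have : M%:R * h0%:R <= 2 * B%:R :> R by rewrite -!natrM ler_nat.
  move/(ler_wpM2l (ler0n R (t + k))) => E.
  apply: (@le_trans _ _ ((t + k)%:R * (2 * B%:R))); first by rewrite mulrCA.
  have -> : (t + k)%:R * (2 * B%:R) = (2 * (t + k)%:R) * B%:R :> R by ring.
  have -> : M%:R * (e * (t%:R * B%:R)) = (M%:R * e) * B%:R * t%:R :> R by ring.
  apply: le_trans (ler_wpM2r (ler0n R B) Me) _.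
  by rewrite ler_peMr ?ler1n // !mulr_ge0 // ltW.
apply: le_trans E4; rewrite ler_norml; apply/andP; split.
  by rewrite lerBrDl lerBlDr -!natrM -natrD ler_nat.
by rewrite lerBlDl -!natrM -natrD ler_nat.
Unshelve. all: by end_near.
Qed.

End Ratio.

Section Hdim.
Import Order.TTheory GRing.Theory Num.Theory numFieldNormedType.Exports.
Local Open Scope ring_scope.
Local Open Scope classical_set_scope.
Variables (R : realType) (p : nat) (G : topGroupType).
Hypothesis p_pr : prime p.

Lemma logp_pow n : logp R p (p ^ n) = n%:R.
Proof.
have p1 : 1 < p%:R :> R by rewrite ltr1n prime_gt1.
rewrite /logp natrX lnXn ?ltr0n ?prime_gt0 // -[ln _ *+ n]mulr_natl mulfK //.
by rewrite gt_eqF // ln_gt0.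
Qed.

Lemma hdim_ratio (S : nat -> set G) (H : set G) f h k t : subgroup H ->
  (forall i, pquot p (S i)) -> (forall i, S i 1%g) ->
  (forall i, (k * f i <= lidx p H (S i) + h i /\ lidx p H (S i) <= k * f i + h i)%N) ->
  (forall i, (t * f i <= lidx p setT (S i) + h i /\ lidx p setT (S i) <= t * f i + h i)%N) ->
  (0 < t)%N -> little_o h f -> (exists i0, forall i, (i0 <= i -> 0 < f i)%N) ->
  hdim R p S H = k%:R / t%:R.
Proof.
move=> gH qS S1 ak bt t0 ho f0; rewrite /hdim.
have cv := ratio_cvg (R := R) ak bt t0 ho f0.
rewrite (_ : (fun i => _) = (fun i => (lidx p H (S i))%:R / (lidx p setT (S i))%:R)).
  by have [-> _] := cvg_limn_inf_sup cv.
apply/boolp.funext => i; have gT : subgroup [set: G] by [].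
rewrite -(lidx_pow p_pr gH (qS i)) -[X in subg_index X _](mulsetT (S1 i)).
by rewrite -(lidx_pow p_pr gT (qS i)) !logp_pow.
Qed.

End Hdim.

(** * The normal spectrum of a direct product *)

Section Spectrum.
Local Open Scope group_scope.
Local Open Scope classical_set_scope.
Variables (R : realType) (p r : nat) (F : 'I_r -> topGroupType) (e : 'I_r -> nat).
Variable x : forall j, 'I_(e j) -> F j.
Arguments x : clear implicits.
Hypothesis p_pr : prime p.
Hypothesis freeF : forall j, free_pro_p_on p (x j).
Variable V : forall j, nat -> set (F j).
Arguments V : clear implicits.
Hypothesis V_open : forall j i, open (V j i).
Hypothesis V_normal : forall j i, normal_subgroup (V j i).
Hypothesis V_hom : forall j j' (h : F j -> F j'), toghom h ->
  forall i f, V j i f -> V j' i (h f).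
Hypothesis V_little_o : forall j (N : set (F j)), 1 < e j -> normal_subgroup N ->
  (exists2 f, N f & f <> 1) ->
  little_o (fun i => lidx p setT (mulset N (V j i))) (fun i => lidx p setT (V j i)).
Hypothesis V_unbounded : forall j B, 0 < e j ->
  exists i0, forall i, i0 <= i -> B <= lidx p setT (V j i).

Local Notation G := (prod_topology F).
Local Notation S := (fun i => box (fun j => V j i)).
Local Notation li := (fun j i => lidx p setT (V j i)).
Let d := \max_j e j.
Let t := #|[pred j | e j == d]|.
Hypothesis d0 : 0 < d.

Let pF j : pro_p p (F j) := proj1 (freeF j).
Let qV j i : pquot p (V j i).
Proof. exact: pro_p_quotient. Qed.

Let gV j i : subgroup (V j i).
Proof. by case: (V_normal j i). Qed.

(** [N] is the kernel of a surjection from [F j] to [F j']. By [V_hom] it carries one chain into the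
    other, so [N V_i] lies in the preimage of the corresponding term for [j']. *)
Lemma index_kernel j j' : e j' <= e j -> exists2 N : set (F j), normal_subgroup N &
  (e j' < e j -> exists2 f, N f & f <> 1) /\
  forall i, li j' i <= lidx p setT (mulset N (V j i)).
Proof.
move=> le; have [h [hh hs hk]] := free_surjection p_pr (freeF j) (freeF j') le.
exists (h @^-1` [set 1]); first by apply: toghom_normal => //; exact: normal_set1.
split=> [|i]; first exact: hk.
have [qp <-] := pquot_preim hh hs (qV j' i).
have nN : normal_subgroup (h @^-1` [set 1]) by apply: toghom_normal => //; exact: normal_set1.
rewrite (lidx_mono (pquot_mulset nN (qV j i)) (mulset_normal nN (V_normal j i)) (toghom_normal hh (V_normal j' i))).
  exact: leq_addl.
move=> _ [n Nn [v Vv <-]]; have [_ hM] := hh; rewrite /preimage /= hM.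
by rewrite (_ : h n = 1) // mul1g; exact: V_hom Vv.
Qed.

Lemma li_mulset j (N : set (F j)) i : normal_subgroup N -> lidx p setT (mulset N (V j i)) <= li j i.
Proof. by move=> nN; rewrite /= (lidx_split nN (qV j i)) leq_addl. Qed.

Lemma li_eq j j' i : e j = e j' -> li j i = li j' i.
Proof.
move=> E; apply/eqP; rewrite eqn_leq; apply/andP; split.
  have [|N nN [_ H]] := @index_kernel j' j; first by rewrite E.
  exact: leq_trans (H i) (li_mulset _ nN).
have [|N nN [_ H]] := @index_kernel j j'; first by rewrite E.
exact: leq_trans (H i) (li_mulset _ nN).
Qed.

Lemma rank0 j : e j = 0 -> forall f : F j, f = 1.
Proof.
move=> e0 f; apply: contrapT => f1; have [gT [q [fq qs pT /eqP qf]]] := pro_p_residual p_pr (pF j) f1.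
apply: qf; have := free_generated (H := [1 gT]%G) p_pr (freeF j) fq pT.
move=> /(_ _ f)/finset.set1P; apply=> l; have := leq_ltn_trans (leq0n l) (ltn_ord l).
by rewrite e0.
Qed.

Lemma li_rank0 j i : e j = 0 -> li j i = 0.
Proof.
move=> e0; have [gT [q [fq qs qK pT]]] := qV j i; rewrite (lidxTE p fq qs qK).
rewrite (_ : #|gT| = 1%N) ?logn1 // -cardsT (_ : [set: gT]%SET = 1) ?cards1 //.
apply/setP => z; rewrite finset.in_setT finset.in_set1; have [f <-] := qs z.
by rewrite (rank0 e0 f) (finmor1 fq) eqxx.
Qed.

(** If [1 < e j'], the kernel of the surjection to [F j] is nontrivial and [V_little_o] applies;
    otherwise [e j = 0] and [F j] is trivial. *)
Lemma li_small j j' : e j < e j' -> little_o (li j) (li j').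
Proof.
move=> lt; case: (ltnP 1 (e j')) => e1.
  have [|N nN [/(_ lt) Nf H]] := @index_kernel j' j; first exact: ltnW.
  exact: little_o_le H (V_little_o e1 nN Nf).
by move=> M; exists 0 => i _; rewrite li_rank0 ?muln0 //; clear -lt e1; lia.
Qed.

Lemma top_factor : exists j0, e j0 = d.
Proof.
case: (pickP 'I_r) => [j0 _|H].
  have [|j E] := @eq_bigmax _ e; first by apply/card_gt0P; exists j0.
  by exists j; rewrite /d E.
by have := d0; rewrite /d big_pred0.
Qed.

Section Main.
Variable j0 : 'I_r.
Hypothesis ej0 : e j0 = d.
Let f := li j0.
Let h i := \sum_(j | e j != d) li j i.

Lemma t_gt0 : 0 < t.
Proof. by rewrite /t; apply/card_gt0P; exists j0; rewrite inE ej0. Qed.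

Lemma li_top j i : e j = d -> li j i = f i.
Proof. by move=> ej; apply: li_eq; rewrite ej ej0. Qed.

Lemma h_little_o : little_o h f.
Proof.
apply: (little_o_sum (h := li)) => j ej; apply: li_small; rewrite ej0 ltn_neqAle ej.
exact: leq_bigmax.
Qed.

Lemma li_box i : lidx p setT (S i) = (t * f i + h i)%N.
Proof.
have -> : [set: G] = box (fun j => [set: F j]) by apply/seteqP; split.
rewrite (lidx_box (fun j => qV j i)) //.
rewrite (bigID (fun j => e j == d)) /=; congr (_ + _)%N.
rewrite (eq_bigr (fun=> f i)) ?sum_nat_const //; first by move=> j /eqP /li_top.
Qed.

Lemma f_unbounded B : exists i0, forall i, i0 <= i -> B <= f i.
Proof. by apply: V_unbounded; rewrite ej0. Qed.

Let S1 i : S i 1. Proof. by move=> j; case: (gV j i). Qed.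
Let qS i : pquot p (S i). Proof. exact: box_pquot. Qed.
Let sub1 j : subgroup [set (1 : F j)]. Proof. by case: (@normal_set1 (F j)). Qed.
Let subT j : subgroup [set: F j]. Proof. by []. Qed.

Lemma spectrum_value (N : set G) h' k : subgroup N -> little_o h' f ->
  (forall i, k * f i <= lidx p N (S i) + h' i /\ lidx p N (S i) <= k * f i + h' i) ->
  hdim R p S N = (k%:R / t%:R)%R.
Proof.
move=> gN ho ak; refine (@hdim_ratio R p G p_pr S N f (fun i => (h' i + h i)%N) k t gN qS S1 _ _ _ _ _).
- by move=> i; have [H1 H2] := ak i; split; rewrite addnA; [apply: leq_trans H1 _|apply: leq_trans H2 _]; apply: leq_addr.
- move=> i; rewrite li_box; split; first by rewrite -addnA leq_addr.
  by rewrite leq_add2l leq_addl.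
- exact: t_gt0.
- exact: little_o_add ho h_little_o.
- exact: f_unbounded 1%N.
Qed.

Lemma lidx1 j i : lidx p [set 1] (V j i) = 0.
Proof.
have [gT [q [fq qs qK pT]]] := qV j i; rewrite (lidxE p _ fq qK).
rewrite (_ : img q [set 1] = 1) ?cards1 ?logn1 //.
apply/setP => z; rewrite finset.in_set1; apply/imgP/eqP => [[_ -> <-]|->]; first exact: finmor1.
by exists 1; rewrite ?(finmor1 fq).
Qed.

(** The witness is the product of [k] factors of maximal rank. *)
Lemma spectrum_ge k : k <= t -> exists N : set G,
  [/\ closed N, normal_subgroup N & hdim R p S N = (k%:R / t%:R)%R].
Proof.
move=> kt; pose J := [set j in take k (enum [pred j | e j == d])]%SET.
have JD j : j \in J -> e j = d.
  by rewrite inE => /mem_take; rewrite mem_enum inE => /eqP.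
have cJ : #|J| = k.
  rewrite cardsE; have /card_uniqP -> : uniq (take k (enum [pred j | e j == d])).
    by apply: take_uniq; exact: enum_uniq.
  by rewrite size_takel // -cardE.
pose B (j : 'I_r) : set (F j) := if j \in J then setT else [set 1].
have nB j : normal_subgroup (B j) by rewrite /B; case: ifP => _ //; exact: normal_set1.
have cB j : closed (B j).
  rewrite /B; case: ifP => _; first exact: closedT.
  by apply: accessible_closed_set1; apply: hausdorff_accessible; case: (pF j).
exists (box B); split; last 1 first.
- apply: (@spectrum_value _ (fun=> 0)); first by apply: box_subgroup => j; case: (nB j).
    by move=> M; exists 0 => i _; rewrite muln0.
  move=> i; rewrite (lidx_box (fun j => qV j i)); last by move=> j; case: (nB j).
  suff -> : (\sum_j lidx p (B j) (V j i))%N = (k * f i)%N by rewrite addn0.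
  rewrite (bigID (mem J)) /= [X in (_ + X)%N]big1 ?addn0.
    rewrite (eq_bigr (fun=> f i)) ?sum_nat_const ?cJ // => j jJ.
    by rewrite /B jJ; apply: li_top; exact: JD.
  by move=> j jJ; rewrite /B (negPf jJ) lidx1.
- by have [] := @box_closed_subgroup _ F B (fun j => conj (proj1 (nB j)) (cB j)).
- exact: box_normal.
Qed.

(** [J] collects the top factors to which [N] projects nontrivially. [N] contains the product of the
    [Nj j] over [J] and lies in the product of the factors that are in [J] or of smaller rank; both
    bounds are [#|J| * f] up to [o(f)]. *)
Lemma spectrum_nonabelian (N : set G) : 1 < d -> normal_subgroup N ->
  exists2 k, k <= t & hdim R p S N = (k%:R / t%:R)%R.
Proof.
move=> d1 nN; have [[N1 NM NV] NJ] := nN.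
pose J := [set j | (e j == d) && `[< exists2 n, N n & n j <> 1 >]]%SET.
have JP j : reflect (e j = d /\ exists2 n, N n & n j <> 1) (j \in J).
  rewrite inE; apply: (iffP andP) => [[/eqP ? /asboolP ?]|[-> ?]] //.
  by split=> //; apply/asboolP.
exists #|J|; first by apply: subset_leq_card; apply/fintype.subsetP => j /JP[ej _]; rewrite inE ej.
pose Nj j : set (F j) := @inj r F j @^-1` N.
have nNj j : normal_subgroup (Nj j) by apply: toghom_normal => //; exact: toghom_inj.
have Nj1 j : j \in J -> exists2 y, Nj j y & y <> 1.
  move=> /JP[ej [n Nn nj]]; have e1 : 1 < e j by rewrite ej.
  have [M MM] := magnus_ex p_pr (freeF j).
  have [l nl] := free_centerless p_pr (freeF j) MM e1 nj.
  exists [~ n j, x j l] => //; rewrite /Nj /preimage /=.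
  (* The commutator of [n] with an element supported in factor [j] is supported there, and it
     belongs to the normal subgroup [N]. *)
  have -> : inj [~ n j, x j l] = [~ n, inj (x j l)] :> G.
    apply: functional_extensionality_dep => i; rewrite (toghomR (toghom_proj F i)).
    case: (eqVneq j i) => [ji|ji]; first by case: i / ji; rewrite !inj_in.
    by rewrite !inj_out // commg1.
  by rewrite commgEl; apply: NM; [exact: NV | exact: NJ].
pose h' i := (\sum_(j in J) lidx p setT (mulset (Nj j) (V j i)) + h i)%N.
apply: (@spectrum_value _ h') => //.
  apply: little_o_add h_little_o.
  apply: (little_o_sum (h := fun j i => lidx p setT (mulset (Nj j) (V j i)))) => j jJ.
  have [ej _] := JP _ jJ; have ho : little_o (fun i => lidx p setT (mulset (Nj j) (V j i))) (li j).
    by apply: V_little_o; [rewrite ej | exact: nNj | exact: Nj1].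
  by move=> M; have [i0 H] := ho M; exists i0 => i /H; rewrite (li_top i ej).
move=> i; split.
  pose B j : set (F j) := if j \in J then Nj j else [set 1].
  have gB j : subgroup (B j) by rewrite /B; case: ifP => _ //; case: (nNj j).
  have BN : box B `<=` N.
    apply: box_sub => // j y; rewrite /B; case: ifP => // _ ->.
    by rewrite (toghom1 (toghom_inj F j)).
  rewrite /h' addnA (leq_trans _ (leq_addr _ _)) //.
  apply: leq_trans (leq_add (lidx_le (box_subgroup gB) (proj1 nN) (qS i) BN) (leqnn _)).
  rewrite (lidx_box (fun j => qV j i) gB) (bigID (mem J)) /= addnAC.
  rewrite (leq_trans _ (leq_addr _ _)) // -big_split /=.
  rewrite -sum_nat_const; apply: leq_sum => j jJ; have [ej _] := JP _ jJ.
  by rewrite /B jJ -(li_top i ej) -(lidx_split (nNj j) (qV j i)).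
pose B j : set (F j) := if (j \in J) || (e j != d) then setT else [set 1].
have gB j : subgroup (B j) by rewrite /B; case: ifP.
have NB : N `<=` box B.
  move=> n Nn j; rewrite /B; case: ifP => // /norP[jJ /negPn/eqP ej] /=.
  by apply: contrapT => nj; case/negP: jJ; apply/JP; split=> //; exists n.
apply: leq_trans (lidx_le (proj1 nN) (box_subgroup gB) (qS i) NB) _.
rewrite (lidx_box (fun j => qV j i) gB) /h' addnCA; apply: leq_trans (leq_addl _ _).
rewrite (bigID (fun j => e j == d)) /= leq_add //; last first.
  by apply: leq_sum => j ej; rewrite /B ej orbT.
rewrite (bigID (mem J)) /= [X in (_ + X)%N]big1 ?addn0; last first.
  by move=> j /andP[ej jJ]; rewrite /B (negPf jJ) ej lidx1.
rewrite -sum_nat_const big_mkcondl [X in _ <= X]big_mkcond.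
rewrite [X in X <= _]big_mkcond /=; apply: leq_sum => j _; case: ifP => // jJ.
by case: ifP => // /eqP ej; rewrite /B jJ /= (li_top i ej).
Qed.

Lemma prod_expg (g : G) n j : (g ^+ n) j = g j ^+ n.
Proof. exact: (toghomX (toghom_proj F j)). Qed.

Lemma box_gpow n : box (fun j => gpow (F j) n) = gpow G n.
Proof.
apply/seteqP; split=> [g Hg|_ [g _ <-] j]; last by exists (g j); rewrite ?prod_expg.
have K j : {y | y ^+ n = g j} by apply: cid; have [y _ <-] := Hg j; exists y.
exists (fun j => sval (K j)) => //.
by apply: functional_extensionality_dep => j; rewrite prod_expg; case: (K j).
Qed.

Lemma spectrum_abelian (N : set G) : d = 1%N -> normal_subgroup N ->
  exists2 k, k <= t & hdim R p S N = (k%:R / t%:R)%R.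
Proof.
move=> d1 nN; have e1 j : e j <= 1 by rewrite -d1; exact: leq_bigmax.
have cG (g g' : G) : g * g' = g' * g.
  by apply: functional_extensionality_dep => j; exact: (rank1_abelian p_pr (freeF j) (e1 j)).
have qG k : pquot p (gpow G (p ^ k)).
  rewrite -box_gpow; apply: box_pquot => j; apply: pro_p_quotient => //.
    exact: (gpow_open p_pr (freeF j) (e1 j)).
  exact: (gpow_normal p_pr (freeF j) (e1 j)).
(* In rank one an open normal subgroup is determined by its index, and the index is the same for all
   nontrivial factors. *)
have SE i : S i = gpow G (p ^ f i).
  rewrite -box_gpow; apply/seteqP; split=> g Hg j; have := Hg j.
    case: (posnP (e j)) => ej; first by rewrite (rank0 ej (g j)) => _; exists 1; rewrite ?expg1n.
    have ejd : e j = d by have := e1 j; rewrite d1; clear -ej; lia.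
    by rewrite {1}(rank1_open p_pr (freeF j) (e1 j) (V_open j i) (V_normal j i)) (li_top i ejd).
  case: (posnP (e j)) => ej; first by rewrite (rank0 ej (g j)) => _; case: (gV j i).
  have ejd : e j = d by have := e1 j; rewrite d1; clear -ej; lia.
  by rewrite [X in _ -> X _](rank1_open p_pr (freeF j) (e1 j) (V_open j i) (V_normal j i)) (li_top i ejd).
have [c [C Hc]] := abelian_growth p_pr cG (proj1 nN) qG.
have b i : (lidx p N (S i) + lidx p setT (mulset N (S i)) = t * f i)%N.
  rewrite -(lidx_split nN (qS i)) li_box /h big1 ?addn0 // => j ej.
  by apply: li_rank0; have := e1 j; move/eqP: ej; rewrite d1; clear; lia.
have ct : c <= t.
  rewrite leqNgt; apply/negP => tc; have [i0 /(_ i0 (leqnn _)) Hi] := f_unbounded C.+1.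
  have [_ H2] := Hc (f i0); rewrite -SE in H2; have := b i0.
  have : (t.+1 * f i0 <= c * f i0)%N by rewrite leq_mul2r tc orbT.
  by rewrite mulSn; clear -H2 Hi; lia.
(* The logarithm of the index of [S i] in [N S_i] is [t * f i] minus that of [N S_i] in [G], which
   is [c * f i] up to a constant. *)
exists (t - c)%N; first exact: leq_subr.
apply: (@spectrum_value _ (fun=> C)); first by case: nN.
  by move=> M; have [i0 H] := f_unbounded (M * C)%N; exists i0.
move=> i; have [H1 H2] := Hc (f i); rewrite -SE in H1 H2; have bi := b i.
rewrite mulnBl; have : (c * f i <= t * f i)%N by rewrite leq_mul2r ct orbT.
by clear -H1 H2 bi; lia.
Qed.

End Main.

Theorem spectrum_box :
  normal_hspec R p S = [set (k%:R / t%:R)%R | k in [set k : nat | k <= t]].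
Proof.
have [j0 ej0] := top_factor.
apply/seteqP; split=> [_ [N [cN nN] <-]|_ [k kt <-]].
  have [k kt ->] : exists2 k, k <= t & hdim R p S N = (k%:R / t%:R)%R.
    case: (ltnP 1 d) => d1; first exact: (spectrum_nonabelian ej0).
    by apply: (spectrum_abelian ej0) => //; move: d0 d1; clear; lia.
  by exists k.
have [N [cN nN <-]] := spectrum_ge ej0 kt.
by exists N.
Qed.

End Spectrum.

(** * Verbal chains of a product and the conclusion *)

Section Verbal_chains.
Local Open Scope group_scope.
Local Open Scope classical_set_scope.

(** Fixing the sets of words makes the filtration functorial: it can be formed in each factor and
    compared along homomorphisms. *)
Fixpoint verbal_chain (W : nat -> set (seq (nat * bool))) (G : topGroupType) i : set G :=
  if i is i'.+1 then verbal_subgroup (W i') (verbal_chain W i') else setT.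
Arguments verbal_chain : clear implicits.

Lemma verbal_chain_closed W G i : closed (verbal_chain W G i).
Proof. by case: i => [|i] /=; [exact: closedT | apply: (proj2 (topgen_closed_subgroup _))]. Qed.

Lemma verbal_chain_normal W G i : normal_subgroup (verbal_chain W G i).
Proof. by elim: i => [|i IH] //=; exact: verbal_normal. Qed.

Lemma verbal_chain_hom W (G G' : topGroupType) (h : G -> G') i g : toghom h ->
  verbal_chain W G i g -> verbal_chain W G' i (h g).
Proof.
move=> hh; elim: i g => [|i IH] //= g; apply: (toghom_verbal hh) => //.
exact: topgen_closed_subgroup.
Qed.

Lemma verbal_chain_box W r (F : 'I_r -> topGroupType) i :
  verbal_chain W (prod_topology F) i = box (fun j => verbal_chain W (F j) i).
Proof.
elim: i => [|i IH] /=; first by apply/seteqP; split.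
by rewrite IH verbal_box // => j; case: (verbal_chain_normal W (F j) i).
Qed.

(** The chain of [F j] is the preimage of the chain of the product under the injection, so openness
    and trivial intersection are inherited. *)
Lemma verbal_chain_factor W r (F : 'I_r -> topGroupType) j :
  filtration (verbal_chain W (prod_topology F)) -> iterated_verbal_filtration (verbal_chain W (F j)).
Proof.
move=> [_ SN S1]; split=> [|//|i]; last by exists (W i).
have SV i : verbal_chain W (F j) i = (@inj r F j) @^-1` verbal_chain W (prod_topology F) i.
  apply/seteqP; split=> y; first by apply: verbal_chain_hom; exact: toghom_inj.
  by rewrite /preimage /= verbal_chain_box => /(_ j); rewrite inj_in.
split=> [i|i|].
- by apply: verbal_sub; [exact: verbal_chain_closed | case: (verbal_chain_normal W (F j) i)].
- split; last exact: verbal_chain_normal.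
  rewrite SV; apply: open_comp; last by case: (SN i).
  by move=> y _; have [ci _] := @toghom_inj r F j; exact: ci.
- apply/seteqP; split=> [y Vy|_ -> i _]; last by case: (verbal_chain_normal W (F j) i) => -[].
  have : (\bigcap_i verbal_chain W (prod_topology F) i) (inj y) by move=> i _; have := Vy i I; rewrite SV.
  rewrite S1 => /(congr1 (fun g : prod_topology F => g j)); by rewrite inj_in.
Qed.

End Verbal_chains.
Arguments verbal_chain : clear implicits.

Local Open Scope classical_set_scope.
Local Open Scope ring_scope.

Theorem theorem1p9 (R : realType) (p r : nat) (F : 'I_r -> topGroupType)
    (G : topGroupType := prod_topology F)
    (d : nat := \max_(j < r) mingen (F j))
    (t : nat := #|[pred j : 'I_r | mingen (F j) == d]|)
    (S : nat -> set G) :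
  prime p ->
  (forall j, fg_free_pro_p p (F j)) ->
  (exists x : G, x <> 1%g) ->
  iterated_verbal_filtration S ->
  normal_hspec R p S = normal_hspec R p (@zassenhaus G p) /\
  normal_hspec R p (@zassenhaus G p)
    = [set k%:R / t%:R | k in [set k : nat | (k <= t)%N]].
Proof.
move=> p_pr freeF [g g1] [fS S0 vS].
pose e j := projT1 (cid (freeF j)); have xP j := projT2 (cid (freeF j)).
pose x j : 'I_(e j) -> F j := projT1 (cid (xP j)).
have freex j : free_pro_p_on p (x j) := projT2 (cid (xP j)).
have me j : mingen (F j) = e j by exact: free_mingen p_pr (freex j).
have Ed : d = (\max_j e j)%N by apply: eq_bigr => j _; exact: me.
have Et : t = #|[pred j | e j == \max_j e j]| by apply: eq_card => j; rewrite !inE me Ed.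
(* If all ranks were 0, the factors and hence the product would be trivial. *)
have d0 : (0 < \max_j e j)%N.
  rewrite lt0n; apply/eqP => E0; apply: g1; apply: functional_extensionality_dep => j.
  apply: (rank0 p_pr freex); apply/eqP; rewrite -leqn0 -E0; exact: leq_bigmax.
have x1 j : (0 < e j)%N -> exists y : F j, y <> 1%g.
  by move=> ej; exists (x j (Ordinal ej)); exact: free_gen_neq1 (freex j) _.
have [W SW] := choice vS.
have {}SW : S = verbal_chain W G.
  by apply/boolp.funext; elim=> [|i IH] //=; rewrite SW IH.
rewrite SW in fS *.
have vV j := @verbal_chain_factor W r F j fS.
have fV j : filtration (verbal_chain W (F j)) by case: (vV j).
have fZ j : filtration (@zassenhaus (F j) p) := zassenhaus_filtration p_pr (freex j).
have -> : verbal_chain W G = (fun i => box (fun j => verbal_chain W (F j) i)).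
  by apply/boolp.funext => i; exact: verbal_chain_box.
have -> : @zassenhaus G p = (fun i => box (fun j => @zassenhaus (F j) p i)).
  by apply/boolp.funext => i; apply: zassenhaus_box => // j; case: (freex j).
rewrite Et; have -> := spectrum_box R p_pr freex (V := fun j => verbal_chain W (F j)).
- have -> // := spectrum_box R p_pr freex (V := fun j => @zassenhaus (F j) p).
  + by move=> j i; have [_ /(_ i)[]] := fZ j.
  + by move=> j i; have [_ /(_ i)[]] := fZ j.
  + move=> j j' h hh i f; apply: (toghom_zassenhaus hh p_pr); by case: (freex j').
  + by move=> j N ej nN Nf; exact: (zassenhaus_little_o p_pr (freex j)).
  + by move=> j B /x1[y y1]; exact: (li_unbounded p_pr (freex j) (fZ j) B y1).
- by move=> j i; have [_ /(_ i)[]] := fV j.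
- by move=> j i; exact: verbal_chain_normal.
- by move=> j j' h hh i f; exact: verbal_chain_hom.
- by move=> j N ej nN Nf; exact: (verbal_little_o p_pr (freex j) (vV j)).
- by move=> j B /x1[y y1]; exact: (li_unbounded p_pr (freex j) (fV j) B y1).
- exact: d0.
Qed.
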